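(* Let $T$ be the Jacobi operator associated to an indeterminate Hamburger moment sequence, $F$ its characteristic line bundle, and let $f(\lambda)$ be any one of the four entries $a(\lambda),b(\lambda),c(\lambda),d(\lambda)$ of the Nevanlinna matrix. Then, as $r\to+\infty$, $$\mathrm{T}_F(r)=T_f(r)+O(\ln r).$$
   Context: Moment problem. Let $s=\{s_i\}_{i=0}^\infty$ be a real sequence with $s_0=1$ that is positive-definite: $\sum_{i,j=0}^n s_{i+j}\xi_i\overline{\xi_j}>0$ for all $n$ and all nonzero $(\xi_0,\dots,\xi_n)\in\mathbb{C}^{n+1}$. It is indeterminate if there is more than one positive Borel measure $\mu$ on $\mathbb{R}$ with $s_i=\int x^i d\mu$ for all $i\ge0$. On polynomials use the inner product determined by $(\lambda^i,\lambda^j)=s_{i+j}$; Gram–Schmidt applied to $1,\lambda,\lambda^2,\dots$ gives the orthonormal polynomials $P_n$ (positive leading coefficient, $P_0\equiv1$), which satisfy $\lambda P_n=a_nP_{n+1}+b_nP_n+a_{n-1}P_{n-1}$ with $a_n>0$, $b_n\in\mathbb{R}$, $P_{-1}\equiv0$. The polynomials of the second kind $Q_n$ are determined by $Q_0\equiv0$, $a_0Q_1=1$, and $\lambda Q_n=a_nQ_{n+1}+b_nQ_n+a_{n-1}Q_{n-1}$ for $n\ge1$. The Jacobi operator $T$ is the closure in $l^2(\mathbb{N}_0)$ of the operator on finite sequences given by $Te_n=a_ne_{n+1}+b_ne_n+a_{n-1}e_{n-1}$, $e_{-1}:=0$. In the indeterminate case $T$ is a densely defined, closed, simple symmetric operator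 with deficiency indices $(1,1)$, and $\ker(T^*-\lambda)$ is one-dimensional for every $\lambda\in\mathbb{C}$. The entries of the Nevanlinna matrix are the entire functions $$a(\lambda)=\lambda\sum_{n\ge0}Q_n(0)Q_n(\lambda),\quad b(\lambda)=-1+\lambda\sum_{n\ge0}Q_n(0)P_n(\lambda),$$ $$c(\lambda)=1+\lambda\sum_{n\ge0}P_n(0)Q_n(\lambda),\quad d(\lambda)=\lambda\sum_{n\ge0}P_n(0)P_n(\lambda).$$ Characteristic line bundle. Let $E_\lambda=\ker(T^*-\lambda)\subset l^2(\mathbb{N}_0)$, a holomorphic line bundle $E$ over $\mathbb{C}$. Let $F^\dag_\lambda=E_{\bar\lambda}$ with the $l^2$ norm and $F_\lambda$ the space of conjugate-linear functionals on $F^\dag_\lambda$ with the dual norm $|\cdot|$. $F$ is a holomorphic Hermitian line bundle over $\mathbb{C}$: a section $\sigma$ is holomorphic iff $\lambda\mapsto\langle\sigma(\lambda),v(\bar\lambda)\rangle$ is holomorphic for every local holomorphic section $v$ of $E$. With $R=\bar\partial\partial\ln|\sigma|^2$ ($\sigma$ any local holomorphic frame) the Chern curvature, $c_1(F)=\frac{\mathrm{i}}{2\pi}R$ and $\mathrm{T}_F(r)=\int_0^r\frac{dt}{t}\int_{\mathbb{D}_t}c_1(F)$, $\mathbb{D}_t=\{|\lambda|<t\}$. Nevanlinna characteristic. For an entire function $f$, $T_f(r)=\frac1{2\pi}\int_0^{2\pi}\ln^+|f(re^{\mathrm{i}\phi})|\,d\phi$, where $\ln^+x=\max\{0,\ln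 x\}$. *)

(* Defs.v *)
(* The copy [R[i]^o] of the complex numbers [R[i]] is the type on which the
   topology and the normed structure of C over itself are inferred. *)
From HB Require Import structures.
From mathcomp Require Import all_boot all_order all_algebra.
From mathcomp Require Import complex.
From mathcomp Require Import all_classical all_reals all_analysis.

Set Implicit Arguments.
Unset Strict Implicit.
Unset Printing Implicit Defensive.

Import Order.TTheory GRing.Theory Num.Theory.
Import numFieldNormedType.Exports.

Local Open Scope classical_set_scope.
Local Open Scope ring_scope.
Local Open Scope complex_scope.

Local Notation Re := complex.Re.
Local Notation Im := complex.Im.
Local Notation cmod := Normc.normc.

Section MomentProblem.
Context {R : realType}.
Implicit Types s : nat -> R.

(* On R[i], [0 < z] means that z is real and positive. *)
Definition positive_definite_seq s : Prop :=
  forall (n : nat) (xi : 'I_n.+1 -> R[i]), (exists i, xi i != 0) ->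
    0 < \sum_(i < n.+1) \sum_(j < n.+1) (s (i + j)%N)%:C * xi i * (xi j)^*%C.

Definition moment_solution s
    (mu : {measure set (measurableTypeR R) -> \bar R}) : Prop :=
  forall i : nat,
    mu.-integrable setT (fun x : measurableTypeR R => ((x : R) ^+ i)%:E) /\
    (\int[mu]_(x in setT) ((x : R) ^+ i)%:E = (s i)%:E)%E.

Definition indeterminate s : Prop :=
  exists mu nu : {measure set (measurableTypeR R) -> \bar R},
    [/\ moment_solution s mu, moment_solution s nu &
        exists2 A : set (measurableTypeR R), measurable A & mu A <> nu A].

(* Since s is real, Gram-Schmidt on 1, X, X^2, ... stays in real polynomials. *)
Definition poly_ip s (p q : {poly R}) : R :=
  \sum_(i < size p) \sum_(j < size q) p`_i * q`_j * s (i + j)%N.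

Fixpoint gram_schmidt s (n : nat) : seq {poly R} :=
  if n is m.+1 then
    let prev := gram_schmidt s m in
    let g := 'X^m - \sum_(p <- prev) poly_ip s 'X^m p *: p in
    rcons prev ((Num.sqrt (poly_ip s g g))^-1 *: g)
  else [::].

(* The orthonormal polynomial P_n. *)
Definition opoly s (n : nat) : {poly R} := nth 0 (gram_schmidt s n.+1) n.

(* The coefficients of X P_n = a_n P_(n+1) + b_n P_n + a_(n-1) P_(n-1), read
   off by orthonormality of the P_n. *)
Definition jacobi_a s (n : nat) : R := poly_ip s ('X * opoly s n) (opoly s n.+1).
Definition jacobi_b s (n : nat) : R := poly_ip s ('X * opoly s n) (opoly s n).

(* The polynomial of the second kind Q_n: the same recurrence for n >= 1, with
   Q_0 = 0 and a_0 Q_1 = 1. *)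
Fixpoint opoly2 s (n : nat) : {poly R} :=
  match n with
  | 0 => 0
  | n'.+1 =>
    match n' with
    | 0 => ((jacobi_a s 0)^-1)%:P
    | m.+1 => (jacobi_a s n')^-1 *:
        ('X * opoly2 s n' - jacobi_b s n' *: opoly2 s n'
         - jacobi_a s m *: opoly2 s m)
    end
  end.

Definition ceval (p : {poly R}) (z : R[i]) : R[i] :=
  (map_poly (real_complex R) p).[z].

Definition csum (u : nat -> R[i]) : R[i] := limn (series (u : nat -> R[i]^o)).

Definition nev_a s (z : R[i]) : R[i] :=
  z * csum (fun n => ceval (opoly2 s n) 0 * ceval (opoly2 s n) z).
Definition nev_b s (z : R[i]) : R[i] :=
  - 1 + z * csum (fun n => ceval (opoly2 s n) 0 * ceval (opoly s n) z).
Definition nev_c s (z : R[i]) : R[i] :=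
  1 + z * csum (fun n => ceval (opoly s n) 0 * ceval (opoly2 s n) z).
Definition nev_d s (z : R[i]) : R[i] :=
  z * csum (fun n => ceval (opoly s n) 0 * ceval (opoly s n) z).

End MomentProblem.

Section OperatorsOnL2.
Context {R : realType}.

Definition is_l2 (x : nat -> R[i]) : Prop :=
  cvgn (series (fun n => cmod (x n) ^+ 2)).

Definition l2norm (x : nat -> R[i]) : R :=
  Num.sqrt (limn (series (fun n => cmod (x n) ^+ 2))).

Definition l2ip (x y : nat -> R[i]) : R[i] := csum (fun n => x n * (y n)^*%C).

(* A (possibly unbounded) operator in l^2 is represented by its graph. *)
Definition l2graph := set ((nat -> R[i]) * (nat -> R[i])).

Definition closure_graph (G : l2graph) : l2graph :=
  [set xy | [/\ is_l2 xy.1, is_l2 xy.2 &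
     forall eps : R, 0 < eps -> exists uv, [/\ G uv,
       l2norm (xy.1 \- uv.1) < eps & l2norm (xy.2 \- uv.2) < eps]]].

Definition adjoint_graph (G : l2graph) : l2graph :=
  [set xy | [/\ is_l2 xy.1, is_l2 xy.2 &
     forall uv, G uv -> l2ip uv.2 xy.1 = l2ip uv.1 xy.2]].

Definition e_ (n : nat) : nat -> R[i] := fun k => (k == n)%:R.

Definition jacobi_e (s : nat -> R) (n : nat) : nat -> R[i] := fun k =>
  (jacobi_a s n)%:C * e_ n.+1 k + (jacobi_b s n)%:C * e_ n k
  + (if n is m.+1 then (jacobi_a s m)%:C * e_ m k else 0).

Definition jacobi_fin (s : nat -> R) : l2graph :=
  [set xy | exists (N : nat) (c : nat -> R[i]),
     xy.1 = (fun k => \sum_(n < N) c n * e_ n k) /\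
     xy.2 = (fun k => \sum_(n < N) c n * jacobi_e s n k)].

Definition jacobi_op (s : nat -> R) : l2graph := closure_graph (jacobi_fin s).

End OperatorsOnL2.

Section LineBundle.
Context {R : realType}.
Implicit Types (T : l2graph (R := R)) (U V : set R[i]^o) (z : R[i]).

(* [fiberE T z] is ker (T^* - z). *)
Definition fiberE T z : set (nat -> R[i]) :=
  [set x | adjoint_graph T (x, fun n => z * x n)].

Definition holomorphic_on U (f : R[i] -> R[i]) : Prop :=
  forall z, U z -> derivable (f : R[i]^o -> R[i]^o) z 1.

Definition l2_holomorphic_on U (v : R[i] -> nat -> R[i]) : Prop :=
  forall z, U z -> is_l2 (v z) /\ exists2 w : nat -> R[i], is_l2 w &
    (fun h : R[i]^o => l2norm (fun n => h^-1 * (v (z + h) n - v z n) - w n))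
      @ (0 : R[i]^o)^' --> (0 : R).

Definition holomorphic_section_E T U (v : R[i] -> nat -> R[i]) : Prop :=
  (forall z, U z -> fiberE T z (v z)) /\ l2_holomorphic_on U v.

Definition conj_linear_on (A : set (nat -> R[i])) (phi : (nat -> R[i]) -> R[i]) :=
  forall (c : R[i]) x y, A x -> A y ->
    phi (fun n => c * x n + y n) = c^*%C * phi x + phi y.

(* A section of F maps z to a conjugate-linear functional on ker (T^* - z^* );
   its values outside that kernel are irrelevant. *)
Definition holomorphic_section_F T U (sigma : R[i] -> (nat -> R[i]) -> R[i]) :=
  (forall z, U z -> conj_linear_on (fiberE T z^*%C) (sigma z)) /\
  (forall V v, open V -> holomorphic_section_E T V v ->
     holomorphic_on (U `&` [set z | V (z^*%C)]) (fun z => sigma z (v z^*%C))).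

(* F has rank one: a frame is a section without zeros. *)
Definition holomorphic_frame_F T U (sigma : R[i] -> (nat -> R[i]) -> R[i]) :=
  holomorphic_section_F T U sigma /\
  (forall z, U z -> exists2 x, fiberE T z^*%C x & sigma z x <> 0).

Definition normF T z (phi : (nat -> R[i]) -> R[i]) : R :=
  sup [set cmod (phi x) | x in [set x | fiberE T z^*%C x /\ l2norm x <= 1]].

Definition partial_x (g : R[i] -> R[i]) z : R[i] :=
  derive1 (fun t : R => Re (g (t +i* Im z))) (Re z) +i*
  derive1 (fun t : R => Im (g (t +i* Im z))) (Re z).
Definition partial_y (g : R[i] -> R[i]) z : R[i] :=
  derive1 (fun t : R => Re (g (Re z +i* t))) (Im z) +i*
  derive1 (fun t : R => Im (g (Re z +i* t))) (Im z).

Definition d_z (g : R[i] -> R[i]) z : R[i] :=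
  (partial_x g z - 'i%C * partial_y g z) / 2.
Definition d_zbar (g : R[i] -> R[i]) z : R[i] :=
  (partial_x g z + 'i%C * partial_y g z) / 2.

(* The coefficient of R = dbar d ln |sigma|^2 with respect to dzbar /\ dz. *)
Definition chern_coef T (sigma : R[i] -> (nat -> R[i]) -> R[i]) z : R[i] :=
  d_zbar (d_z (fun w => (ln (normF T w (sigma w) ^+ 2))%:C)) z.

(* The density of c_1(F) = (i / 2 pi) R with respect to dx /\ dy, computed in
   any holomorphic frame around z; dzbar /\ dz = 2 i dx /\ dy. *)
Definition c1_density T z : R :=
  xget 0 [set k : R | exists U sigma,
    [/\ open U, U z, holomorphic_frame_F T U sigma &
        k = Re ('i%C / (2 * pi)%:C * chern_coef T sigma z * (2 * 'i%C))]].

Definition c1_disc T (t : R) : R :=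
  \int[(lebesgue_measure \x lebesgue_measure)%E]_(
    p in [set p : measurableTypeR R * measurableTypeR R | cmod (p.1 +i* p.2) < t])
    c1_density T (p.1 +i* p.2).

Definition charF T (r : R) : R :=
  \int[lebesgue_measure]_(t in `]0, r[) (c1_disc T t / t).

Definition nevanlinna_char (f : R[i] -> R[i]) (r : R) : R :=
  (2 * pi)^-1 * \int[lebesgue_measure]_(phi in `[0, 2 * pi])
    Num.max 0 (ln (cmod (f (r%:C * (cos phi +i* sin phi))))).

End LineBundle.

(* Main.v *)
(* Write K(z) for the sum of |P_n(z)|^2; indeterminacy makes it finite and
   smooth on C. The fibre E_z is spanned by the sequence (P_n(z)), so a
   holomorphic frame of F has norm |g| / sqrt K with g holomorphic and without
   zeros, and c_1(F) is the Laplacian of ln K divided by 4 pi. By Jensen's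
   formula T_F(r) is half the mean of ln K over the circle of radius r, up to a
   constant. Cauchy-Schwarz bounds |b| and |d| by (1 + c |z|) sqrt K, and the
   Weyl disc estimate gives |Im z| K <= |b d|; since the mean of ln |sin| on a
   circle is finite, ln+ |b| and ln+ |d| both have mean (ln K) / 2 up to
   O(ln r). Finally |Im z| |a| <= |b| and |Im z| |b| <= C (1 + |z|)^2 |a|, and
   likewise for c and d.
   That K is finite at some non-real z follows from Stieltjes inversion: two
   solutions have different Stieltjes transforms at some u + i v, and this
   difference controls the value of a polynomial at u + i v by its norm. *)
Require Import Defs.
From HB Require Import structures.
From mathcomp Require Import all_boot all_order all_algebra.
From mathcomp Require Import complex ring lra.
From mathcomp Require Import all_classical all_reals all_analysis.
From mathcomp Require Import measurable_realfun.

Set Implicit Arguments.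
Unset Strict Implicit.
Unset Printing Implicit Defensive.

Import Order.TTheory GRing.Theory Num.Theory.
Import numFieldNormedType.Exports.

Local Open Scope classical_set_scope.
Local Open Scope ring_scope.
Local Open Scope complex_scope.

Local Notation Re := complex.Re.
Local Notation Im := complex.Im.
Local Notation cmod := Normc.normc.

(** * Complex numbers and complex derivatives *)

(** The curvature is read off an arbitrary frame that is only assumed complex differentiable, so its
    value is independent of the frame only once g'/g is known to be differentiable again. This is
    why Goursat's theorem and Cauchy's formula are needed; they are kept to rectangles and are just
    strong enough to differentiate a holomorphic function twice. Smoothness of K is obtained without
    power series: the exact identity P_w - P_z = (w - z) G_z P_w, with a Hilbert-Schmidt Green
    operator G_z, yields local bounds and then, by iteration, the first two derivatives in l^2.
    Estimates on the four entries are made at finite index n on Wronskians, where they are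
    algebraic, and pass to the limit afterwards. The lower bounds for ln+ |b| and ln+ |d| come from
    the lower bound on their product together with the upper bound on the other factor. Area
    integrals over discs are reduced by Fubini and one-dimensional substitution, so that nearly
    every integral is an oriented integral of a continuous function. *)

Section ComplexBasics.
Context {R : realType}.
Local Notation C := R[i].
Implicit Types z w : C.

Lemma ceqP z w : Re z = Re w -> Im z = Im w -> z = w.
Proof. by case: z => a b; case: w => c d /= -> ->. Qed.
Lemma cReD z w : Re (z + w) = Re z + Re w. Proof. by case: z; case: w. Qed.
Lemma cImD z w : Im (z + w) = Im z + Im w. Proof. by case: z; case: w. Qed.
Lemma cReN z : Re (- z) = - Re z. Proof. by case: z. Qed.
Lemma cImN z : Im (- z) = - Im z. Proof. by case: z. Qed.
Lemma cReM z w : Re (z * w) = Re z * Re w - Im z * Im w.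
Proof. by case: z; case: w. Qed.
Lemma cImM z w : Im (z * w) = Re z * Im w + Im z * Re w.
Proof. by case: z; case: w. Qed.
Lemma cReJ z : Re z^*%C = Re z. Proof. by case: z. Qed.
Lemma cImJ z : Im z^*%C = - Im z. Proof. by case: z. Qed.
Lemma cRe_sum (I : Type) (r : seq I) (P : pred I) (F : I -> C) :
  Re (\sum_(i <- r | P i) F i) = \sum_(i <- r | P i) Re (F i).
Proof. by elim/big_rec2: _ => // i y x _ <-; rewrite cReD. Qed.
Lemma cIm_sum (I : Type) (r : seq I) (P : pred I) (F : I -> C) :
  Im (\sum_(i <- r | P i) F i) = \sum_(i <- r | P i) Im (F i).
Proof. by elim/big_rec2: _ => // i y x _ <-; rewrite cImD. Qed.

Definition cE := (cReD, cImD, cReN, cImN, cReM, cImM, cReJ, cImJ).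

Lemma normcR z : `|z| = (cmod z)%:C. Proof. by case: z. Qed.

Lemma cmod_ge0 z : 0 <= cmod z.
Proof. by case: z => a b /=; rewrite sqrtr_ge0. Qed.
Hint Resolve cmod_ge0 : core.

Lemma cmod_sq z : cmod z ^+ 2 = Re z ^+ 2 + Im z ^+ 2.
Proof. by case: z => a b /=; rewrite sqr_sqrtr// addr_ge0// sqr_ge0. Qed.

Lemma cmodM z w : cmod (z * w) = cmod z * cmod w.
Proof. exact: Normc.normcM. Qed.
Lemma cmodV z : cmod z^-1 = (cmod z)^-1.
Proof. exact: Normc.normcV. Qed.
Lemma cmod0 : cmod (0 : C) = 0. Proof. exact: Normc.normc0. Qed.
Lemma cmod1 : cmod (1 : C) = 1. Proof. exact: Normc.normc1. Qed.
Lemma cmodD z w : cmod (z + w) <= cmod z + cmod w.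
Proof. exact: le_normcD. Qed.
Lemma cmodN z : cmod (- z) = cmod z.
Proof. exact: normcN. Qed.
Lemma cmodB z w : cmod (z - w) <= cmod z + cmod w.
Proof. by rewrite (le_trans (cmodD _ _))// cmodN. Qed.
Lemma cmodC z w : cmod (z - w) = cmod (w - z).
Proof. by rewrite -cmodN opprB. Qed.
Lemma cmodX z n : cmod (z ^+ n) = cmod z ^+ n.
Proof. by elim: n => [|n IH]; rewrite ?expr0 ?cmod1// !exprS cmodM IH. Qed.
Lemma cmod_rc (x : R) : cmod x%:C = `|x|.
Proof. by rewrite /= expr0n addr0 sqrtr_sqr. Qed.
Lemma cmodJ z : cmod z^*%C = cmod z.
Proof. by case: z => a b /=; rewrite sqrrN. Qed.
Lemma cmod_i : cmod ('i%C : C) = 1.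
Proof. by rewrite /= expr0n add0r expr1n sqrtr1. Qed.
Lemma cmod_eq0 z : (cmod z == 0) = (z == 0).
Proof.
by apply/eqP/eqP => [/Normc.eq0_normc//|->]; rewrite cmod0.
Qed.
Lemma cmod_gt0 z : (0 < cmod z) = (z != 0).
Proof. by rewrite lt_neqAle cmod_ge0 andbT eq_sym cmod_eq0. Qed.
Lemma Re_le_cmod z : `|Re z| <= cmod z.
Proof.
by rewrite -(@ler_pXn2r _ 2)// ?nnegrE// cmod_sq real_normK ?num_real// lerDl sqr_ge0.
Qed.
Lemma Im_le_cmod z : `|Im z| <= cmod z.
Proof.
by rewrite -(@ler_pXn2r _ 2)// ?nnegrE// cmod_sq real_normK ?num_real// lerDr sqr_ge0.
Qed.
Lemma cmod_le_ReIm z : cmod z <= `|Re z| + `|Im z|.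
Proof.
rewrite -(@ler_pXn2r _ 2)// ?nnegrE// ?addr_ge0// cmod_sq sqrrD.
rewrite !real_normK ?num_real//.
by rewrite addrAC lerDl mulrn_wge0// mulr_ge0.
Qed.
Lemma mulcJ z : z * z^*%C = (cmod z ^+ 2)%:C.
Proof. by rewrite cmod_sq; apply: ceqP; rewrite !cE /=; ring. Qed.
Lemma cmod_sum (I : Type) (r : seq I) (P : pred I) (F : I -> C) :
  cmod (\sum_(i <- r | P i) F i) <= \sum_(i <- r | P i) cmod (F i).
Proof.
elim/big_rec2: _ => [|i y x _ h]; first by rewrite cmod0.
by rewrite (le_trans (cmodD _ _))// lerD2l.
Qed.
Lemma cmodD_sq z w : cmod (z + w) ^+ 2 <= 2 * (cmod z ^+ 2 + cmod w ^+ 2).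
Proof.
rewrite !cmod_sq !cE.
have := sqr_ge0 (Re z - Re w); have := sqr_ge0 (Im z - Im w); nra.
Qed.
Lemma cmod_triB z w : cmod z - cmod w <= cmod (z - w).
Proof. by rewrite lerBlDr -{1}(subrK w z) cmodD. Qed.

Lemma cconjM z w : (z * w)^*%C = z^*%C * w^*%C. Proof. exact: rmorphM. Qed.
Lemma cconjD z w : (z + w)^*%C = z^*%C + w^*%C. Proof. exact: rmorphD. Qed.
Lemma cconjR (x : R) : (x%:C)^*%C = x%:C. Proof. by apply: ceqP; rewrite //= oppr0. Qed.
Lemma cconjB z w : (z - w)^*%C = z^*%C - w^*%C. Proof. exact: rmorphB. Qed.
Lemma cconjN z : (- z)^*%C = - z^*%C. Proof. exact: rmorphN. Qed.

(** First-order expansion instead of a limit of quotients, so no case [w = z] has to be excluded. It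
    is relative to a set because Goursat's theorem only uses points of a closed rectangle. *)
Definition cdiff_in (S : set C) (f : C -> C) z l := forall e : R, 0 < e ->
  exists2 d : R, 0 < d & forall w, S w -> cmod (w - z) < d ->
    cmod (f w - f z - l * (w - z)) <= e * cmod (w - z).

Definition ccont (f : C -> C) := forall z (e : R), 0 < e ->
  exists2 d : R, 0 < d & forall w, cmod (w - z) < d -> cmod (f w - f z) < e.

(** Balls of [R[i]^o] have radii in [R[i]], where positivity forces a radius to be real; its real
    part is the radius of an ordinary disc. *)
Lemma nbhs_cP (z : C) (P : set C) :
  nbhs (z : R[i]^o) P <-> exists2 d : R, 0 < d & forall w, cmod (w - z) < d -> P w.
Proof.
split.
  case/nbhs_ballP => e /= e0 H; exists (Re e); first by case: e e0 H => a b; rewrite ltcE /= => /andP[].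
  move=> w wd; apply: H; rewrite -ball_normE /= normcR ltcE /= cmodC wd andbT.
  by move: e0; rewrite ltcE /= => /andP[].
case=> d d0 H; apply/nbhs_ballP; exists d%:C; first by rewrite /= ltcR.
by move=> w; rewrite -ball_normE /= normcR ltcR => h; apply: H; rewrite cmodC.
Qed.

Lemma open_cP (U : set C) : open (U : set R[i]^o) <->
  forall z, U z -> exists2 d : R, 0 < d & forall w, cmod (w - z) < d -> U w.
Proof.
rewrite openE; split => H z Uz; first exact/nbhs_cP/H.
exact/nbhs_cP/H.
Qed.

Lemma cvg_dnbhs_cP (f : C -> C) (l : C) :
  ((f : R[i]^o -> R[i]^o) @ (0 : R[i]^o)^' --> (l : R[i]^o)) <->
  forall e : R, 0 < e -> exists2 d : R, 0 < d &
     forall h, h != 0 -> cmod h < d -> cmod (f h - l) < e.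
Proof.
split.
  move=> H e e0.
  have e0' : 0 < e%:C by rewrite ltcR.
  move/cvgrPdist_lt : H => /(_ _ e0'); rewrite near_withinE => /nbhs_cP[d d0 H].
  exists d => // h hn0 hd.
  have := H h; rewrite subr0 => /(_ hd hn0).
  by rewrite normcR ltcR cmodC.
move=> H; apply/cvgrPdist_lt => e e0.
have [d d0 Hd] : exists2 d : R, 0 < d &
     forall h, h != 0 -> cmod h < d -> cmod (f h - l) < Re e.
  by apply: H; move: e0; rewrite ltcE /= => /andP[].
rewrite near_withinE; apply/nbhs_cP; exists d => // w; rewrite subr0 => wd w0.
rewrite normcR cmodC ltcE /= Hd// andbT.
by move: e0; rewrite ltcE /= => /andP[].
Qed.

Lemma derivable_cdiff (f : C -> C) z :
  derivable (f : R[i]^o -> R[i]^o) z 1 <-> exists l, cdiff_in setT f z l.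
Proof.
split.
  move=> /cvg_ex[l /cvg_dnbhs_cP H]; exists l => e e0.
  have [d d0 Hd] := H e e0; exists d => // w _ wd.
  have [->|wz] := eqVneq w z; first by rewrite !subrr mulr0 subrr cmod0 mulr0.
  have wz0 : w - z != 0 by rewrite subr_eq0.
  have /ltW := Hd (w - z) wz0 wd.
  rewrite /= -[(w - z)%:A]/((w - z) * 1) mulr1 subrK -[_ *: _]/(_ * _) => h.
  have -> : f w - f z - l * (w - z) = ((w - z)^-1 * (f w - f z) - l) * (w - z).
    by field.
  by rewrite cmodM ler_wpM2r.
case=> l H; apply/cvg_ex; exists l; apply/cvg_dnbhs_cP => e e0.
have e20 : 0 < e / 2 by rewrite divr_gt0.
have [d d0 Hd] := H _ e20; exists d => // h h0 hd.
have := Hd (z + h) I; rewrite addrAC subrr add0r => /(_ hd) {}Hd.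
rewrite /= -[h%:A]/(h * 1) mulr1 [h + z]addrC.
rewrite -[X in cmod X](mulKf h0) cmodM cmodV -[_ *: _]/(_ * _).
rewrite mulrBr mulVKf// [h * l]mulrC ltr_pdivrMl ?cmod_gt0//.
apply: (le_lt_trans Hd); rewrite mulrC ltr_pM2l ?cmod_gt0//.
by rewrite ltr_pdivrMr// ltr_pMr// ltr1n.
Qed.

End ComplexBasics.
#[global] Hint Resolve cmod_ge0 : core.

(** * Oriented integrals of continuous functions *)

Section RealIntegral.
Context {R : realType}.
Implicit Types f g F : R -> R.
Local Notation mu := (@lebesgue_measure R).

(** One of the two intervals is empty unless a = b, so the difference is the oriented integral.
    Orientation makes additivity and substitution free of order assumptions. *)
Definition RI f (a b : R) : R :=
  \int[mu]_(x in `[a, b]) f x - \int[mu]_(x in `[b, a]) f x.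

Lemma cont_integrable f a b : continuous f ->
  mu.-integrable `[a, b] (EFin \o f).
Proof.
move=> cf; apply: continuous_compact_integrable; first exact: segment_compact.
exact: continuous_subspaceT.
Qed.

Lemma Rint_gt f a b : b < a -> \int[mu]_(x in `[a, b]) f x = 0.
Proof.
by move=> ba; rewrite set_itv_ge ?Rintegral_set0// bnd_simp -ltNge.
Qed.

Lemma Rint_id f a : \int[mu]_(x in `[a, a]) f x = 0.
Proof. by rewrite set_itv1 Rintegral_set1. Qed.

Lemma RI_le f a b : a <= b -> RI f a b = \int[mu]_(x in `[a, b]) f x.
Proof.
rewrite le_eqVlt => /predU1P[->|ab]; rewrite /RI.
  by rewrite Rint_id subrr.
by rewrite [X in _ - X]Rint_gt// subr0.
Qed.

Lemma RI_anti f a b : RI f a b = - RI f b a.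
Proof. by rewrite /RI opprB. Qed.

Lemma RI_id f a : RI f a a = 0.
Proof. by rewrite /RI subrr. Qed.

Lemma Rint_cat f a b c : continuous f -> a <= b -> b <= c ->
  \int[mu]_(x in `[a, c]) f x =
  \int[mu]_(x in `[a, b]) f x + \int[mu]_(x in `[b, c]) f x.
Proof.
move=> cf ab bc; apply/eqP; rewrite addrC -subr_eq; apply/eqP.
rewrite Rintegral_itvB ?bnd_simp//; last exact: cont_integrable.
rewrite Rintegral_itv_obnd_cbnd//.
have S : `]b, c] `<=` `[b, c] by exact: subset_itv_oc_cc.
by apply: integrableS (cont_integrable b c cf).
Qed.

Lemma RI_cat f a b c : continuous f -> RI f a b + RI f b c = RI f a c.
Proof.
move=> cf.
have H x y z : x <= y -> y <= z -> RI f x y + RI f y z = RI f x z.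
  by move=> xy yz; rewrite !RI_le// ?(le_trans xy yz)// -Rint_cat.
have [ab|/ltW ba] := leP a b; have [bc|/ltW cb] := leP b c.
- exact: H.
- have [ac|/ltW ca] := leP a c.
    by rewrite [RI f b c]RI_anti -(H _ _ _ ac cb) addrK.
  by rewrite [RI f b c]RI_anti -(H _ _ _ ca ab) [RI f c a]RI_anti; ring.
- have [ac|/ltW ca] := leP a c.
    by rewrite -(H _ _ _ ba ac) [RI f b a]RI_anti; ring.
  by rewrite [RI f a c]RI_anti [RI f a b]RI_anti -(H _ _ _ bc ca); ring.
- by rewrite [RI f a b]RI_anti [RI f b c]RI_anti [RI f a c]RI_anti -(H _ _ _ cb ba); ring.
Qed.

Lemma is_derive_RI f a (x : R) : continuous f ->
  is_derive x 1 (RI f a) (f x).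
Proof.
(* The unoriented fundamental theorem wants a base point strictly to the left of x; moving the base
   point costs only a constant. *)
move=> cf; pose a' := Num.min a x - 1.
have a'x : a' < x.
  by rewrite /a' ltrBlDr (@le_lt_trans _ _ x)// ?ltrDl// ge_min lexx orbT.
have x1 : x < x + 1 by rewrite ltrDl.
have [dF F'] := continuous_FTC1_closed x1 (cont_integrable a' (x + 1) cf) a'x (cf x).
have H : \forall y \near x, \int[mu]_(t in `[a', y]) f t - RI f a' a = RI f a y.
  near=> y.
  have a'y : a' <= y by apply: ltW; near: y; exact: lt_nbhsr.
  rewrite -RI_le// -(RI_cat a' a y cf); ring.
apply: near_eq_is_derive H _.
rewrite -[f x]subr0; apply: is_deriveB.
by apply: (DeriveDef dF); rewrite -derive1E; exact: F'.
Unshelve. all: by end_near. Qed.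

Lemma is_derive_cont f F : (forall x : R, is_derive x 1 F (f x)) -> continuous F.
Proof.
move=> H x; apply: differentiable_continuous; apply/derivable1_diffP.
by have [] := H x.
Qed.

(** The difference of two primitives has derivative 0. Linearity, scaling and substitution below all
    follow by exhibiting a primitive, without returning to measure theory. *)
Lemma FTC f F a b : continuous f -> (forall x : R, is_derive x 1 F (f x)) ->
  RI f a b = F b - F a.
Proof.
move=> cf dF.
pose G x := RI f a x - F x.
have : G a = G b.
  apply: is_derive_0_is_cst => x; rewrite -(subrr (f x)).
  exact: (is_deriveB (is_derive_RI a x cf)).
by rewrite /G /= RI_id => h; rewrite -[LHS](subrK (F b)) -h; ring.
Qed.

Lemma eq_RI f g a b : f =1 g -> RI f a b = RI g a b.
Proof. by move=> fg; rewrite (_ : f = g)//; apply/funext. Qed.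

Lemma RID f g a b : continuous f -> continuous g ->
  RI (fun x => f x + g x) a b = RI f a b + RI g a b.
Proof.
move=> cf cg.
apply: (etrans (@FTC _ (fun x => RI f a x + RI g a x) _ _ _ _)).
- by move=> x; apply: cvgD; [exact: cf|exact: cg].
- by move=> x; apply: is_deriveD; exact: is_derive_RI.
- by rewrite /= !RI_id addr0 subr0.
Qed.

Lemma RIZ f k a b : continuous f ->
  RI (fun x => k * f x) a b = k * RI f a b.
Proof.
move=> cf.
apply: (etrans (@FTC _ (fun x => k * RI f a x) _ _ _ _)).
- by move=> x; apply: cvgM; [exact: cvg_cst|exact: cf].
- by move=> x; apply: is_deriveZ; exact: is_derive_RI.
- by rewrite /= !RI_id mulr0 subr0.
Qed.

Lemma RIN f a b : continuous f -> RI (fun x => - f x) a b = - RI f a b.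
Proof.
by move=> cf; rewrite -mulN1r -RIZ//; apply: eq_RI => x; rewrite mulN1r.
Qed.

Lemma RI_cst k a b : RI (fun=> k) a b = k * (b - a).
Proof.
apply: (etrans (@FTC _ (fun x => k * x) _ _ _ _)).
- by move=> x; exact: cvg_cst.
- by move=> x; rewrite -[X in is_derive _ _ _ X]mulr1; apply: is_deriveZ.
- by rewrite mulrBr.
Qed.

Lemma RI_subst f g dg a b : continuous f -> continuous dg ->
  (forall x : R, is_derive x 1 g (dg x)) ->
  RI (fun x => f (g x) * dg x) a b = RI f (g a) (g b).
Proof.
move=> cf cdg dgP.
apply: (etrans (@FTC _ (fun x => RI f (g a) (g x)) _ _ _ _)).
- move=> x; apply: cvgM; last exact: cdg.
  by apply: (@continuous_comp _ _ _ g f); [exact: is_derive_cont dgP _|exact: cf].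
- by move=> x; apply: (@is_derive1_comp _ (RI f (g a)) g); exact: is_derive_RI.
- by rewrite /= RI_id subr0.
Qed.

Lemma RI_ge0 f a b : a <= b -> (forall x, a <= x <= b -> 0 <= f x) -> 0 <= RI f a b.
Proof.
by move=> ab f0; rewrite RI_le//; apply: Rintegral_ge0 => x /=; rewrite in_itv/=; exact: f0.
Qed.

Lemma le_RI f g a b : a <= b -> continuous f -> continuous g ->
  (forall x, a <= x <= b -> f x <= g x) -> RI f a b <= RI g a b.
Proof.
move=> ab cf cg fg; rewrite !RI_le//; apply: le_Rintegral => //; try exact: cont_integrable.
Qed.

Lemma RI_abs_le f a b M : a <= b -> continuous f ->
  (forall x, a <= x <= b -> `|f x| <= M) -> `|RI f a b| <= M * (b - a).
Proof.
move=> ab cf fM; rewrite ler_norml -mulNr -!RI_cst.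
have cc k : continuous (fun _ : R => k : R) by move=> x; exact: cvg_cst.
by apply/andP; split; apply: le_RI => // x /fM; rewrite ler_norml => /andP[].
Qed.

Lemma eq_RI_in f g a b : a <= b -> continuous f -> continuous g ->
  (forall x, a <= x <= b -> f x = g x) -> RI f a b = RI g a b.
Proof.
move=> ab cf cg fg.
by apply/eqP; rewrite eq_le; apply/andP; split; apply: le_RI => // x /fg ->.
Qed.

End RealIntegral.

(** * Cauchy's integral formula *)

Section ContourIntegral.
Context {R : realType}.
Local Notation C := R[i].
Implicit Types (m n : R -> C) (h : C -> C).

Definition pcont m := continuous (fun t => Re (m t)) /\ continuous (fun t => Im (m t)).

Definition CI m (a b : R) : C :=
  RI (fun t => Re (m t)) a b +i* RI (fun t => Im (m t)) a b.

Lemma pcontP m : (forall t (e : R), 0 < e -> exists2 d : R, 0 < d &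
   forall s, `|s - t| < d -> cmod (m s - m t) < e) -> pcont m.
Proof.
move=> H; split=> t; apply/cvgrPdist_lt => e e0; have [d d0 Hd] := H t e e0;
  near=> s; (have sd : `|s - t| < d by near: s; apply/nbhs_ballP; exists d => //;
    move=> s /=; rewrite distrC);
  apply: le_lt_trans (Hd _ sd); rewrite distrC.
- by rewrite -cReN -cReD Re_le_cmod.
- by rewrite -cImN -cImD Im_le_cmod.
Unshelve. all: by end_near. Qed.

Lemma ccont_comp h (gam : R -> C) : ccont h ->
  (forall s t, cmod (gam s - gam t) <= `|s - t|) -> pcont (h \o gam).
Proof.
move=> ch lg; apply: pcontP => t e e0; have [d d0 Hd] := ch (gam t) e e0.
by exists d => // s st; apply: Hd; apply: le_lt_trans st.
Qed.

Lemma pcont_cst (k : C) : pcont (fun=> k).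
Proof. by split=> t; exact: cvg_cst. Qed.

Lemma pcontD m n : pcont m -> pcont n -> pcont (fun t => m t + n t).
Proof.
move=> [m1 m2] [n1 n2]; split => t.
- under eq_fun do rewrite cReD. by rewrite ?cReD; apply: cvgD; [exact: m1|exact: n1].
- under eq_fun do rewrite cImD. by rewrite ?cImD; apply: cvgD; [exact: m2|exact: n2].
Qed.

Lemma pcontM m n : pcont m -> pcont n -> pcont (fun t => m t * n t).
Proof.
move=> [m1 m2] [n1 n2]; split => t.
- under eq_fun do rewrite cReM. rewrite ?cReM.
  by apply: cvgB; apply: cvgM; [exact: m1|exact: n1|exact: m2|exact: n2].
- under eq_fun do rewrite cImM. rewrite ?cImM.
  by apply: cvgD; apply: cvgM; [exact: m1|exact: n2|exact: m2|exact: n1].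
Qed.

Lemma pcontN m : pcont m -> pcont (fun t => - m t).
Proof.
move=> cm; have := pcontM (pcont_cst (-1)) cm.
by under eq_fun do rewrite mulN1r.
Qed.

Lemma pcontB m n : pcont m -> pcont n -> pcont (fun t => m t - n t).
Proof. by move=> cm cn; apply: pcontD => //; exact: pcontN. Qed.

Lemma pcont_bounded m a b : pcont m ->
  exists2 M : R, 0 <= M & forall t, a <= t <= b -> cmod (m t) <= M.
Proof.
move=> [m1 m2].
have [|ba] := leP a b; last first.
  by exists 0 => // t /andP[/le_trans h /h]; rewrite leNgt ba.
move=> ab.
have H (f : R -> R) : continuous f -> exists M : R, forall t, a <= t <= b -> `|f t| <= M.
  move=> cf.
  have cf' : {within `[a, b], continuous (fun t => `|f t|)}.
    by apply: continuous_subspaceT => t; apply: cvg_norm; exact: cf.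
  have [c _ Hc] := EVT_max ab cf'.
  by exists `|f c| => t tab; apply: Hc; rewrite in_itv.
have [M1 H1] := H _ m1; have [M2 H2] := H _ m2.
have M1ge : 0 <= M1 by rewrite (le_trans _ (H1 a _))// lexx ab.
have M2ge : 0 <= M2 by rewrite (le_trans _ (H2 a _))// lexx ab.
exists (M1 + M2); first by rewrite addr_ge0.
move=> t tab; apply: le_trans (cmod_le_ReIm _) _.
by rewrite lerD ?H1 ?H2.
Qed.

Lemma eq_CI m n a b : m =1 n -> CI m a b = CI n a b.
Proof. by move=> mn; rewrite (_ : m = n)//; apply/funext. Qed.

Lemma CID m n a b : pcont m -> pcont n ->
  CI (fun t => m t + n t) a b = CI m a b + CI n a b.
Proof.
move=> [m1 m2] [n1 n2]; rewrite /CI.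
by apply: ceqP; rewrite !cE /= -RID//; apply: eq_RI => t; rewrite !cE.
Qed.

Lemma CIZ k m a b : pcont m -> CI (fun t => k * m t) a b = k * CI m a b.
Proof.
move=> [m1 m2].
have cM (c : R) (f : R -> R) : continuous f -> continuous (fun t : R => c * f t).
  by move=> cf t; apply: cvgM; [exact: cvg_cst|exact: cf].
apply: ceqP; rewrite !cE /=.
- rewrite -!RIZ// -RIN; last exact: cM.
  rewrite -RID; last 2 first; [exact: cM| | by apply: eq_RI => t; rewrite !cE].
  by move=> t; apply: cvgN; apply: cM.
- rewrite -!RIZ// -RID; [|exact: cM|exact: cM].
  by apply: eq_RI => t; rewrite !cE.
Qed.

Lemma CIN m a b : pcont m -> CI (fun t => - m t) a b = - CI m a b.
Proof.
by move=> cm; rewrite -mulN1r -CIZ//; apply: eq_CI => x; rewrite mulN1r.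
Qed.

Lemma CIB m n a b : pcont m -> pcont n ->
  CI (fun t => m t - n t) a b = CI m a b - CI n a b.
Proof. by move=> cm cn; rewrite CID// ?CIN//; exact: pcontN. Qed.

Lemma CI_cat m a b c : pcont m -> CI m a b + CI m b c = CI m a c.
Proof. by move=> [m1 m2]; apply: ceqP; rewrite !cE /= RI_cat. Qed.

Lemma CI_cst k a b : CI (fun=> k) a b = k * (b - a)%:C.
Proof. by rewrite /CI !RI_cst; apply: ceqP; rewrite !cE /=; ring. Qed.

(** The factor 2 comes from estimating the real and the imaginary part separately; only the order of
    magnitude matters later. *)
Lemma CI_bound m a b M : a <= b -> pcont m ->
  (forall t, a <= t <= b -> cmod (m t) <= M) -> cmod (CI m a b) <= 2 * M * (b - a).
Proof.
move=> ab [m1 m2] H; apply: le_trans (cmod_le_ReIm _) _ => /=.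
rewrite -mulrA mulr_natl mulr2n lerD// RI_abs_le// => t /H; apply: le_trans.
- exact: Re_le_cmod.
- exact: Im_le_cmod.
Qed.

Definition hline (y t : R) : C := t +i* y.
Definition vline (x t : R) : C := x +i* t.

Lemma hl_dist y s t : cmod (hline y s - hline y t) = `|s - t|.
Proof. by rewrite /hline -cmod_rc; congr cmod; apply: ceqP; rewrite !cE //= subrr. Qed.
Lemma vl_dist x s t : cmod (vline x s - vline x t) = `|s - t|.
Proof.
have -> : vline x s - vline x t = 'i%C * (s - t)%:C.
  by apply: ceqP; rewrite !cE /=; ring.
by rewrite cmodM cmod_rc cmod_i mul1r.
Qed.

Definition bcont h a b c d := [/\ pcont (fun t => h (hline c t)), pcont (fun t => h (hline d t)),
  pcont (fun t => h (vline a t)) & pcont (fun t => h (vline b t))].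

(** The counterclockwise integral of h dz over the boundary of the rectangle; the factor ['i] is dz
    / dt on the vertical sides. *)
Definition rect_int h (a b c d : R) : C :=
  CI (fun t => h (hline c t)) a b - CI (fun t => h (hline d t)) a b +
  'i%C * (CI (fun t => h (vline b t)) c d - CI (fun t => h (vline a t)) c d).

Lemma ccont_h h y : ccont h -> pcont (fun t => h (hline y t)).
Proof. by move=> ch; apply: ccont_comp => // s t; rewrite hl_dist. Qed.
Lemma ccont_v h y : ccont h -> pcont (fun t => h (vline y t)).
Proof. by move=> ch; apply: ccont_comp => // s t; rewrite vl_dist. Qed.

Lemma ccont_bcont h a b c d : ccont h -> bcont h a b c d.
Proof.
by move=> ch; split; (exact: ccont_h || exact: ccont_v).
Qed.

Lemma JB h k a b c d : bcont h a b c d -> bcont k a b c d ->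
  rect_int (fun z => h z - k z) a b c d = rect_int h a b c d - rect_int k a b c d.
Proof.
by move=> [h1 h2 h3 h4] [k1 k2 k3 k4]; rewrite /rect_int !CIB//; ring.
Qed.

Lemma JZ u h a b c d : bcont h a b c d ->
  rect_int (fun z => u * h z) a b c d = u * rect_int h a b c d.
Proof. by move=> [h1 h2 h3 h4]; rewrite /rect_int !CIZ//; ring. Qed.

Lemma rect_int_splitx h a b c d e : ccont h -> rect_int h a b c d = rect_int h a e c d + rect_int h e b c d.
Proof.
move=> ch; rewrite /rect_int -!(@CI_cat _ a e b); first [exact: ccont_h|ring].
Qed.

Lemma rect_int_splity h a b c d e : ccont h -> rect_int h a b c d = rect_int h a b c e + rect_int h a b e d.
Proof.
move=> ch; rewrite /rect_int -!(@CI_cat _ c e d); first [exact: ccont_v|ring].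
Qed.

Lemma ccont_affine (u v : C) : ccont (fun z => u + v * z).
Proof.
have v1 : 0 < cmod v + 1 by have := cmod_ge0 v; lra.
move=> z e e0; exists (e / (cmod v + 1)); first exact: divr_gt0.
move=> w wz; have -> : u + v * w - (u + v * z) = v * (w - z) by ring.
rewrite cmodM; apply: (@le_lt_trans _ _ ((cmod v + 1) * cmod (w - z))).
  by rewrite ler_wpM2r// lerDl.
by rewrite mulrC -ltr_pdivlMr.
Qed.

(** Goursat's argument subtracts a first-order Taylor polynomial, so affine functions are the only
    ones whose contour integral must be computed by hand. *)
Lemma rect_int_affine (u v : C) a b c d : rect_int (fun z => u + v * z) a b c d = 0.
Proof.
have hh y : pcont (fun t => u + v * hline y t) := ccont_h y (ccont_affine u v).
have hv x : pcont (fun t => u + v * vline x t) := ccont_v x (ccont_affine u v).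
rewrite /rect_int -(CIB _ _ (hh c) (hh d)) -(CIB _ _ (hv b) (hv a)).
have -> : CI (fun t => u + v * hline c t - (u + v * hline d t)) a b =
   v * 'i%C * (c - d)%:C * (b - a)%:C.
  rewrite -CI_cst; apply: eq_CI => t.
  by apply: ceqP; rewrite !cE /=; ring.
have -> : CI (fun t => u + v * vline b t - (u + v * vline a t)) c d =
   v * (b - a)%:C * (d - c)%:C.
  rewrite -CI_cst; apply: eq_CI => t.
  by apply: ceqP; rewrite !cE /=; ring.
by rewrite !rmorphB /=; ring.
Qed.

Lemma rect_int_bound h a b c d M : a <= b -> c <= d -> bcont h a b c d ->
  (forall z, a <= Re z <= b -> c <= Im z <= d -> cmod (h z) <= M) ->
  cmod (rect_int h a b c d) <= 4 * M * ((b - a) + (d - c)).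
Proof.
move=> ab cd [h1 h2 h3 h4] hM; rewrite /rect_int.
have B1 : cmod (CI (fun t => h (hline c t)) a b) <= 2 * M * (b - a).
  by apply: CI_bound => // t tab; apply: hM => //=; rewrite lexx cd.
have B2 : cmod (CI (fun t => h (hline d t)) a b) <= 2 * M * (b - a).
  by apply: CI_bound => // t tab; apply: hM => //=; rewrite lexx cd.
have B3 : cmod (CI (fun t => h (vline a t)) c d) <= 2 * M * (d - c).
  by apply: CI_bound => // t tab; apply: hM => //=; rewrite lexx ab.
have B4 : cmod (CI (fun t => h (vline b t)) c d) <= 2 * M * (d - c).
  by apply: CI_bound => // t tab; apply: hM => //=; rewrite lexx ab.
apply: le_trans (cmodD _ _) _; rewrite cmodM cmod_i mul1r.
apply: le_trans (lerD (cmodB _ _) (cmodB _ _)) _.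
lra.
Qed.

End ContourIntegral.

(** * Goursat's theorem on rectangles *)

Section Goursat.
Context {R : realType}.
Local Notation C := R[i].
Implicit Types (h : C -> C).

Definition rect (a b c d : R) : set C := [set z | a <= Re z <= b /\ c <= Im z <= d].

(* One bisection step keeps a quarter carrying at least a quarter of |rect_int|. *)
Let quarter h (r : R * R * R * R) : R * R * R * R :=
  let: (a, b, c, d) := r in
  let m := (a + b) / 2 in let n := (c + d) / 2 in
  let big r' := let: (a', b', c', d') := r' in
    cmod (rect_int h a b c d) <= 4 * cmod (rect_int h a' b' c' d') in
  if big (a, m, c, n) then (a, m, c, n) else
  if big (a, m, n, d) then (a, m, n, d) else
  if big (m, b, c, n) then (m, b, c, n) else (m, b, n, d).

Let midpoint (a b : R) : a <= b ->
  [/\ a <= (a + b) / 2, (a + b) / 2 <= b, (a + b) / 2 - a = (b - a) / 2 &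
      b - (a + b) / 2 = (b - a) / 2].
Proof. by move=> ab; split; lra. Qed.

Let quarter_sum (x1 x2 x3 x4 y z w : R) : 4 * x1 < w -> 4 * x2 < w -> 4 * x3 < w ->
  4 * x4 < w -> w <= y + z -> y <= x1 + x2 -> z <= x3 + x4 -> False.
Proof. by move=> *; lra. Qed.

Let quarterP h a b c d : ccont h -> a <= b -> c <= d ->
  let: (a', b', c', d') := quarter h (a, b, c, d) in
  [/\ cmod (rect_int h a b c d) <= 4 * cmod (rect_int h a' b' c' d'),
      a <= a' /\ b' <= b, c <= c' /\ d' <= d,
      b' - a' = (b - a) / 2 & d' - c' = (d - c) / 2].
Proof.
move=> ch ab cd; rewrite /quarter.
have E : rect_int h a b c d = rect_int h a ((a + b) / 2) c ((c + d) / 2)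
   + rect_int h a ((a + b) / 2) ((c + d) / 2) d + (rect_int h ((a + b) / 2) b c ((c + d) / 2)
   + rect_int h ((a + b) / 2) b ((c + d) / 2) d).
  rewrite (rect_int_splitx a b c d ((a + b) / 2) ch).
  by rewrite (rect_int_splity a ((a + b) / 2) c d ((c + d) / 2) ch)
    (rect_int_splity ((a + b) / 2) b c d ((c + d) / 2) ch).
have [a1 a2 a3 a4] := midpoint ab; have [c1 c2 c3 c4] := midpoint cd.
case: ifPn => [B1|/negP B1]; first by split; [exact: B1|split|split|exact: a3|exact: c3].
case: ifPn => [B2|/negP B2]; first by split; [exact: B2|split|split|exact: a3|exact: c4].
case: ifPn => [B3|/negP B3]; first by split; [exact: B3|split|split|exact: a4|exact: c3].
split; [|by split|by split|exact: a4|exact: c4].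
rewrite leNgt; apply/negP => B4.
move/negP: B1; rewrite -ltNge => B1; move/negP: B2; rewrite -ltNge => B2.
move/negP: B3; rewrite -ltNge => B3.
have := cmodD (rect_int h a ((a + b) / 2) c ((c + d) / 2)) (rect_int h a ((a + b) / 2) ((c + d) / 2) d).
have := cmodD (rect_int h ((a + b) / 2) b c ((c + d) / 2)) (rect_int h ((a + b) / 2) b ((c + d) / 2) d).
have := cmodD (rect_int h a ((a + b) / 2) c ((c + d) / 2) + rect_int h a ((a + b) / 2) ((c + d) / 2) d)
  (rect_int h ((a + b) / 2) b c ((c + d) / 2) + rect_int h ((a + b) / 2) b ((c + d) / 2) d).
rewrite -E => h1 h2 h3; exact: quarter_sum B1 B2 B3 B4 h1 h3 h2.
Qed.

Lemma nested_intervals (a b : nat -> R) :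
  (forall n, a n <= a n.+1) -> (forall n, b n.+1 <= b n) -> (forall n, a n <= b n) ->
  exists p, forall n, a n <= p <= b n.
Proof.
move=> ai bd ab.
have amono m n : (m <= n)%N -> a m <= a n.
  by move=> /subnK <-; elim: (n - m)%N => //= k IH; rewrite (le_trans IH).
have bmono m n : (m <= n)%N -> b n <= b m.
  by move=> /subnK <-; elim: (n - m)%N => //= k IH; exact: le_trans (bd _) IH.
have abmn m n : a m <= b n.
  rewrite (le_trans (amono m (maxn m n) (leq_maxl _ _)))//.
  by rewrite (le_trans (ab _))// bmono// leq_maxr.
exists (sup (range a)) => n; apply/andP; split.
- apply: ub_le_sup; last by exists n.
  by exists (b 0%N) => _ [m _ <-]; exact: abmn.
- apply: ge_sup; first by exists (a 0%N), 0%N.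
  by move=> _ [m _ <-]; exact: abmn.
Qed.

Theorem goursat h a b c d : ccont h -> a <= b -> c <= d ->
  (forall z, rect a b c d z -> exists l, cdiff_in (rect a b c d) h z l) ->
  rect_int h a b c d = 0.
Proof.
move=> ch ab cd hd; apply/eqP; apply: contraT => J0.
pose r n := iter n (quarter h) (a, b, c, d).
pose an n := (r n).1.1.1; pose bn n := (r n).1.1.2.
pose cn n := (r n).1.2; pose dn n := (r n).2.
have rS n : r n.+1 = quarter h (an n, bn n, cn n, dn n).
  by rewrite /r iterS /an /bn /cn /dn /r; case: (iter n _ _) => [[[? ?] ?] ?].
have inv n : [/\ an n <= bn n, cn n <= dn n,
    bn n - an n = (b - a) / 2 ^+ n, dn n - cn n = (d - c) / 2 ^+ n &
    cmod (rect_int h a b c d) <= 4 ^+ n * cmod (rect_int h (an n) (bn n) (cn n) (dn n))].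
  elim: n => [|n [i1 i2 i3 i4 i5]]; first by rewrite expr0 !divr1 mul1r.
  have := quarterP ch i1 i2; rewrite -rS /an /bn /cn /dn.
  case: (r n.+1) => [[[a' b'] c'] d'] /= [q1 q2 q3 q4 q5].
  have E x : x / 2 ^+ n / 2 = x / 2 ^+ n.+1 :> R by rewrite exprSr invfM mulrA.
  rewrite q4 q5 -/(an n) -/(bn n) -/(cn n) -/(dn n) i3 i4 !E; split => //.
  - by rewrite -subr_ge0 q4 divr_ge0// subr_ge0.
  - by rewrite -subr_ge0 q5 divr_ge0// subr_ge0.
  - apply: le_trans i5 _; rewrite exprSr -mulrA ler_wpM2l// exprn_ge0//.
have mono n : [/\ an n <= an n.+1, bn n.+1 <= bn n, cn n <= cn n.+1 & dn n.+1 <= dn n].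
  have [i1 i2 _ _ _] := inv n.
  have := quarterP ch i1 i2; rewrite -rS /an /bn /cn /dn.
  by case: (r n.+1) => [[[a' b'] c'] d'] /= [_ [? ?] [? ?] _ _].
have [p Hp] : exists p, forall n, an n <= p <= bn n.
  by apply: nested_intervals; move=> n; [have [] := mono n|have [] := mono n|have [] := inv n].
have [q Hq] : exists p, forall n, cn n <= p <= dn n.
  by apply: nested_intervals; move=> n; [have [] := mono n|have [] := mono n|have [] := inv n].
have sub n z : rect (an n) (bn n) (cn n) (dn n) z -> rect a b c d z.
  elim: n => // n IH [/andP[h1 h2] /andP[h3 h4]]; apply: IH.
  have [m1 m2 m3 m4] := mono n.
  by split; apply/andP; split; [exact: le_trans m1 _|exact: le_trans m2|
    exact: le_trans m3 _|exact: le_trans m4].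
have zr n : rect (an n) (bn n) (cn n) (dn n) (p +i* q) by split => /=.
have [l Hl] := hd _ (sub 0%N _ (zr 0%N)).
pose W := (b - a) + (d - c).
have W0 : 0 <= W by rewrite addr_ge0// subr_ge0.
have Jp : 0 < cmod (rect_int h a b c d) by rewrite cmod_gt0.
(* W is half the perimeter. After n bisections the integral is at most 4^n * 4 * (e W / 2^n) * (W /
   2^n) = 4 e W^2, so this e yields the contradiction. *)
have [e e0 He] : exists2 e : R, 0 < e & 4 * e * W ^+ 2 < cmod (rect_int h a b c d).
  exists (cmod (rect_int h a b c d) / (4 * (W ^+ 2 + 1))).
    by rewrite divr_gt0// mulr_gt0// ltr_wpDl// sqr_ge0.
  have W1 : 0 < W ^+ 2 + 1 by rewrite ltr_wpDl// sqr_ge0.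
  rewrite (_ : 4 * _ * _ = cmod (rect_int h a b c d) * (W ^+ 2 / (W ^+ 2 + 1))); last first.
    by field; rewrite gt_eqF.
  by rewrite gtr_pMr// ltr_pdivrMr// mul1r ltrDl.
have [de de0 Hde] := Hl e e0.
have [n Hn] : exists n, W / 2 ^+ n < de.
  have h2 : `|2^-1 : R| < 1 by rewrite gtr0_norm// invf_lt1// ltr1n.
  have := cvg_geometric W h2; move/cvgrPdist_lt => /(_ _ de0)[n _ Hn].
  exists n; have := Hn n (leqnn _); rewrite sub0r normrN /= exprVn ger0_norm//.
  by rewrite divr_ge0// exprn_ge0.
have [i1 i2 i3 i4 i5] := inv n.
have E2 : 4 ^+ n = (2 ^+ n) ^+ 2 :> R by rewrite -exprM mulnC exprM; congr (_ ^+ n); rewrite expr2; ring.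
have dist z : rect (an n) (bn n) (cn n) (dn n) z -> cmod (z - (p +i* q)) <= W / 2 ^+ n.
  move=> [/andP[h1 h2] /andP[h3 h4]]; apply: le_trans (cmod_le_ReIm _) _.
  rewrite /W mulrDl -i3 -i4 !cE /=; have /andP[p1 p2] := Hp n; have /andP[q1 q2] := Hq n.
  by apply: lerD; rewrite ler_norml; lra.
(* The Taylor polynomial at the limit point of the nested rectangles; subtracting it leaves the
   contour integrals unchanged and makes the integrand o(diameter). *)
pose aff z := h (p +i* q) - l * (p +i* q) + l * z.
have ca : ccont aff by apply: ccont_affine.
have Jn : rect_int h (an n) (bn n) (cn n) (dn n) = rect_int (fun z => h z - aff z) (an n) (bn n) (cn n) (dn n).
  by rewrite JB ?rect_int_affine ?subr0//; exact: ccont_bcont.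
have cha : ccont (fun z => h z - aff z).
  move=> z ep ep0; have ep2 : 0 < ep / 2 by rewrite divr_gt0.
  have [d1 d10 H1] := ch z _ ep2; have [d2 d20 H2] := ca z _ ep2.
  exists (Num.min d1 d2); first by rewrite lt_min d10.
  move=> w; rewrite lt_min => /andP[/H1 k1 /H2 k2].
  have -> : h w - aff w - (h z - aff z) = (h w - h z) - (aff w - aff z) by ring.
  by have := cmodB (h w - h z) (aff w - aff z); lra.
have : cmod (rect_int h (an n) (bn n) (cn n) (dn n)) <= 4 * (e * (W / 2 ^+ n)) * (W / 2 ^+ n).
  rewrite Jn [X in _ <= _ * X](_ : _ = (bn n - an n) + (dn n - cn n)); last by rewrite i3 i4 /W mulrDl.
  apply: rect_int_bound => //; first exact: ccont_bcont.
  move=> z z1 z2; have zrn : rect (an n) (bn n) (cn n) (dn n) z by split.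
  have := Hde z (sub n z zrn) (le_lt_trans (dist z zrn) Hn).
  have -> : h z - h (p +i* q) - l * (z - (p +i* q)) = h z - aff z by rewrite /aff; ring.
  move=> /le_trans; apply; rewrite ler_wpM2l//; first exact: ltW.
  exact: dist.
move=> Bn.
have p2n : 0 < (2 ^+ n : R) by rewrite exprn_gt0.
have : cmod (rect_int h a b c d) <= 4 * e * W ^+ 2.
  apply: le_trans i5 _; rewrite E2.
  rewrite (_ : 4 * e * W ^+ 2 = (2 ^+ n) ^+ 2 * (4 * (e * (W / 2 ^+ n)) * (W / 2 ^+ n))).
    by rewrite ler_wpM2l// sqr_ge0.
  by field; rewrite gt_eqF.
by rewrite leNgt He.
Qed.

End Goursat.

(** * Rules for complex derivatives *)

Section ComplexDerivative.
Context {R : realType}.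
Local Notation C := R[i].
Implicit Types (f g h : C -> C).

Definition cdiff f z l := cdiff_in setT f z l.

Definition ccont_at f z := forall e : R, 0 < e ->
  exists2 d : R, 0 < d & forall w, cmod (w - z) < d -> cmod (f w - f z) < e.

Lemma cdiff_lip f z l : cdiff f z l -> exists2 d : R, 0 < d &
  forall w, cmod (w - z) < d -> cmod (f w - f z) <= (cmod l + 1) * cmod (w - z).
Proof.
move=> H; have [d d0 Hd] := H 1 ltr01; exists d => // w wd.
have := Hd w I wd; rewrite mul1r => h1.
have -> : f w - f z = (f w - f z - l * (w - z)) + l * (w - z) by ring.
by apply: le_trans (cmodD _ _) _; rewrite cmodM; lra.
Qed.

Lemma cdiff_ccont f z l : cdiff f z l -> ccont_at f z.
Proof.
move=> /cdiff_lip[d d0 Hd] e e0.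
have l0 : 0 < cmod l + 1 by have := cmod_ge0 l; lra.
exists (Num.min d (e / (cmod l + 1))); first by rewrite lt_min d0 divr_gt0.
move=> w; rewrite lt_min => /andP[/Hd h1 h2]; apply: le_lt_trans h1 _.
by rewrite mulrC -ltr_pdivlMr.
Qed.

Lemma ccont_at_near f g z : (exists2 d : R, 0 < d & forall w, cmod (w - z) < d -> f w = g w) ->
  ccont_at f z -> ccont_at g z.
Proof.
move=> [d d0 Hd] H e e0; have [d' d'0 Hd'] := H e e0.
exists (Num.min d d'); first by rewrite lt_min d0.
move=> w; rewrite lt_min => /andP[w1 w2]; rewrite -Hd// -Hd ?subrr ?cmod0//.
exact: Hd'.
Qed.

Lemma cdiff_near f g z l : (exists2 d : R, 0 < d & forall w, cmod (w - z) < d -> f w = g w) ->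
  cdiff f z l -> cdiff g z l.
Proof.
move=> [d d0 Hd] H e e0; have [d' d'0 Hd'] := H e e0.
exists (Num.min d d'); first by rewrite lt_min d0.
move=> w _; rewrite lt_min => /andP[w1 w2]; rewrite -Hd// -Hd ?subrr ?cmod0//.
exact: Hd'.
Qed.

(** Absorbs a constant factor into epsilon, so that the estimates for products, inverses and
    parameter integrals need no tuning. *)
Lemma cdiff_suff f z l K : (forall e : R, 0 < e -> exists2 d : R, 0 < d & forall w,
    cmod (w - z) < d -> cmod (f w - f z - l * (w - z)) <= K * e * cmod (w - z)) ->
  cdiff f z l.
Proof.
move=> H e e0; have K0 : 0 < `|K| + 1 by rewrite ltr_wpDl.
have [d d0 Hd] := H (e / (`|K| + 1)) (divr_gt0 e0 K0).
exists d => // w _ /Hd /le_trans; apply; rewrite ler_wpM2r//.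
rewrite mulrCA ger_pMr// ler_pdivrMr// mul1r.
by have := ler_norm K; lra.
Qed.

Lemma cdiff_cst (k : C) z : cdiff (fun=> k) z 0.
Proof.
move=> e e0; exists 1 => // w _ _.
by rewrite subrr mul0r subrr cmod0 mulr_ge0// ltW.
Qed.

Lemma cdiff_id z : cdiff id z 1.
Proof.
move=> e e0; exists 1 => // w _ _.
by rewrite mul1r subrr cmod0 mulr_ge0// ltW.
Qed.

Lemma cdiffD f g z l m : cdiff f z l -> cdiff g z m ->
  cdiff (fun w => f w + g w) z (l + m).
Proof.
move=> Hf Hg; apply: (@cdiff_suff _ _ _ 2) => e e0.
have [d1 d10 H1] := Hf _ e0; have [d2 d20 H2] := Hg _ e0.
exists (Num.min d1 d2); first by rewrite lt_min d10.
move=> w; rewrite lt_min => /andP[/(H1 _ I) k1 /(H2 _ I) k2].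
rewrite (_ : _ - _ = (f w - f z - l * (w - z)) + (g w - g z - m * (w - z))); last by ring.
by apply: le_trans (cmodD _ _) _; lra.
Qed.

Lemma cdiffM f g z l m : cdiff f z l -> cdiff g z m ->
  cdiff (fun w => f w * g w) z (l * g z + f z * m).
Proof.
move=> Hf Hg.
apply: (@cdiff_suff _ _ _ (cmod (g z) + cmod (f z) + (cmod l + 1) * (cmod m + 1))) => e e0.
have [d1 d10 H1] := Hf _ e0; have [d2 d20 H2] := Hg _ e0.
have [d3 d30 H3] := cdiff_lip Hf; have [d4 d40 H4] := cdiff_lip Hg.
exists (Num.min (Num.min d1 d2) (Num.min (Num.min d3 d4) e)).
  by rewrite !lt_min d10 d20 d30 d40.
move=> w; rewrite !lt_min => /andP[/andP[/(H1 _ I) k1 /(H2 _ I) k2] /andP[/andP[/H3 k3 /H4 k4] we]].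
rewrite (_ : _ - _ = (f w - f z - l * (w - z)) * g z + f z * (g w - g z - m * (w - z)) +
  (f w - f z) * (g w - g z)); last by ring.
have B1 : cmod ((f w - f z - l * (w - z)) * g z) <= cmod (g z) * (e * cmod (w - z)).
  by rewrite cmodM mulrC ler_wpM2l.
have B2 : cmod (f z * (g w - g z - m * (w - z))) <= cmod (f z) * (e * cmod (w - z)).
  by rewrite cmodM ler_wpM2l.
have B3 : cmod ((f w - f z) * (g w - g z)) <= (cmod l + 1) * (cmod m + 1) * (e * cmod (w - z)).
  rewrite cmodM; apply: (@le_trans _ _ ((cmod l + 1) * cmod (w - z) * ((cmod m + 1) * cmod (w - z)))).
    exact: ler_pM.
  rewrite mulrACA ler_wpM2l// ?mulr_ge0 ?addr_ge0//.
  by rewrite ler_wpM2r// ltW.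
apply: le_trans (cmodD _ _) _; apply: le_trans (lerD (cmodD _ _) (lexx _)) _.
apply: le_trans (lerD (lerD B1 B2) B3) _.
by rewrite -!mulrDl mulrA.
Qed.

Lemma cdiffV f z l : f z != 0 -> cdiff f z l ->
  cdiff (fun w => (f w)^-1) z (- (l / f z ^+ 2)).
Proof.
move=> fz0 Hf.
have fz : 0 < cmod (f z) by rewrite cmod_gt0.
pose K := (cmod (f z) + cmod l * (cmod l + 1)) * (2 / cmod (f z) ^+ 3).
apply: (@cdiff_suff _ _ _ K) => e e0.
have [d1 d10 H1] := Hf _ e0.
have [d3 d30 H3] := cdiff_lip Hf.
have [|d4 d40 H4] := cdiff_ccont Hf (e := cmod (f z) / 2); first by rewrite divr_gt0.
exists (Num.min (Num.min d1 d3) (Num.min d4 e)); first by rewrite !lt_min d10 d30 d40.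
move=> w; rewrite !lt_min => /andP[/andP[/(H1 _ I) k1 /H3 k3] /andP[/H4 k4 we]].
have fwge : cmod (f z) / 2 <= cmod (f w).
  by have := cmod_triB (f z) (f z - f w); rewrite subKr cmodC; lra.
have fw0 : f w != 0 by rewrite -cmod_gt0; lra.
rewrite (_ : _ - _ = (l * (w - z) * (f w - f z) - (f w - f z - l * (w - z)) * f z) /
  (f w * f z ^+ 2)); last by field; rewrite fw0 fz0.
rewrite cmodM cmodV; rewrite /K.
rewrite -(mulrA _ e) [X in _ <= X]mulrAC; apply: ler_pM => //; first by rewrite invr_ge0.
- have B1 : cmod ((f w - f z - l * (w - z)) * f z) <= cmod (f z) * (e * cmod (w - z)).
    by rewrite cmodM mulrC ler_wpM2l.
  have B2 : cmod (l * (w - z) * (f w - f z)) <= cmod l * (cmod l + 1) * (e * cmod (w - z)).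
    rewrite !cmodM -!mulrA ler_wpM2l//.
    apply: (@le_trans _ _ (cmod (w - z) * ((cmod l + 1) * cmod (w - z)))).
      by rewrite ler_wpM2l.
    by rewrite mulrCA ler_wpM2l ?addr_ge0// ler_wpM2r// ltW.
  apply: le_trans (cmodB _ _) _; apply: le_trans (lerD B2 B1) _.
  by rewrite -mulrDl addrC.
- rewrite cmodM cmodX -[X in _ <= X]invrK invf_div lef_pV2 ?posrE; last 2 first.
  + by rewrite mulr_gt0// ?exprn_gt0// cmod_gt0.
  + by rewrite divr_gt0// exprn_gt0.
  rewrite (_ : _ / 2 = cmod (f z) / 2 * cmod (f z) ^+ 2); last by field.
  by rewrite ler_wpM2r ?sqr_ge0.
Qed.

Lemma cdiffZ (k : C) f z l : cdiff f z l -> cdiff (fun w => k * f w) z (k * l).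
Proof. by move=> H; have := cdiffM (cdiff_cst k z) H; rewrite mul0r add0r. Qed.

Lemma cdiffN f z l : cdiff f z l -> cdiff (fun w => - f w) z (- l).
Proof.
move=> H; have := cdiffZ (-1) H; rewrite mulN1r => H1; refine (cdiff_near _ H1).
by exists 1 => // w _; rewrite mulN1r.
Qed.

Lemma cdiffB f g z l m : cdiff f z l -> cdiff g z m ->
  cdiff (fun w => f w - g w) z (l - m).
Proof. by move=> Hf Hg; apply: cdiffD => //; exact: cdiffN. Qed.

End ComplexDerivative.

(** * Cauchy integrals and Cauchy's formula on a rectangle *)

Section CauchyFormula.
Context {R : realType}.
Local Notation C := R[i].
Implicit Types (f g h : C -> C) (m gam : R -> C) (w z : C).

Lemma pcontV m : pcont m -> (forall t, m t != 0) -> pcont (fun t => (m t)^-1).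
Proof.
move=> [m1 m2] m0.
have E t : (m t)^-1 = (m t)^*%C * ((Re (m t) ^+ 2 + Im (m t) ^+ 2)^-1)%:C.
  have q0 : Re (m t) ^+ 2 + Im (m t) ^+ 2 != 0.
    by rewrite -cmod_sq expf_eq0 /= cmod_eq0.
  apply: (mulfI (m0 t)); rewrite divff// mulrA mulcJ -rmorphM /= cmod_sq divff//.
rewrite (_ : (fun t => (m t)^-1) = (fun t => (m t)^*%C * ((Re (m t) ^+ 2 + Im (m t) ^+ 2)^-1)%:C)); last exact/funext.
apply: pcontM; split.
- by under eq_fun do rewrite cReJ.
- by under eq_fun do rewrite cImJ; move=> t; apply: cvgN; exact: m2.
- move=> t /=; apply: cvgV; first by rewrite -cmod_sq expf_eq0 /= cmod_eq0.
  have sq (u : R -> R) : continuous u -> continuous (fun t => u t ^+ 2).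
    by move=> cu s; apply: (@continuous_comp _ _ _ u (fun x => x ^+ 2)); [exact: cu|exact: exprn_continuous].
  by apply: cvgD; [exact: (sq _ m1)|exact: (sq _ m2)].
- by move=> t; exact: cvg_cst.
Qed.

Lemma pcontX m k : pcont m -> pcont (fun t => m t ^+ k).
Proof.
move=> cm; elim: k => [|k IH].
  by under eq_fun do rewrite expr0; exact: pcont_cst.
by under eq_fun do rewrite exprS; exact: pcontM.
Qed.

(** Differentiation under the integral sign for the Cauchy kernels of order 1 and 2. The remainder
    of the kernel is an explicit multiple of (w - w0)^2, and its denominators are controlled because
    the path keeps the distance eta / 2 from w. *)
Lemma kernel_param m gam (a b eta : R) (w0 : C) : pcont m -> pcont gam -> a <= b -> 0 < eta ->
  (forall t, eta <= cmod (gam t - w0)) ->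
  let Psi k w := CI (fun t => m t / (gam t - w) ^+ k) a b in
  cdiff (Psi 1%N) w0 (Psi 2%N w0) /\ cdiff (Psi 2%N) w0 (2 * Psi 3%N w0).
Proof.
move=> cm cg ab eta0 H Psi.
have [M M0 HM] := pcont_bounded a b cm.
have gw0 t : gam t - w0 != 0 by rewrite -cmod_gt0 (lt_le_trans eta0).
have near w t : cmod (w - w0) < eta / 2 -> eta / 2 <= cmod (gam t - w).
  move=> wd; have := cmod_triB (gam t - w0) (w - w0); have := H t.
  by rewrite (_ : gam t - w0 - (w - w0) = gam t - w); [lra|ring].
have gw w t : cmod (w - w0) < eta / 2 -> gam t - w != 0.
  by move=> /near h; rewrite -cmod_gt0 (lt_le_trans _ (h t))// divr_gt0.
have cK w k : cmod (w - w0) < eta / 2 -> pcont (fun t => m t / (gam t - w) ^+ k).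
  move=> wd; apply: pcontM => //; apply: pcontV.
    by apply: pcontX; apply: pcontB => //; exact: pcont_cst.
  by move=> t; rewrite expf_neq0// gw.
have w0d : cmod (w0 - w0) < eta / 2 by rewrite subrr cmod0 divr_gt0.
have main k (u v : C) (K : R) : (0 <= K) ->
    (forall t w, cmod (w - w0) < eta / 2 ->
      cmod (m t) <= M -> cmod (m t / (gam t - w) ^+ k - m t / (gam t - w0) ^+ k -
        (w - w0) * (u * (m t / (gam t - w0) ^+ k.+1))) <= K * cmod (w - w0) ^+ 2) ->
    cdiff (Psi k) w0 (u * Psi k.+1 w0).
  move=> K0 Hk; apply: (@cdiff_suff _ _ _ _ (2 * K * (b - a))) => e e0.
  exists (Num.min (eta / 2) e); first by rewrite lt_min e0 divr_gt0.
  move=> w; rewrite lt_min => /andP[wd we].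
  have -> : Psi k w - Psi k w0 - u * Psi k.+1 w0 * (w - w0) =
    CI (fun t => m t / (gam t - w) ^+ k - m t / (gam t - w0) ^+ k -
        (w - w0) * (u * (m t / (gam t - w0) ^+ k.+1))) a b.
    have c1 := cK w k wd; have c2 := cK w0 k w0d; have c3 := cK w0 k.+1 w0d.
    have c4 := pcontM (pcont_cst u) c3; have c5 := pcontM (pcont_cst (w - w0)) c4.
    by rewrite (CIB a b (pcontB c1 c2) c5) (CIB a b c1 c2) (CIZ _ a b c4) (CIZ _ a b c3) -/(Psi k w) -/(Psi k w0) -/(Psi k.+1 w0); move: (Psi k w) (Psi k w0) (Psi k.+1 w0) => A B D; ring.
  apply: le_trans (CI_bound ab _ (M := K * cmod (w - w0) ^+ 2) _) _.
  - have c1 := cK w k wd; have c2 := cK w0 k w0d; have c3 := cK w0 k.+1 w0d.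
    have c4 := pcontM (pcont_cst u) c3; have c5 := pcontM (pcont_cst (w - w0)) c4.
    exact: pcontB (pcontB c1 c2) c5.
  - by move=> t tab; apply: Hk => //; exact: HM.
  - rewrite (_ : 2 * K * (b - a) * e * cmod (w - w0) = 2 * (K * (e * cmod (w - w0))) * (b - a)); last by ring.
    rewrite ler_wpM2r ?subr_ge0// ler_wpM2l// ler_wpM2l// expr2 ler_wpM2r//.
    exact: ltW.
have bd t w : cmod (w - w0) < eta / 2 -> 0 < cmod (gam t - w0) /\ 0 < cmod (gam t - w).
  by move=> wd; rewrite !cmod_gt0 gw0 gw.
split.
(* The remainder has denominator (gam - w0)^2 (gam - w), of modulus at least eta^2 * eta / 2. *)
- rewrite -[Psi 2%N w0]mul1r; apply: (main 1%N 1 0 (M * (2 / eta ^+ 3))).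
    by rewrite mulr_ge0// divr_ge0// exprn_ge0// ltW.
  move=> t w wd mM; have u0 := gw0 t; have v0 := gw w t wd.
  rewrite (_ : _ - _ = m t * ((w - w0) ^+ 2 * ((gam t - w0) ^+ 2 * (gam t - w))^-1)); last first.
    by field; rewrite u0 v0.
  rewrite (cmodM (m t)) (cmodM ((w - w0) ^+ 2)) cmodX cmodV (cmodM ((gam t - w0) ^+ 2)) cmodX -mulrA; apply: ler_pM => //.
    by rewrite mulr_ge0// ?invr_ge0 ?mulr_ge0// exprn_ge0.
  rewrite mulrC ler_wpM2r ?exprn_ge0// -[X in _ <= X]invrK invf_div lef_pV2 ?posrE.
  + have := near w t wd; have := H t => h1 h2.
    rewrite (_ : eta ^+ 3 / 2 = eta ^+ 2 * (eta / 2)); last by ring.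
    have e0 := ltW eta0; have e20 : 0 <= eta / 2 by rewrite divr_ge0.
    by apply: ler_pM; rewrite ?exprn_ge0// ?ler_pXn2r ?nnegrE ?cmod_ge0//.
  + by rewrite mulr_gt0// ?exprn_gt0// cmod_gt0.
  + by rewrite divr_gt0// exprn_gt0.
(* The numerator 3 (gam - w0) - 2 (w - w0) is at most 5 |gam - w0|, which cancels one power below
   and leaves 5 / (eta^2 (eta / 2)^2). *)
- apply: (main 2%N 2 0 (M * (20 / eta ^+ 4))).
    by rewrite mulr_ge0// divr_ge0// exprn_ge0// ltW.
  move=> t w wd mM; have u0 := gw0 t; have v0 := gw w t wd.
  rewrite (_ : _ - _ = m t * ((w - w0) ^+ 2 * ((3 * (gam t - w0) - 2 * (w - w0)) /
     ((gam t - w0) ^+ 3 * (gam t - w) ^+ 2)))); last first.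
    by field; rewrite u0 v0.
  have h1 := H t; have h2 := near w t wd.
  have n1 : cmod (3 * (gam t - w0) - 2 * (w - w0)) <= 5 * cmod (gam t - w0).
    apply: le_trans (cmodB _ _) _; rewrite !cmodM.
    have -> : cmod (3 : C) = 3 by rewrite (_ : 3 = (3 : R)%:C) ?cmod_rc ?normr_nat// rmorph_nat.
    have -> : cmod (2 : C) = 2 by rewrite (_ : 2 = (2 : R)%:C) ?cmod_rc ?normr_nat// rmorph_nat.
    lra.
  rewrite (cmodM (m t)) (cmodM ((w - w0) ^+ 2)) cmodX (cmodM (3 * _ - _)) cmodV (cmodM ((gam t - w0) ^+ 3)) !cmodX -mulrA; apply: ler_pM => //.
    by rewrite mulr_ge0 ?exprn_ge0// mulr_ge0// ?invr_ge0 ?mulr_ge0// exprn_ge0.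
  rewrite mulrC ler_wpM2r ?exprn_ge0//.
  have [p1 p2] := bd t w wd.
  apply: (@le_trans _ _ (5 * cmod (gam t - w0) / (cmod (gam t - w0) ^+ 3 * cmod (gam t - w) ^+ 2))).
    by rewrite ler_wpM2r// invr_ge0 mulr_ge0// exprn_ge0.
  rewrite (_ : _ / _ = 5 / (cmod (gam t - w0) ^+ 2 * cmod (gam t - w) ^+ 2)); last first.
    by field; rewrite !gt_eqF.
  rewrite (_ : 20 / eta ^+ 4 = 5 / (eta ^+ 2 * (eta / 2) ^+ 2)); last first.
    by field; rewrite gt_eqF.
  rewrite ler_wpM2l// lef_pV2 ?posrE ?mulr_gt0 ?exprn_gt0 ?divr_gt0//.
  have e0 := ltW eta0; have e20 : 0 <= eta / 2 by rewrite divr_ge0.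
  by apply: ler_pM; rewrite ?exprn_ge0 ?cmod_ge0// ler_pXn2r ?nnegrE ?cmod_ge0//.
Qed.

Definition cauchy_int f (a b c d : R) k w := rect_int (fun z => f z / (z - w) ^+ k) a b c d.

(** The distance is bounded below along the whole lines carrying the sides, because [pcont] asks for
    continuity on all of the real line. *)
Lemma line_dist (a b c d : R) (w : C) : a < Re w < b -> c < Im w < d ->
  exists2 eta : R, 0 < eta &
    forall t, [/\ eta <= cmod (hline c t - w), eta <= cmod (hline d t - w),
                 eta <= cmod (vline a t - w) & eta <= cmod (vline b t - w)].
Proof.
move=> /andP[w1 w2] /andP[w3 w4].
exists (Num.min (Num.min (Re w - a) (b - Re w)) (Num.min (Im w - c) (d - Im w))).
  by rewrite !lt_min !subr_gt0 w1 w2 w3 w4.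
move=> t; split; rewrite !ge_min.
- have := Im_le_cmod (hline c t - w); rewrite !cE /= distrC gtr0_norm ?subr_gt0// => ->.
  by rewrite !orbT.
- have := Im_le_cmod (hline d t - w); rewrite !cE /= gtr0_norm ?subr_gt0// => ->.
  by rewrite !orbT.
- have := Re_le_cmod (vline a t - w); rewrite !cE /= distrC gtr0_norm ?subr_gt0// => ->.
  by rewrite ?orbT.
- have := Re_le_cmod (vline b t - w); rewrite !cE /= gtr0_norm ?subr_gt0// => ->.
  by rewrite ?orbT.
Qed.

Lemma pcont_hl (y : R) : pcont (@hline R y).
Proof. by split => t /=; [exact: cvg_id|exact: cvg_cst]. Qed.
Lemma pcont_vl (x : R) : pcont (@vline R x).
Proof. by split => t /=; [exact: cvg_cst|exact: cvg_id]. Qed.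

Lemma cauchy_int_cdiff f a b c d w : ccont f -> a < Re w < b -> c < Im w < d ->
  cdiff (cauchy_int f a b c d 1) w (cauchy_int f a b c d 2 w) /\
  cdiff (cauchy_int f a b c d 2) w (2 * cauchy_int f a b c d 3 w).
Proof.
move=> cf rw iw; have [eta eta0 H] := line_dist rw iw.
have ab : a <= b by case/andP: rw => /lt_trans h /h /ltW.
have cd : c <= d by case/andP: iw => /lt_trans h /h /ltW.
have H1 t : eta <= cmod (hline c t - w) by case: (H t).
have H2 t : eta <= cmod (hline d t - w) by case: (H t).
have H3 t : eta <= cmod (vline a t - w) by case: (H t).
have H4 t : eta <= cmod (vline b t - w) by case: (H t).
have [A1 B1] := kernel_param (ccont_h c cf) (pcont_hl c) ab eta0 H1.
have [A2 B2] := kernel_param (ccont_h d cf) (pcont_hl d) ab eta0 H2.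
have [A3 B3] := kernel_param (ccont_v a cf) (pcont_vl a) cd eta0 H3.
have [A4 B4] := kernel_param (ccont_v b cf) (pcont_vl b) cd eta0 H4.
split.
- exact: cdiffD (cdiffB A1 A2) (cdiffZ 'i%C (cdiffB A4 A3)).
- have := cdiffD (cdiffB B1 B2) (cdiffZ 'i%C (cdiffB B4 B3)).
  by rewrite -!mulrBr mulrCA -mulrDr.
Qed.

(** Filling in the derivative at w removes the singularity of the difference quotient, so that it
    qualifies for the contour calculus, which asks for continuity on all of C. *)
Lemma ccont_at_quot g z w l : cdiff g w l -> ccont_at g z ->
  ccont_at (fun x => if x == w then l else (g x - g w) / (x - w)) z.
Proof.
move=> dg cg; have [->|zw] := eqVneq z w.
  move=> e e0; have e20 : 0 < e / 2 by rewrite divr_gt0.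
  have [d d0 Hd] := dg _ e20; exists d => // x xd; rewrite eqxx.
  case: eqVneq => [_|xw]; first by rewrite subrr cmod0.
  have := Hd x I xd.
  have xw0 : x - w != 0 by rewrite subr_eq0.
  rewrite (_ : _ - _ - _ = ((g x - g w) / (x - w) - l) * (x - w)); last by field.
  rewrite cmodM ler_pM2r ?cmod_gt0// => h; lra.
have zw0 : z - w != 0 by rewrite subr_eq0.
have zp : 0 < cmod (z - w) by rewrite cmod_gt0.
pose q x := (x - w)^-1.
have cq : ccont_at q z.
  have dz : cdiff (fun x => x - w) z (1 - 0) by apply: cdiffB; [exact: cdiff_id|exact: cdiff_cst].
  have dq := @cdiffV _ (fun x => x - w) z _ zw0 dz.
  by move=> e e0; apply: (cdiff_ccont dq).
have H : ccont_at (fun x => (g x - g w) * q x) z.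
  move=> e e0.
  pose A := cmod (g z - g w) + 1; pose B := cmod (q z) + 1.
  have A0 : 0 < A by rewrite ltr_wpDl.
  have B0 : 0 < B by rewrite ltr_wpDl.
  have [d1 d10 H1] := cg _ (divr_gt0 e0 (mulr_gt0 (ltr0n _ 2) B0)).
  have [d2 d20 H2] := cq _ (divr_gt0 e0 (mulr_gt0 (ltr0n _ 2) A0)).
  have [d3 d30 H3] := cq _ ltr01.
  exists (Num.min d1 (Num.min d2 d3)); first by rewrite !lt_min d10 d20.
  move=> x; rewrite !lt_min => /and3P[/H1 h1 /H2 h2 /H3 h3].
  rewrite (_ : _ - _ = (g x - g z) * q x + (g z - g w) * (q x - q z)); last by ring.
  have qx : cmod (q x) <= B.
    by have := cmod_triB (q x) (q z); rewrite /B; lra.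
  have B1 : cmod ((g x - g z) * q x) < e / 2.
    rewrite cmodM; apply: (@le_lt_trans _ _ (cmod (g x - g z) * B)); first by rewrite ler_wpM2l.
    by rewrite -ltr_pdivlMr// (lt_le_trans h1)// invfM mulrA.
  have B2 : cmod ((g z - g w) * (q x - q z)) <= e / 2.
    rewrite cmodM; apply: (@le_trans _ _ (A * cmod (q x - q z))).
      by rewrite ler_wpM2r// /A lerDl.
    by rewrite mulrC -ler_pdivlMr// (le_trans (ltW h2))// invfM mulrA.
  by apply: le_lt_trans (cmodD _ _) _; lra.
apply: ccont_at_near H; exists (cmod (z - w)) => // x xz.
case: eqVneq => [xw|//]; move: xz; by rewrite xw cmodC ltxx.
Qed.

(** The difference quotient of g at w has contour integral 0. The integral of 1 / (z - w) stays as a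
    factor: knowing that it does not vanish suffices, and 2 pi i is never computed. *)
Lemma cauchy_formula g a b c d w : ccont g ->
  a < Re w < b -> c < Im w < d ->
  (forall z, rect a b c d z -> exists l, cdiff g z l) ->
  cauchy_int g a b c d 1 w = g w * cauchy_int (fun=> 1) a b c d 1 w.
Proof.
move=> cg rw iw dg.
have [/andP[aw wb] /andP[cw wd]] := (rw, iw).
have [l dl] := dg w (ltac:(by split; apply/andP; split; apply: ltW)).
pose k x := if x == w then l else (g x - g w) / (x - w).
have ck : ccont k by move=> z; apply: (ccont_at_quot dl); exact: cg.
have dk z : rect a b c d z -> z != w -> exists l', cdiff k z l'.
  move=> rz zw; have [lz dz] := dg z rz.
  have zw0 : z - w != 0 by rewrite subr_eq0.
  have d1 : cdiff (fun x => x - w) z (1 - 0) by apply: cdiffB; [exact: cdiff_id|exact: cdiff_cst].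
  have d2 := cdiffM (cdiffB dz (cdiff_cst (g w) z)) (@cdiffV _ (fun x => x - w) z _ zw0 d1).
  eexists; refine (cdiff_near _ d2).
  exists (cmod (z - w)); first by rewrite cmod_gt0.
  by move=> x xz; rewrite /k; case: eqVneq => [xw|//]; move: xz; rewrite xw cmodC ltxx.
have zero a' b' c' d' : a <= a' -> b' <= b -> c <= c' -> d' <= d -> a' <= b' -> c' <= d' ->
    ~ rect a' b' c' d' w -> rect_int k a' b' c' d' = 0.
  move=> h1 h2 h3 h4 h5 h6 nw; apply: goursat => // z rz.
  have zw : z != w by apply: contra_not_neq nw => <-.
  have [l' dl'] : exists l', cdiff k z l'.
    apply: dk zw; case: rz => /andP[r1 r2] /andP[r3 r4].
    by split; apply/andP; split; lra.
  exists l' => e e0; have [d0 d00 Hd] := dl' e e0.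
  by exists d0 => // x _; exact: Hd.
(* The four outer pieces of the rectangle avoid w and contribute 0 by Goursat. On the remaining
   square of half side e the quotient is at most |l| + 1, so the integral is O(e). *)
have [m m0 Hm] : exists2 m : R, 0 < m & forall e : R, 0 < e -> e < m ->
    cmod (rect_int k a b c d) <= 4 * (cmod l + 1) * (4 * e).
  have [d1 d10 H1] := ck w 1 ltr01.
  exists (Num.min (d1 / 2) (Num.min (Num.min (Re w - a) (b - Re w)) (Num.min (Im w - c) (d - Im w)))).
    by rewrite !lt_min !subr_gt0 aw wb cw wd divr_gt0.
  move=> e e0; rewrite !lt_min => /and3P[ed /andP[e1 e2] /andP[e3 e4]].
  have -> : rect_int k a b c d = rect_int k (Re w - e) (Re w + e) (Im w - e) (Im w + e).
    rewrite (rect_int_splitx a b c d (Re w - e) ck) (rect_int_splitx (Re w - e) b c d (Re w + e) ck).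
    rewrite (rect_int_splity (Re w - e) (Re w + e) c d (Im w - e) ck).
    rewrite (rect_int_splity (Re w - e) (Re w + e) (Im w - e) d (Im w + e) ck).
    have z1 : rect_int k a (Re w - e) c d = 0 by apply: zero; [lra..|move=> [/andP[? ?] _]; lra].
    have z2 : rect_int k (Re w + e) b c d = 0 by apply: zero; [lra..|move=> [/andP[? ?] _]; lra].
    have z3 : rect_int k (Re w - e) (Re w + e) c (Im w - e) = 0.
      by apply: zero; [lra..|move=> [_ /andP[? ?]]; lra].
    have z4 : rect_int k (Re w - e) (Re w + e) (Im w + e) d = 0.
      by apply: zero; [lra..|move=> [_ /andP[? ?]]; lra].
    rewrite z1 z2 z3 z4.
    by rewrite !add0r !addr0.
  rewrite [X in _ <= _ * X](_ : _ = (Re w + e - (Re w - e)) + (Im w + e - (Im w - e))); last by ring.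
  apply: rect_int_bound; [lra|lra|exact: ccont_bcont|].
  move=> z /andP[z1 z2] /andP[z3 z4].
  have zw : cmod (z - w) < d1.
    apply: le_lt_trans (cmod_le_ReIm _) _.
    have : `|Re (z - w)| <= e by rewrite ler_norml !cE; lra.
    have : `|Im (z - w)| <= e by rewrite ler_norml !cE; lra.
    lra.
  have := H1 z zw; have := cmod_triB (k z) (k w).
  by rewrite (_ : k w = l); [lra|rewrite /k eqxx].
have Jk : rect_int k a b c d = 0.
  apply/eqP; rewrite -cmod_eq0; apply/negPn/negP => n0.
  have p0 : 0 < cmod (rect_int k a b c d) by rewrite lt_neqAle eq_sym n0 cmod_ge0.
  have l1 : 0 < cmod l + 1 by rewrite ltr_wpDl.
  (* For this e the bound 16 (|l| + 1) e is at most half the modulus that it should dominate. *)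
  pose e := Num.min (m / 2) (cmod (rect_int k a b c d) / (32 * (cmod l + 1))).
  have e0 : 0 < e by rewrite lt_min !divr_gt0// mulr_gt0.
  have em : e < m by rewrite /e gt_min ltr_pdivrMr// ltr_pMr// ltr1n.
  have := Hm e e0 em.
  have : e <= cmod (rect_int k a b c d) / (32 * (cmod l + 1)) by rewrite /e ge_min lexx orbT.
  rewrite ler_pdivlMr ?mulr_gt0//; nra.
have [eta eta0 H] := line_dist rw iw.
have nz z : eta <= cmod z -> z != 0 by move=> h; rewrite -cmod_gt0 (lt_le_trans eta0).
have n1 t : hline c t - w != 0 by apply: nz; case: (H t).
have n2 t : hline d t - w != 0 by apply: nz; case: (H t).
have n3 t : vline a t - w != 0 by apply: nz; case: (H t).
have n4 t : vline b t - w != 0 by apply: nz; case: (H t).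
have bq f : ccont f -> bcont (fun z => f z / (z - w) ^+ 1) a b c d.
  move=> cf; have pc gam : pcont gam -> pcont (fun t => f (gam t)) ->
      (forall t, gam t - w != 0) -> pcont (fun t => f (gam t) / (gam t - w) ^+ 1).
    move=> c1 c2 c3; apply: pcontM => //; apply: pcontV => //.
    by apply: pcontX; apply: pcontB => //; exact: pcont_cst.
  by split; apply: pc => //; first [exact: pcont_hl|exact: pcont_vl|exact: ccont_h|exact: ccont_v].
have cc (u : C) : ccont (fun=> u).
  by move=> z e e0; exists 1 => // x _; rewrite subrr cmod0.
have E : rect_int k a b c d = rect_int (fun z => g z / (z - w) ^+ 1 - g w * (1 / (z - w) ^+ 1)) a b c d.
  rewrite /rect_int; congr (_ - _ + _ * (_ - _)); apply: eq_CI => t;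
    rewrite /k -subr_eq0 ?(negbTE (n1 t)) ?(negbTE (n2 t)) ?(negbTE (n3 t)) ?(negbTE (n4 t)) !expr1; by rewrite mul1r mulrBl.
apply/eqP; rewrite -subr_eq0 /cauchy_int -JZ; last exact: bq.
rewrite -JB; first by rewrite -E Jk.
- exact: bq.
- have [b1 b2 b3 b4] := bq _ (cc 1).
  by split; apply: pcontM => //; exact: pcont_cst.
Qed.

End CauchyFormula.

(** * The derivative of a holomorphic function is differentiable *)

Section HolomorphicRegularity.
Context {R : realType}.
Local Notation C := R[i].
Implicit Types (f g h : C -> C) (z w : C).

Lemma ccont_cst (u : C) : ccont (fun=> u).
Proof. by move=> z e e0; exists 1 => // x _; rewrite subrr cmod0. Qed.

Lemma ImV z : Im z^-1 = - Im z / (Re z ^+ 2 + Im z ^+ 2).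
Proof. by case: z => x y; rewrite mulNr. Qed.
Lemma ReV z : Re z^-1 = Re z / (Re z ^+ 2 + Im z ^+ 2).
Proof. by case: z. Qed.

(* Each side of the rectangle contributes the angle it subtends at w to the
   imaginary part. *)
Lemma cauchy_int1_neq0 (a b c d : R) w : a < Re w < b -> c < Im w < d ->
  cauchy_int (fun=> 1) a b c d 1 w != 0.
Proof.
move=> rw iw; have [eta eta0 H] := line_dist rw iw.
have [/andP[aw wb] /andP[cw wd]] := (rw, iw).
have nz z : eta <= cmod z -> z != 0 by move=> h; rewrite -cmod_gt0 (lt_le_trans eta0).
have pc gam : pcont gam -> (forall t : R, gam t - w != 0) ->
    pcont (fun t => 1 / (gam t - w) ^+ 1).
  move=> c1 c3; apply: pcontM; first exact: pcont_cst.
  apply: pcontV; last by [].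
  by apply: pcontX; apply: pcontB => //; exact: pcont_cst.
have [p1 p1'] := pc _ (pcont_hl c) (fun t => nz _ (let: And4 h _ _ _ := H t in h)).
have [p2 p2'] := pc _ (pcont_hl d) (fun t => nz _ (let: And4 _ h _ _ := H t in h)).
have [p3 p3'] := pc _ (pcont_vl a) (fun t => nz _ (let: And4 _ _ h _ := H t in h)).
have [p4 p4'] := pc _ (pcont_vl b) (fun t => nz _ (let: And4 _ _ _ h := H t in h)).
suff : 0 < Im (cauchy_int (fun=> 1) a b c d 1 w).
  by move=> h; apply: contraTneq h => ->; rewrite ltxx.
have ab := lt_trans aw wb; have cd := lt_trans cw wd.
rewrite /cauchy_int /rect_int !cE /= !mul0r !mul1r add0r.
have cpos (x y : R) : 0 <= x ^+ 2 + y ^+ 2 by rewrite addr_ge0// sqr_ge0.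
have I2 : 0 <= - RI (fun t => Im (1 / (hline d t - w) ^+ 1)) a b.
  rewrite -RIN//; apply: RI_ge0; first exact: ltW.
  by move=> t _; rewrite mul1r expr1 ImV !cE /= mulNr opprK divr_ge0// subr_ge0 ltW.
have I3 : 0 <= - RI (fun t => Re (1 / (vline a t - w) ^+ 1)) c d.
  rewrite -RIN//; apply: RI_ge0; first exact: ltW.
  by move=> t _; rewrite mul1r expr1 ReV !cE /= -mulNr opprB divr_ge0// subr_ge0 ltW.
have I4 : 0 <= RI (fun t => Re (1 / (vline b t - w) ^+ 1)) c d.
  apply: RI_ge0; first exact: ltW.
  by move=> t _; rewrite mul1r expr1 ReV !cE /= divr_ge0// subr_ge0 ltW.
have I1 : 0 < RI (fun t => Im (1 / (hline c t - w) ^+ 1)) a b.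
  pose K := (Im w - c) / ((b - a) ^+ 2 + (Im w - c) ^+ 2).
  apply: (@lt_le_trans _ _ (K * (b - a))).
    rewrite mulr_gt0// ?subr_gt0// /K divr_gt0// ?subr_gt0// ltr_wpDl// ?sqr_ge0//.
    by rewrite exprn_gt0// subr_gt0.
  have cK : continuous (fun _ : R => K) by move=> t; exact: cvg_cst.
  rewrite -RI_cst; apply: (le_RI (ltW ab) cK p1').
  move=> t /andP[t1 t2]; rewrite mul1r expr1 ImV !cE /= opprB /K -!/(_ / _).
  rewrite ler_wpM2l ?subr_ge0 ?(ltW cw)// lef_pV2 ?posrE; last 2 first.
  - by rewrite ltr_wpDl ?sqr_ge0// exprn_gt0// subr_gt0.
  - rewrite ltr_wpDl ?sqr_ge0// -sqrrN opprB exprn_gt0// subr_gt0//.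
  by rewrite -[X in _ + X <= _]sqrrN opprB lerD2r; nra.
by lra.
Qed.

(** By Cauchy's formula g is locally a quotient F / N of Cauchy integrals, each of which can be
    differentiated twice; the quotient rule then makes g1 explicit. It is applied to the coefficient
    of an arbitrary frame, whose logarithmic derivative enters the curvature. *)
Theorem cdiff_regular (U : set C) g : open (U : set R[i]^o) ->
  (forall z, U z -> exists l, cdiff g z l) -> forall z0, U z0 ->
  exists r g1, [/\ 0 < r, forall z, cmod (z - z0) < r -> cdiff g z (g1 z) &
    exists l, cdiff g1 z0 l].
Proof.
move=> /open_cP oU dg z0 Uz0; have [r0 r00 Hr] := oU z0 Uz0.
pose rho := r0 / 3.
have rho0 : 0 < rho by rewrite divr_gt0.
(* Projection onto the square of half side rho about z0. It does not increase distances, and points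
   of the square are within 2 rho < r0 of z0, so g composed with it is continuous on all of C and
   equals g near z0. *)
pose clamp (x t : R) := Num.max (x - rho) (Num.min (x + rho) t).
pose cl z := clamp (Re z0) (Re z) +i* clamp (Im z0) (Im z).
have clamp_in (x t : R) : `|clamp x t - x| <= rho.
  by rewrite /clamp ler_norml !maxEle !minEle; do 2 case: ifPn => //; rewrite -?ltNge; lra.
have clamp_id (x t : R) : `|t - x| <= rho -> clamp x t = t.
  by rewrite ler_norml /clamp !maxEle !minEle; do 2 case: ifPn => //; rewrite -?ltNge; lra.
have clamp_lip (x s t : R) : `|clamp x s - clamp x t| <= `|s - t|.
  have lmax (u y y' : R) : `|Num.max u y - Num.max u y'| <= `|y - y'|.
    have := ler_norm (y - y'); have := ler_norm (- (y - y')); rewrite normrN.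
    by rewrite ler_norml !maxEle; case: (leP u y) => h1; case: (leP u y') => h2; lra.
  have lmin (u y y' : R) : `|Num.min u y - Num.min u y'| <= `|y - y'|.
    have := ler_norm (y - y'); have := ler_norm (- (y - y')); rewrite normrN.
    by rewrite ler_norml !minEle; case: (leP u y) => h1; case: (leP u y') => h2; lra.
  exact: le_trans (lmax _ _ _) (lmin _ _ _).
have clU z : U (cl z).
  apply: Hr; apply: le_lt_trans (cmod_le_ReIm _) _; rewrite !cE /=.
  have := clamp_in (Re z0) (Re z); have := clamp_in (Im z0) (Im z).
  by rewrite /rho; lra.
have cl_id z : `|Re z - Re z0| <= rho -> `|Im z - Im z0| <= rho -> cl z = z.
  by move=> h1 h2; apply: ceqP; rewrite /= clamp_id.
have cl_lip z w : cmod (cl z - cl w) <= cmod (z - w).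
  rewrite -(@ler_pXn2r _ 2)// ?nnegrE// !cmod_sq !cE /=.
  have sq (x y : R) : `|x| <= `|y| -> x ^+ 2 <= y ^+ 2.
    by move=> xy; rewrite -(real_normK (num_real x)) -(real_normK (num_real y)) ler_pXn2r ?nnegrE.
  by apply: lerD; apply: sq; exact: clamp_lip.
pose G z := g (cl z).
have cG : ccont G.
  move=> z e e0; have [l dl] := dg _ (clU z).
  have [d d0 Hd] := cdiff_ccont dl e0.
  by exists d => // w wd; apply: Hd; apply: le_lt_trans (cl_lip _ _) wd.
have inner z : `|Re z - Re z0| < rho -> `|Im z - Im z0| < rho ->
    exists2 d : R, 0 < d & forall w, cmod (w - z) < d -> g w = G w.
  move=> h1 h2; exists (Num.min (rho - `|Re z - Re z0|) (rho - `|Im z - Im z0|)).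
    by rewrite lt_min !subr_gt0 h1.
  move=> w; rewrite lt_min => /andP[w1 w2]; rewrite /G cl_id//.
    have := ler_normD (Re w - Re z) (Re z - Re z0); rewrite subrKA.
    have := Re_le_cmod (w - z); rewrite !cE; lra.
  have := ler_normD (Im w - Im z) (Im z - Im z0); rewrite subrKA.
  have := Im_le_cmod (w - z); rewrite !cE; lra.
have dG z : `|Re z - Re z0| < rho -> `|Im z - Im z0| < rho -> exists l, cdiff G z l.
  move=> h1 h2; have [l dl] := dg _ (clU z); exists l.
  refine (cdiff_near (inner z h1 h2) _).
  by move: dl; rewrite cl_id// ltW.
pose a := Re z0 - rho / 2; pose b := Re z0 + rho / 2.
pose c := Im z0 - rho / 2; pose d := Im z0 + rho / 2.
have box z : cmod (z - z0) < rho / 2 -> (a < Re z < b) /\ (c < Im z < d).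
  move=> h; have := Re_le_cmod (z - z0); have := Im_le_cmod (z - z0).
  rewrite !ler_norml !cE /a /b /c /d => h1 h2; lra.
pose N k := cauchy_int (fun=> 1) a b c d k; pose F k := cauchy_int G a b c d k.
have near_box z : cmod (z - z0) < rho / 2 -> exists2 e : R, 0 < e &
    forall w, cmod (w - z) < e -> cmod (w - z0) < rho / 2.
  move=> h; exists (rho / 2 - cmod (z - z0)); first by rewrite subr_gt0.
  move=> w wz; have := cmodD (w - z) (z - z0); rewrite subrKA; lra.
have N0 w : a < Re w < b -> c < Im w < d -> N 1%N w != 0 by exact: cauchy_int1_neq0.
have cf w : cmod (w - z0) < rho / 2 -> F 1%N w * (N 1%N w)^-1 = G w.
  move=> /box[h1 h2]; rewrite /F cauchy_formula//.
    by rewrite mulfK// N0.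
  by move=> z [z1 z2]; apply: dG; rewrite ltr_norml; move: z1 z2; rewrite /a /b /c /d; lra.
have dN w (h1 : a < Re w < b) (h2 : c < Im w < d) := cauchy_int_cdiff (ccont_cst 1) h1 h2.
have dF w (h1 : a < Re w < b) (h2 : c < Im w < d) := cauchy_int_cdiff cG h1 h2.
have {}dN w (h1 : a < Re w < b) (h2 : c < Im w < d) :
  cdiff (N 1%N) w (N 2%N w) /\ cdiff (N 2%N) w (2 * N 3%N w) by exact: dN.
have {}dF w (h1 : a < Re w < b) (h2 : c < Im w < d) :
  cdiff (F 1%N) w (F 2%N w) /\ cdiff (F 2%N) w (2 * F 3%N w) by exact: dF.
clearbody N F.
pose g1 z := F 2%N z * (N 1%N z)^-1 + F 1%N z * (- (N 2%N z * (N 1%N z * N 1%N z)^-1)).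
exists (rho / 2), g1; split; first by rewrite divr_gt0.
- move=> z zb; have [h1 h2] := box z zb.
  have [A1 _] := dF z h1 h2; have [B1 _] := dN z h1 h2.
  have D := cdiffM A1 (cdiffV (N0 z h1 h2) B1).
  rewrite expr2 in D.
  have [e e0 He] := near_box z zb.
  have [e' e'0 He'] : exists2 d : R, 0 < d & forall w, cmod (w - z) < d -> g w = G w.
    have := Re_le_cmod (z - z0); have := Im_le_cmod (z - z0); rewrite !cE => k1 k2.
    by apply: inner; lra.
  refine (cdiff_near _ D); exists (Num.min e e'); first by rewrite lt_min e0.
  by move=> w; rewrite lt_min => /andP[w1 w2]; rewrite He'// -cf//; exact: He.
- have zb : cmod (z0 - z0) < rho / 2 by rewrite subrr cmod0 divr_gt0.
  have [h1 h2] := box z0 zb.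
  have [A1 A2] := dF z0 h1 h2; have [B1 B2] := dN z0 h1 h2.
  have n1 := N0 z0 h1 h2.
  have n2 : N 1%N z0 * N 1%N z0 != 0 by rewrite mulf_neq0.
  have V1 := cdiffV n1 B1.
  have V2 := @cdiffV _ (fun z => N 1%N z * N 1%N z) _ _ n2 (cdiffM B1 B1).
  eexists; exact: (cdiffD (cdiffM A2 V1) (cdiffM A1 (cdiffN (cdiffM B2 V2)))).
Qed.

End HolomorphicRegularity.

(** * Real differentiability and polar coordinates *)

Section PlaneCalculus.
Context {R : realType}.
Local Notation C := R[i].
Implicit Types (F G : C -> R) (z w : C).

Lemma is_deriveP (f : R -> R) (t l : R) :
  (forall e : R, 0 < e -> exists2 d : R, 0 < d & forall s, `|s - t| < d ->
     `|f s - f t - l * (s - t)| <= e * `|s - t|) ->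
  is_derive t 1 f l.
Proof.
move=> H.
have cv : h^-1 *: (f (h *: 1 + t) - f t) @[h --> (0 : R)^'] --> l.
  apply/cvgrPdist_le => e e0; have [d d0 Hd] := H e e0.
  rewrite near_withinE; apply/nbhs_ballP; exists d => //= h.
  rewrite /ball /= sub0r normrN => hd h0.
  have := Hd (h + t); rewrite addrK => /(_ hd).
  rewrite -[h *: 1]/(h * 1) mulr1 -[_ *: _]/(_ * _) => {}Hd.
  rewrite -(@ler_pM2r _ `|h|) ?normr_gt0// (le_trans _ Hd)//.
  by rewrite -normrM mulrBl mulrAC mulVf// mul1r distrC.
apply: DeriveDef; first by apply/cvg_ex; exists l.
exact/cvg_lim.
Qed.

Definition rdiff F z (a b : R) := forall e : R, 0 < e -> exists2 d : R, 0 < d &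
  forall w, cmod (w - z) < d ->
    `|F w - F z - (a * Re (w - z) + b * Im (w - z))| <= e * cmod (w - z).

Lemma rdiff_ray F (p v : C) (t a b : R) : rdiff F (p + t%:C * v) a b ->
  is_derive t 1 (fun s => F (p + s%:C * v)) (a * Re v + b * Im v).
Proof.
move=> H; apply: is_deriveP => e e0.
have v0 : 0 < cmod v + 1 by rewrite ltr_wpDl.
have [d d0 Hd] := H _ (divr_gt0 e0 v0).
exists (d / (cmod v + 1)); first by rewrite divr_gt0.
move=> s st; have E : p + s%:C * v - (p + t%:C * v) = (s - t)%:C * v.
  by rewrite rmorphB /=; ring.
have Ec : cmod (p + s%:C * v - (p + t%:C * v)) <= `|s - t| * (cmod v + 1).
  by rewrite E cmodM cmod_rc ler_wpM2l// lerDl.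
have := Hd (p + s%:C * v); rewrite ltr_pdivlMr// in st.
move=> /(_ (le_lt_trans Ec st)) h.
have -> : (a * Re v + b * Im v) * (s - t) = a * Re ((s - t)%:C * v) + b * Im ((s - t)%:C * v).
  by rewrite !cE /=; ring.
rewrite -E (le_trans h)//.
by rewrite mulrAC ler_pdivrMr// -mulrA ler_wpM2l// ltW.
Qed.

Lemma rdiff_x F (x y a b : R) : rdiff F (x +i* y) a b ->
  is_derive x 1 (fun s => F (s +i* y)) a.
Proof.
have E s : s +i* y = (0 +i* y) + s%:C * 1 :> C by apply: ceqP; rewrite !cE /=; ring.
rewrite E => /rdiff_ray; rewrite /= mulr1 mulr0 addr0.
by under eq_fun do rewrite -E.
Qed.

Lemma rdiff_y F (x y a b : R) : rdiff F (x +i* y) a b ->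
  is_derive y 1 (fun s => F (x +i* s)) b.
Proof.
have E s : x +i* s = x%:C + s%:C * 'i%C :> C by apply: ceqP; rewrite !cE /=; ring.
rewrite E => /rdiff_ray; rewrite /= mulr0 mulr1 add0r.
by under eq_fun do rewrite -E.
Qed.

Definition ccontR F := forall z (e : R), 0 < e ->
  exists2 d : R, 0 < d & forall w, cmod (w - z) < d -> `|F w - F z| < e.

Lemma ccontR_comp F (x y : R -> R) : ccontR F -> continuous x -> continuous y ->
  continuous (fun t => F (x t +i* y t)).
Proof.
move=> cF cx cy t; apply/cvgrPdist_lt => e e0.
have [d d0 Hd] := cF (x t +i* y t) e e0.
have d20 : 0 < d / 2 by rewrite divr_gt0.
have /cvgrPdist_lt/(_ _ d20) hx := cx t; have /cvgrPdist_lt/(_ _ d20) hy := cy t.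
near=> s; rewrite distrC; apply: Hd.
apply: le_lt_trans (cmod_le_ReIm _) _; rewrite !cE /=.
have : `|x t - x s| < d / 2 by near: s.
have : `|y t - y s| < d / 2 by near: s.
by rewrite distrC => h1; rewrite distrC => h2; lra.
Unshelve. all: by end_near. Qed.

(** Lipschitz on every disc: stable under sums and products, and it yields continuity, boundedness
    and integrability on discs together. No more regularity is tracked for second derivatives. *)
Definition locLip F := forall r : R, exists2 K : R, 0 <= K & forall z w,
  cmod z <= r -> cmod w <= r -> `|F z - F w| <= K * cmod (z - w).

Lemma locLip_ccontR F : locLip F -> ccontR F.
Proof.
move=> lF z e e0; have [K K0 HK] := lF (cmod z + 1).
exists (Num.min 1 (e / (K + 1))); first by rewrite lt_min ltr01 divr_gt0// ltr_wpDl.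
move=> w; rewrite lt_min => /andP[w1 w2].
have wr : cmod w <= cmod z + 1.
  by have := cmodD (w - z) z; rewrite subrK; lra.
apply: le_lt_trans (HK _ _ wr _) _; first by rewrite lerDl.
rewrite ltr_pdivlMr ?ltr_wpDl// in w2.
by apply: le_lt_trans w2; rewrite [X in X <= _]mulrC ler_wpM2l ?cmod_ge0 ?lerDl//.
Qed.

Lemma locLip_bounded F r : locLip F -> exists2 M : R, 0 <= M &
  forall z, cmod z <= r -> `|F z| <= M.
Proof.
move=> lF; have [K K0 HK] := lF `|r|.
exists (`|F 0| + K * `|r|); first by rewrite addr_ge0// mulr_ge0.
move=> z zr; have zr' : cmod z <= `|r| by rewrite (le_trans zr)// ler_norm.
have := HK z 0 zr'; rewrite cmod0 subr0 => /(_ (normr_ge0 _)) h.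
have := ler_normD (F z - F 0) (F 0); rewrite subrK.
have : K * cmod z <= K * `|r| by rewrite ler_wpM2l.
lra.
Qed.

Lemma locLip_cst (k : R) : locLip (fun=> k).
Proof. by move=> r; exists 0 => // z w _ _; rewrite subrr normr0 mul0r. Qed.

Lemma locLipD F G : locLip F -> locLip G -> locLip (fun z => F z + G z).
Proof.
move=> lF lG r; have [K K0 HK] := lF r; have [L L0 HL] := lG r.
exists (K + L); first by rewrite addr_ge0.
move=> z w zr wr; have := HK z w zr wr; have := HL z w zr wr.
have := ler_normD (F z - F w) (G z - G w).
rewrite (_ : F z - F w + _ = F z + G z - (F w + G w)); last by ring.
rewrite mulrDl; lra.
Qed.

Lemma locLipM F G : locLip F -> locLip G -> locLip (fun z => F z * G z).
Proof.
move=> lF lG r; have [K K0 HK] := lF r; have [L L0 HL] := lG r.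
have [M M0 HM] := locLip_bounded r lF; have [N N0 HN] := locLip_bounded r lG.
exists (M * L + K * N); first by rewrite addr_ge0// mulr_ge0.
move=> z w zr wr.
rewrite (_ : F z * G z - F w * G w = F z * (G z - G w) + (F z - F w) * G w); last by ring.
apply: le_trans (ler_normD _ _) _; rewrite !normrM mulrDl.
apply: lerD; first by rewrite -mulrA ler_pM// ?HM ?HL.
by rewrite mulrAC ler_pM// ?HK ?HN.
Qed.

Lemma locLipN F : locLip F -> locLip (fun z => - F z).
Proof.
by move=> /(locLipM (locLip_cst (-1))); under eq_fun do rewrite mulN1r.
Qed.

(** The lower bound 1 keeps the Lipschitz constant unchanged; K satisfies it because P_0 = 1. *)
Lemma locLipV F : (forall z, 1 <= F z) -> locLip F -> locLip (fun z => (F z)^-1).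
Proof.
move=> F1 lF r; have [K K0 HK] := lF r; exists K => // z w zr wr.
have Fz z' : F z' != 0 by rewrite gt_eqF// (lt_le_trans ltr01).
rewrite (_ : _ - _ = (F w - F z) / (F z * F w)); last by field; rewrite !Fz.
rewrite normrM (@le_trans _ _ `|F w - F z|)//; last by rewrite distrC HK.
rewrite ler_piMr// normfV invf_le1; last by rewrite normr_gt0 mulf_neq0.
rewrite normrM !ger0_norm ?(le_trans ler01)//.
by rewrite -[1]mulr1; apply: ler_pM.
Qed.

Lemma rdiffD F G z a b c d : rdiff F z a b -> rdiff G z c d ->
  rdiff (fun w => F w + G w) z (a + c) (b + d).
Proof.
move=> HF HG e e0; have e20 : 0 < e / 2 by rewrite divr_gt0.
have [d1 d10 H1] := HF _ e20; have [d2 d20 H2] := HG _ e20.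
exists (Num.min d1 d2); first by rewrite lt_min d10.
move=> w; rewrite lt_min => /andP[/H1 h1 /H2 h2].
rewrite (_ : _ - _ = (F w - F z - (a * Re (w - z) + b * Im (w - z))) +
  (G w - G z - (c * Re (w - z) + d * Im (w - z)))); last by ring.
by apply: le_trans (ler_normD _ _) _; lra.
Qed.

Lemma rdiff_lip F z a b : rdiff F z a b -> exists2 d : R, 0 < d &
  forall w, cmod (w - z) < d -> `|F w - F z| <= (`|a| + `|b| + 1) * cmod (w - z).
Proof.
move=> H; have [d d0 Hd] := H 1 ltr01; exists d => // w /Hd h.
rewrite (_ : F w - F z = (F w - F z - (a * Re (w - z) + b * Im (w - z))) +
   (a * Re (w - z) + b * Im (w - z))); last by ring.
apply: le_trans (ler_normD _ _) _.
have h2 : `|a * Re (w - z) + b * Im (w - z)| <= (`|a| + `|b|) * cmod (w - z).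
  apply: le_trans (ler_normD _ _) _; rewrite !normrM mulrDl.
  by rewrite lerD// ler_wpM2l// (Re_le_cmod, Im_le_cmod).
by rewrite mulrDl mul1r; lra.
Qed.

Lemma rdiff_comp F z a b (phi : R -> R) (l : R) : rdiff F z a b ->
  (forall e : R, 0 < e -> exists2 d : R, 0 < d & forall s, `|s - F z| < d ->
     `|phi s - phi (F z) - l * (s - F z)| <= e * `|s - F z|) ->
  rdiff (fun w => phi (F w)) z (l * a) (l * b).
Proof.
move=> HF Hp e e0.
pose A := `|a| + `|b| + 1.
have A0 : 0 < A by rewrite ltr_wpDl// addr_ge0.
have l0 : 0 < `|l| + 1 by rewrite ltr_wpDl.
have [d1 d10 H1] := rdiff_lip HF.
have [d2 d20 H2] := Hp (e / 2 / A) (divr_gt0 (divr_gt0 e0 (ltr0n _ 2)) A0).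
have [d3 d30 H3] := HF (e / 2 / (`|l| + 1)) (divr_gt0 (divr_gt0 e0 (ltr0n _ 2)) l0).
exists (Num.min d1 (Num.min (d2 / A) d3)); first by rewrite !lt_min d10 d30 divr_gt0.
move=> w; rewrite !lt_min => /and3P[/H1 h1 w2 /H3 h3].
have Fd : `|F w - F z| < d2.
  by apply: le_lt_trans h1 _; rewrite mulrC -ltr_pdivlMr.
have := H2 _ Fd => h2.
rewrite (_ : _ - _ = (phi (F w) - phi (F z) - l * (F w - F z)) +
  l * (F w - F z - (a * Re (w - z) + b * Im (w - z)))); last by ring.
apply: le_trans (ler_normD _ _) _; rewrite normrM.
have k1 : e / 2 / A * `|F w - F z| <= e / 2 * cmod (w - z).
  apply: (@le_trans _ _ (e / 2 / A * (A * cmod (w - z)))).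
    by rewrite ler_wpM2l// !divr_ge0// ltW.
  by rewrite mulrA divfK// gt_eqF.
have k2 : `|l| * `|F w - F z - (a * Re (w - z) + b * Im (w - z))| <= e / 2 * cmod (w - z).
  apply: (@le_trans _ _ ((`|l| + 1) * (e / 2 / (`|l| + 1) * cmod (w - z)))).
    by apply: ler_pM => //; rewrite lerDl.
  by rewrite mulrA mulrCA mulfV ?mulr1// gt_eqF.
lra.
Qed.

Lemma is_derive_eps (f : R -> R) (t l : R) : is_derive t 1 f l ->
  forall e : R, 0 < e -> exists2 d : R, 0 < d & forall s, `|s - t| < d ->
     `|f s - f t - l * (s - t)| <= e * `|s - t|.
Proof.
move=> [df fl] e e0.
have : h^-1 *: (f (h *: 1 + t) - f t) @[h --> (0 : R)^'] --> l.
  by rewrite -fl; exact: df.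
move=> /cvgrPdist_le/(_ e e0); rewrite near_withinE => /nbhs_ballP[d /= d0 Hd].
exists d => // s st; have [->|sn] := eqVneq s t.
  by rewrite !subrr mulr0 subrr normr0 mulr0.
have sn0 : s - t != 0 by rewrite subr_eq0.
have := Hd (s - t); rewrite /ball /= sub0r normrN => /(_ st sn0).
rewrite -[(s - t) *: 1]/((s - t) * 1) mulr1 subrK -[_ *: _]/(_ * _).
rewrite -(@ler_pM2r _ `|s - t|) ?normr_gt0// -normrM mulrBl mulrAC mulVf// mul1r.
by rewrite distrC.
Qed.

Lemma rdiff_compD F z a b (phi : R -> R) (l : R) : rdiff F z a b ->
  is_derive (F z) 1 phi l -> rdiff (fun w => phi (F w)) z (l * a) (l * b).
Proof. by move=> HF /is_derive_eps; exact: rdiff_comp. Qed.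

(** Polarisation: the product is half of (F + G)^2 - F^2 - G^2, and squares fall under the chain
    rule. *)
Lemma rdiffM F G z a b c d : rdiff F z a b -> rdiff G z c d ->
  rdiff (fun w => F w * G w) z (F z * c + G z * a) (F z * d + G z * b).
Proof.
move=> HF HG.
have sq H (p q : R) : rdiff H z p q -> rdiff (fun w => H w ^+ 2) z (2 * H z * p) (2 * H z * q).
  move=> rH; apply: (rdiff_compD rH (phi := fun s => s ^+ 2)).
  apply: is_deriveP => e e0; exists e => // s se.
  rewrite (_ : _ - _ = (s - H z) ^+ 2); last by ring.
  by rewrite normrX expr2 ler_wpM2r// ltW.
have sc H (p q k : R) : rdiff H z p q -> rdiff (fun w => k * H w) z (k * p) (k * q).
  move=> rH; apply: (rdiff_compD rH (phi := fun s => k * s)).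
  apply: is_deriveP => e e0; exists e => // s se.
  have -> : k * s - k * H z - k * (s - H z) = 0 by ring.
  by rewrite normr0 mulr_ge0// ltW.
have S := sc _ _ _ (1/2) (sq _ _ _ (rdiffD HF HG)).
have SF := sc _ _ _ (-1/2) (sq _ _ _ HF).
have SG := sc _ _ _ (-1/2) (sq _ _ _ HG).
have := rdiffD S (rdiffD SF SG).
rewrite [X in rdiff X](_ : _ = (fun w => F w * G w)); last by apply/funext => w; field.
rewrite [X in rdiff _ _ X](_ : _ = F z * c + G z * a); last by field.
by rewrite [X in rdiff _ _ _ X](_ : _ = F z * d + G z * b); last by field.
Qed.

End PlaneCalculus.

(** * Area integrals over discs by horizontal sections *)

Section PlaneMeasure.
Context {R : realType}.
Local Notation C := R[i].
Local Notation mR := (measurableTypeR R).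
Local Notation mu := (@lebesgue_measure R).
Implicit Types (F G : C -> R) (z w : C).

Lemma ccontR_y F (x : R) : ccontR F -> continuous (fun y : R => F (x +i* y)).
Proof.
by move=> cF; apply: (ccontR_comp cF) => t; [exact: cvg_cst|exact: cvg_id].
Qed.
Lemma ccontR_x F (y : R) : ccontR F -> continuous (fun x : R => F (x +i* y)).
Proof.
by move=> cF; apply: (ccontR_comp cF) => t; [exact: cvg_id|exact: cvg_cst].
Qed.

(* Freezing the first coordinate on a grid of mesh 1/n gives functions that are
   measurable on countably many vertical strips. *)
Lemma measurable_plane F : ccontR F ->
  measurable_fun setT (fun p : mR * mR => F ((p.1 : R) +i* (p.2 : R))).
Proof.
move=> cF.
pose st (n : nat) (x : R) : R := (Num.floor (x * n.+1%:R))%:~R / n.+1%:R.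
apply: (@measurable_fun_cvg _ _ _ _ (fun n p => F (st n p.1 +i* (p.2 : R)))).
- move=> n _ B mB; rewrite setTI.
  rewrite (_ : _ @^-1` B = \bigcup_(k : int)
    ([set x : mR | Num.floor ((x : R) * n.+1%:R) = k] `*`
     ((fun y : R => F (k%:~R / n.+1%:R +i* y)) @^-1` B))); last first.
    apply/seteqP; split=> [[x y] /= Bxy|[x y] [k _ [/= xk Bk]]].
      by exists (Num.floor (x * n.+1%:R)).
    by rewrite /st /= xk.
  apply: countable_bigcupT_measurable; first exact: countableP.
  move=> k; apply: measurableX.
    rewrite (_ : [set _ | _] = `[k%:~R / n.+1%:R, (k + 1)%:~R / n.+1%:R[%classic).
      exact: measurable_itv.
    apply/seteqP; split => x /=.
      move=> xk; rewrite in_itv /= ler_pdivrMr// ltr_pdivlMr//.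
      by rewrite -xk floor_itv.
    rewrite in_itv /= ler_pdivrMr// ltr_pdivlMr// => h; exact/floor_def.
  rewrite -[_ @^-1` _]setTI.
  have cm : continuous (fun y : R => F (k%:~R / n.+1%:R +i* y)) by exact: ccontR_y.
  exact: (continuous_measurable_fun cm).
- move=> [x y] _ /=; apply/cvgrPdist_lt => e e0.
  have [d d0 Hd] := cF (x +i* y) e e0.
  have := @near_infty_natSinv_lt R (PosNum d0).
  apply: filterS => n /= nd; rewrite distrC; apply: Hd.
  rewrite (_ : _ - _ = (st n x - x)%:C); last by apply: ceqP; rewrite !cE //= subrr.
  rewrite cmod_rc; apply: le_lt_trans nd.
  have n0 : 0 < n.+1%:R :> R by [].
  have /andP[f1 f2] := floor_itv (x * n.+1%:R).
  have g1 : st n x <= x by rewrite /st ler_pdivrMr.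
  rewrite distrC ger0_norm ?subr_ge0// ltW//.
  rewrite -(@ltr_pM2r _ n.+1%:R)// mulVf ?gt_eqF// mulrBl /st divfK ?gt_eqF//.
  by move: f2; rewrite rmorphD /=; lra.
Qed.

Definition Disc (t : R) : set (mR * mR) := [set p | cmod ((p.1 : R) +i* (p.2 : R)) < t].

Lemma DiscE t (x y : R) : 0 < t -> Disc t (x, y) <-> x ^+ 2 + y ^+ 2 < t ^+ 2.
Proof.
move=> t0; have E : (cmod (x +i* y) < t) = (x ^+ 2 + y ^+ 2 < t ^+ 2).
  by rewrite -(@ltr_pXn2r _ 2)// ?nnegrE ?cmod_ge0 ?(ltW t0)// cmod_sq.
by rewrite -E.
Qed.

Lemma ccontR_cmod : ccontR (fun z : C => cmod z).
Proof.
move=> z e e0; exists e => // w wz; rewrite ltr_norml.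
have := cmod_triB z w; have := cmod_triB w z.
by rewrite [cmod (z - w)]cmodC; lra.
Qed.

Lemma measurable_Disc t : measurable (Disc t).
Proof.
rewrite (_ : Disc t = (fun p : mR * mR => cmod ((p.1 : R) +i* (p.2 : R))) @^-1` `]-oo, t[%classic).
  by rewrite -[_ @^-1` _]setTI; apply: (measurable_plane ccontR_cmod) => //; exact: measurable_itv.
by apply/seteqP; split => p /=; rewrite in_itv.
Qed.

Lemma Disc_finite t : ((mu \x mu)%E (Disc t) < +oo)%E.
Proof.
apply: (@le_lt_trans _ _ ((mu \x mu)%E (`[-t, t]%classic `*` `[-t, t]%classic))).
  apply: le_measure; rewrite ?inE; [exact: measurable_Disc| |].
    by apply: measurableX; exact: measurable_itv.
  move=> [x y]; rewrite /Disc /= => xy.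
  have := Re_le_cmod (x +i* y); have := Im_le_cmod (x +i* y); rewrite /= !ler_norml => h1 h2.
  by split; rewrite /= in_itv /=; lra.
rewrite product_measure1E; [|exact: measurable_itv|exact: measurable_itv].
have h : (mu `[(- t)%R, t]%classic < +oo)%E.
  by rewrite lebesgue_measure_itv /=; case: ifPn => _ //; rewrite -EFinB ltry.
by apply: lte_mul_pinfty => //; rewrite ge0_fin_numE.
Qed.

Lemma integrable_Disc F t : locLip F ->
  (mu \x mu)%E.-integrable (Disc t) (EFin \o (fun p : mR * mR => F ((p.1 : R) +i* (p.2 : R)))).
Proof.
move=> lF; apply: measurable_bounded_integrable.
- exact: measurable_Disc.
- exact: Disc_finite.
- by apply: measurable_funTS; apply: measurable_plane; exact: locLip_ccontR.
- have [M M0 HM] := locLip_bounded t lF.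
  exists M; split; first exact: num_real.
  move=> N MN p /= pD; apply: le_trans (ltW MN); apply: HM; exact: ltW.
Qed.

(* The section of the disc at height y is the interval (-s, s) with
   s = sqrt (t^2 - y^2), which is empty when |y| >= t. *)
Lemma Disc_integral_x F Fx t : 0 < t -> ccontR F -> locLip Fx ->
  (forall x y : R, is_derive x 1 (fun s => F (s +i* y)) (Fx (x +i* y))) ->
  \int[(mu \x mu)%E]_(p in Disc t) Fx ((p.1 : R) +i* (p.2 : R)) =
  RI (fun y => F (Num.sqrt (t ^+ 2 - y ^+ 2) +i* y) - F (- Num.sqrt (t ^+ 2 - y ^+ 2) +i* y)) (- t) t.
Proof.
move=> t0 cF lFx dF; have cFx := locLip_ccontR lFx.
pose s (y : R) : R := Num.sqrt (t ^+ 2 - y ^+ 2).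
pose G (y : R) := F (s y +i* y) - F (- s y +i* y).
rewrite /Rintegral integral_mkcond.
set f := (X in integral _ _ X).
have intf : (mu \x mu)%E.-integrable setT f.
  by apply/(integrable_restrict _ (measurable_Disc t)) => //; rewrite setTI; exact: integrable_Disc.
rewrite -(integral21_prod_meas1 intf).
have s0 y : 0 <= s y by exact: sqrtr_ge0.
have inner (y : R) : fubini_G mu f y = (G y)%:E.
  rewrite /fubini_G /=.
  have sec (x : R) : Disc t (x, y) <-> - s y < x < s y.
    rewrite -ltr_norml; split=> [/(DiscE _ _ t0) h|h].
      rewrite -(@ltr_pXn2r _ 2)// ?nnegrE// real_normK ?num_real// /s.
      have := sqr_ge0 x => x2; rewrite sqr_sqrtr; lra.
    have y2 : 0 < t ^+ 2 - y ^+ 2 by rewrite -sqrtr_gt0 (le_lt_trans _ h).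
    apply/DiscE => //; move: h; rewrite -(@ltr_pXn2r _ 2)// ?nnegrE// real_normK ?num_real// /s.
    rewrite sqr_sqrtr ?(ltW y2)//; lra.
  transitivity (\int[mu]_(x in `](- s y)%R, (s y)%R[) (Fx (x +i* y))%:E)%E.
    rewrite [RHS]integral_mkcond; apply: eq_integral => x _.
    rewrite /f !patchE; case: ifPn => h1; case: ifPn => h2 //; exfalso.
      by move: h1 h2; rewrite inE => /sec h1; rewrite notin_setE /= in_itv.
    by move: h1 h2; rewrite notin_setE inE /= in_itv /= => h1 /sec.
  have cFxy := @ccontR_x Fx y cFx.
  have iFxy := cont_integrable (- s y) (s y) cFxy.
  have mFx : measurable_fun (`](- s y), (s y)[%classic : set R) (fun x : R => (Fx (x +i* y))%:E).
    by apply/measurable_EFinP; apply: measurable_funTS; exact: continuous_measurable_fun.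
  rewrite -(@integral_itv_bndoo _ _ _ _ true false mFx).
  rewrite -[LHS]fineK; last by apply: integrable_fin_num => //; exact: iFxy.
  congr (_%:E); rewrite -[LHS]/(Rintegral _ _ _) -RI_le; last by have := s0 y; lra.
  by rewrite (@FTC _ _ (fun x => F (x +i* (y : R)))).
under eq_integral do rewrite inner.
have cs : continuous s.
  have c1 : continuous (fun y : R => t ^+ 2 - y ^+ 2).
    by move=> y; apply: cvgB; [exact: cvg_cst|exact: exprn_continuous].
  by move=> y; apply: (continuous_comp (c1 y)); exact: sqrt_continuous.
have cid : continuous (fun y : R => y) by move=> y; exact: cvg_id.
have cns : continuous (fun y => - s y) by move=> y; apply: cvgN; exact: cs.
have cG1 := ccontR_comp cF cs cid; have cG2 := ccontR_comp cF cns cid.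
have cG : continuous G by move=> y; apply: cvgB; [exact: cG1|exact: cG2].
rewrite RI_le; last by lra.
congr fine; rewrite [RHS]integral_mkcond; apply: eq_integral => y _.
rewrite patchE; case: ifPn => //; rewrite notin_setE /= in_itv /= -ler_norml => /negP.
rewrite -ltNge => ty.
(* The square root of a negative number is 0 by convention, so both endpoints coincide and G
   vanishes outside [-t, t]. *)
have sy : s y = 0.
  apply/ler0_sqrtr; rewrite subr_le0 -[y ^+ 2]real_normK ?num_real//.
  by rewrite ler_pXn2r// ?nnegrE ?(ltW t0) ?(ltW ty).
by rewrite /G sy oppr0 subrr.
Qed.

End PlaneMeasure.

(** * The divergence theorem on a disc *)

Section PolarIntegrals.
Context {R : realType}.
Local Notation C := R[i].
Local Notation mR := (measurableTypeR R).
Local Notation mu := (@lebesgue_measure R).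
Implicit Types (F G u : C -> R) (z w : C) (f : R -> R).

Lemma cont_cst (k : R) : continuous (fun _ : R => k).
Proof. by move=> t; exact: cvg_cst. Qed.

Lemma contM f (g : R -> R) : continuous f -> continuous g -> continuous (fun t => f t * g t).
Proof. by move=> cf cg t; apply: cvgM; [exact: cf|exact: cg]. Qed.
Lemma contD f (g : R -> R) : continuous f -> continuous g -> continuous (fun t => f t + g t).
Proof. by move=> cf cg t; apply: cvgD; [exact: cf|exact: cg]. Qed.
Lemma contN f : continuous f -> continuous (fun t => - f t).
Proof. by move=> cf t; apply: cvgN; exact: cf. Qed.
Lemma contcomp f (g : R -> R) : continuous f -> continuous g -> continuous (fun t => f (g t)).
Proof. by move=> cf cg t; apply: (continuous_comp (cg t)); exact: cf. Qed.
Lemma cont_affine (a b : R) : continuous (fun t : R => a + b * t).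
Proof. by apply: contD; [exact: cont_cst|apply: contM; [exact: cont_cst|move=> t; exact: cvg_id]]. Qed.

Lemma is_derive_affine (a b x : R) : is_derive x 1 (fun t : R => a + b * t) b.
Proof.
apply: is_deriveP => e e0; exists 1 => // s _.
have -> : a + b * s - (a + b * x) - b * (s - x) = 0 by ring.
by rewrite normr0 mulr_ge0// ltW.
Qed.

Lemma RI_affine f (a b c d : R) : continuous f ->
  b * RI (fun t => f (a + b * t)) c d = RI f (a + b * c) (a + b * d).
Proof.
move=> cf; rewrite -(RI_subst (dg := fun=> b) c d cf (@cont_cst b) (is_derive_affine a b)).
have cfg : continuous (fun t => f (a + b * t)) by apply: contcomp => //; exact: cont_affine.
by rewrite -RIZ//; apply: eq_RI => x; rewrite mulrC.
Qed.

Lemma RI_periodic f (T a : R) : continuous f -> (forall x, f (x + T) = f x) ->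
  RI f a (a + T) = RI f 0 T.
Proof.
move=> cf pf; rewrite -(RI_cat a 0 (a + T) cf) -(RI_cat 0 T (a + T) cf).
have := @RI_affine f T 1 0 a cf; rewrite !mul1r addr0 [T + a]addrC => <-.
rewrite (@eq_RI _ _ f); last by move=> x; rewrite mul1r addrC.
by rewrite [RI f a 0]RI_anti; ring.
Qed.

Lemma RI_refl f (a b c : R) : continuous f ->
  RI (fun t => f (c - t)) a b = RI f (c - b) (c - a).
Proof.
move=> cf; have := @RI_affine f c (-1) a b cf; rewrite !mulN1r => h.
rewrite [RHS]RI_anti -h opprK; apply: eq_RI => x; by rewrite mulN1r.
Qed.

Definition cis (t phi : R) : C := (t * cos phi) +i* (t * sin phi).

Lemma cont_cos : continuous (@cos R). Proof. by move=> t; exact: continuous_cos. Qed.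
Lemma cont_sin : continuous (@sin R). Proof. by move=> t; exact: continuous_sin. Qed.

Lemma cont_cis F (t : R) : ccontR F -> continuous (fun phi => F (cis t phi)).
Proof.
move=> cF; apply: (ccontR_comp cF); apply: contM; try exact: cont_cst.
- exact: cont_cos.
- exact: cont_sin.
Qed.

Lemma cis_2pi t phi : cis t (phi + pi *+ 2) = cis t phi.
Proof. by rewrite /cis mulr2n addrA !cosDpi !sinDpi !opprK. Qed.

Lemma cmod_cis t phi : 0 <= t -> cmod (cis t phi) = t.
Proof.
move=> t0; apply/eqP; rewrite -(@eqrXn2 _ 2)// ?cmod_ge0// cmod_sq /=.
by rewrite !exprMn -mulrDr cos2Dsin2 mulr1.
Qed.

(** The divergence theorem for the field (F, 0). With y = t sin phi the right ends of the sections
    sweep the right half circle, and phi -> pi - phi carries the left ends to the left half;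
    periodicity glues the two. *)
Lemma Disc_polar_x F Fx t : 0 < t -> ccontR F -> locLip Fx ->
  (forall x y : R, is_derive x 1 (fun s => F (s +i* y)) (Fx (x +i* y))) ->
  \int[(mu \x mu)%E]_(p in Disc t) Fx ((p.1 : R) +i* (p.2 : R)) =
  RI (fun phi => F (cis t phi) * (t * cos phi)) 0 (pi *+ 2).
Proof.
move=> t0 cF lFx dF; rewrite (Disc_integral_x t0 cF lFx dF).
pose s (y : R) : R := Num.sqrt (t ^+ 2 - y ^+ 2).
pose G (y : R) : R := F (s y +i* y) - F (- s y +i* y).
have cid : continuous (fun y : R => y) by move=> y; exact: cvg_id.
have cs : continuous s.
  have c1 : continuous (fun y : R => t ^+ 2 - y ^+ 2).
    by move=> y; apply: cvgB; [exact: cvg_cst|exact: exprn_continuous].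
  by move=> y; apply: (continuous_comp (c1 y)); exact: sqrt_continuous.
have cG : continuous G.
  apply: contD; first exact: (ccontR_comp cF cs cid).
  by apply: contN; exact: (ccontR_comp cF (contN cs) cid).
rewrite -/(RI G (- t) t).
have dsin (x : R) : is_derive x 1 (fun x => t * sin x) (t * cos x) by apply: is_deriveZ.
have ctcos : continuous (fun x => t * cos x) by apply: contM; [exact: cont_cst|exact: cont_cos].
have ctsin : continuous (fun x => t * sin x) by apply: contM; [exact: cont_cst|exact: cont_sin].
have := RI_subst (- (pi / 2)) (pi / 2) cG ctcos dsin.
rewrite sinN sin_pihalf mulrN mulr1 => <-.
pose H phi := F (cis t phi) * (t * cos phi).
have cH : continuous H by apply: contM => //; exact: cont_cis.
have cH' : continuous (fun phi => H (pi - phi)).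
  by apply: contcomp => //; apply: contD; [exact: cont_cst|exact: contN].
have pi2 : - (pi / 2) <= pi / 2 :> R by have := pi_gt0 R; lra.
have E : RI (fun x => G (t * sin x) * (t * cos x)) (- (pi / 2)) (pi / 2) =
         RI (fun x => H x + H (pi - x)) (- (pi / 2)) (pi / 2).
  apply: eq_RI_in => //.
  - by apply: contM => //; exact: contcomp.
  - exact: contD.
  move=> x /cos_ge0_pihalf cx.
  have sE : s (t * sin x) = t * cos x.
    rewrite /s -[in LHS](mulr1 (t ^+ 2)) -(cos2Dsin2 x) exprMn mulrDr addrK -exprMn.
    by rewrite sqrtr_sqr ger0_norm// mulr_ge0// ltW.
  rewrite /G sE /H /cis [pi - x]addrC cosDpi sinDpi cosN sinN opprK.
  by rewrite !mulrN; ring.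
rewrite E RID// RI_refl// opprK.
have -> : pi - pi / 2 = pi / 2 :> R by field.
rewrite RI_cat//.
have -> : pi + pi / 2 = - (pi / 2) + pi *+ 2 :> R by rewrite mulr2n; field.
apply: RI_periodic => // x.
by rewrite /H cis_2pi mulr2n addrA !cosDpi opprK.
Qed.

Lemma locLip_swap F : locLip F -> locLip (fun z => F (Im z +i* Re z)).
Proof.
move=> lF r; have [K K0 HK] := lF r; exists K => // z w zr wr.
have E (x : C) : cmod (Im x +i* Re x) = cmod x.
  by case: x => a b /=; rewrite addrC.
apply: le_trans (HK _ _ _ _) _; rewrite ?E//.
by rewrite -[X in _ <= K * X]E !cE.
Qed.

Lemma Disc_swap G t : locLip G ->
  \int[(mu \x mu)%E]_(p in Disc t) G ((p.1 : R) +i* (p.2 : R)) =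
  \int[(mu \x mu)%E]_(p in Disc t) G ((p.2 : R) +i* (p.1 : R)).
Proof.
move=> lG; congr fine; rewrite [LHS]integral_mkcond [RHS]integral_mkcond.
set f := (X in integral _ _ X = _); set g := (X in _ = integral _ _ X).
have intf : (mu \x mu)%E.-integrable setT f.
  by apply/(integrable_restrict _ (measurable_Disc t)) => //; rewrite setTI; exact: integrable_Disc.
have intg : (mu \x mu)%E.-integrable setT g.
  apply/(integrable_restrict _ (measurable_Disc t)) => //; rewrite setTI.
  exact: (integrable_Disc t (locLip_swap lG)).
rewrite -(integral12_prod_meas1 intf) -(integral21_prod_meas1 intg).
apply: eq_integral => x _; apply: eq_integral => y _ /=.
rewrite /f /g !patchE; congr (if _ then _ else _).
apply/idP/idP; rewrite !inE /Disc /=; by rewrite addrC.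
Qed.

(** Exchanging x and y reduces this to the other coordinate; on the circle the exchange is phi -> pi
    / 2 - phi. *)
Lemma Disc_polar_y F Fy t : 0 < t -> ccontR F -> locLip Fy ->
  (forall x y : R, is_derive y 1 (fun s => F (x +i* s)) (Fy (x +i* y))) ->
  \int[(mu \x mu)%E]_(p in Disc t) Fy ((p.1 : R) +i* (p.2 : R)) =
  RI (fun phi => F (cis t phi) * (t * sin phi)) 0 (pi *+ 2).
Proof.
move=> t0 cF lFy dF; rewrite Disc_swap//.
have cF' : ccontR (fun z => F (Im z +i* Re z)).
  move=> z e e0; have [d d0 Hd] := cF (Im z +i* Re z) e e0; exists d => // w wz.
  by apply: Hd; move: wz; case: w => ? ?; case: z => ? ? /=; rewrite addrC.
have dF' (x y : R) : is_derive x 1 (fun s => F (Im (s +i* y) +i* Re (s +i* y)))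
    (Fy (Im (x +i* y) +i* Re (x +i* y))) by exact: dF.
rewrite (Disc_polar_x t0 cF' (locLip_swap lFy) dF').
pose H phi := F (cis t phi) * (t * sin phi).
have cH : continuous H.
  by apply: contM; [exact: cont_cis|apply: contM; [exact: cont_cst|exact: cont_sin]].
have HE x : F (Im (cis t x) +i* Re (cis t x)) * (t * cos x) = H (pi / 2 - x).
  by rewrite /H /cis /= [_ - x]addrC sinDpihalf cosDpihalf sinN cosN opprK.
rewrite (eq_RI _ _ HE) RI_refl// subr0.
rewrite [X in RI _ _ X](_ : _ = pi / 2 - pi *+ 2 + pi *+ 2); last by rewrite subrK.
apply: RI_periodic => // x.
by rewrite /H cis_2pi mulr2n addrA !sinDpi opprK.
Qed.

End PolarIntegrals.

(** * Jensen's formula for twice differentiable functions *)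

Section Jensen.
Context {R : realType}.
Local Notation C := R[i].
Local Notation mR := (measurableTypeR R).
Local Notation mu := (@lebesgue_measure R).
Implicit Types (F G u : C -> R) (z w : C) (f : R -> R).

Lemma taylor1_le f (df : R -> R) (s t K : R) :
  (forall x : R, is_derive x 1 f (df x)) ->
  (forall x : R, `|x - t| <= `|s - t| -> `|df x - df t| <= K * `|x - t|) ->
  0 <= K ->
  `|f s - f t - df t * (s - t)| <= K * `|s - t| ^+ 2.
Proof.
move=> Hd HK K0.
have cf : continuous f by exact: is_derive_cont Hd.
have M (a b : R) : a < b -> exists2 c, a < c < b & f b - f a = df c * (b - a).
  move=> ab; have [c] := MVT ab (fun x _ => Hd x) (continuous_subspaceT cf).
  by rewrite in_itv; exists c.
have [c [ct E]] : exists c, `|c - t| <= `|s - t| /\ f s - f t = df c * (s - t).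
  have [st|ts|->] := ltgtP s t.
  - have [c /andP[c1 c2] E] := M _ _ st; exists c; split.
      by rewrite !ler0_norm ?subr_le0 ?ltW//; lra.
    by rewrite -opprB E; ring.
  - have [c /andP[c1 c2] E] := M _ _ ts; exists c; split => //.
    by rewrite !ger0_norm ?subr_ge0 ?ltW//; lra.
  - by exists t; split => //; rewrite !subrr mulr0.
rewrite E -mulrBl normrM expr2 mulrA ler_wpM2r//.
by apply: le_trans (HK _ ct) _; rewrite ler_wpM2l.
Qed.

Lemma cis_ray t phi : cis t phi = 0 + t%:C * (cos phi +i* sin phi) :> C.
Proof. by rewrite /cis; apply: ceqP; rewrite !cE /=; ring. Qed.

Lemma cmod_cis_dist s t phi : cmod (cis s phi - cis t phi : C) = `|s - t|.
Proof.
rewrite (_ : _ - _ = (s - t)%:C * (cos phi +i* sin phi)); last first.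
  by rewrite /cis; apply: ceqP; rewrite !cE /=; ring.
by rewrite cmodM cmod_rc /= cos2Dsin2 sqrtr1 mulr1.
Qed.

Lemma cmod_cis_norm t phi : cmod (cis t phi : C) = `|t|.
Proof.
have := cmod_cis_dist t 0 phi; rewrite subr0 => <-; congr cmod.
by rewrite /cis !mul0r; apply: ceqP; rewrite !cE /= subr0.
Qed.

Lemma rdiff_ccontR (F : C -> R) (Fx Fy : C -> R) : (forall z, rdiff F z (Fx z) (Fy z)) -> ccontR F.
Proof.
move=> dF z e e0; have [d d0 Hd] := rdiff_lip (dF z).
have K0 : 0 < `|Fx z| + `|Fy z| + 1 by rewrite ltr_wpDl// addr_ge0.
exists (Num.min d (e / (`|Fx z| + `|Fy z| + 1))); first by rewrite lt_min d0 divr_gt0.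
move=> w; rewrite lt_min => /andP[/Hd h1 h2]; apply: le_lt_trans h1 _.
by rewrite mulrC -ltr_pdivlMr.
Qed.

(** By the two polar formulas the integral of the Laplacian over the disc of radius t is t M'(t),
    where M(t) is the integral of u over the angle. Division by t cancels the singularity at 0, and
    the fundamental theorem gives M(r) - M(0). *)
Lemma jensen_disc u ux uy uxx uyy (r : R) : 0 < r ->
  (forall z, rdiff u z (ux z) (uy z)) ->
  locLip ux -> locLip uy -> locLip uxx -> locLip uyy ->
  (forall x y : R, is_derive x 1 (fun s => ux (s +i* y)) (uxx (x +i* y))) ->
  (forall x y : R, is_derive y 1 (fun s => uy (x +i* s)) (uyy (x +i* y))) ->
  \int[mu]_(t in `]0, r[)
    ((\int[(mu \x mu)%E]_(p in Disc t)
       (uxx ((p.1 : R) +i* (p.2 : R)) + uyy ((p.1 : R) +i* (p.2 : R)))) / t)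
  = RI (fun phi => u (cis r phi)) 0 (pi *+ 2) - pi *+ 2 * u 0.
Proof.
move=> r0 du lux luy luxx luyy dux duy.
have cux := locLip_ccontR lux; have cuy := locLip_ccontR luy.
have cu := rdiff_ccontR du.
pose v t phi := ux (cis t phi) * cos phi + uy (cis t phi) * sin phi.
(* V and M are considered for all real t, negative ones included, so that the fundamental theorem
   can be applied at 0 without one-sided derivatives. *)
pose V t := RI (v t) 0 (pi *+ 2).
pose M t := RI (fun phi => u (cis t phi)) 0 (pi *+ 2).
have cv t : continuous (v t).
  by apply: contD; apply: contM; (exact: cont_cis || exact: cont_cos || exact: cont_sin).
have pi2 : 0 <= pi *+ 2 :> R by rewrite mulrn_wge0// pi_ge0.
have dv phi (t : R) : is_derive t 1 (fun s => u (cis s phi)) (v t phi).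
  have := du (cis t phi); rewrite cis_ray => /rdiff_ray.
  under eq_fun do rewrite -cis_ray.
  by rewrite -cis_ray.
have vlip rho : exists2 K : R, 0 <= K & forall s t phi, `|s| <= rho -> `|t| <= rho ->
    `|v s phi - v t phi| <= K * `|s - t|.
  have [K1 K10 H1] := lux rho; have [K2 K20 H2] := luy rho.
  exists (K1 + K2); first exact: addr_ge0.
  move=> s t phi sr tr.
  rewrite (_ : _ - _ = (ux (cis s phi) - ux (cis t phi)) * cos phi +
    (uy (cis s phi) - uy (cis t phi)) * sin phi); last by rewrite /v; ring.
  apply: le_trans (ler_normD _ _) _; rewrite !normrM mulrDl -(cmod_cis_dist s t phi).
  by apply: lerD; (apply: le_trans (ler_piMr _ _) _ => //;
    [rewrite ler_norml; (rewrite cos_geN1 cos_le1 || rewrite sin_geN1 sin_le1) |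
     (apply: H1 || apply: H2); rewrite cmod_cis_norm]).
have cV : continuous V.
  move=> t; apply/cvgrPdist_lt => e e0.
  have [K K0 HK] := vlip (`|t| + 1).
  have D0 : 0 < K * (pi *+ 2) + 1 by rewrite ltr_wpDl// mulr_ge0.
  apply/nbhs_ballP; exists (Num.min 1 (e / (K * (pi *+ 2) + 1))).
    by rewrite /= lt_min ltr01 divr_gt0.
  move=> s; rewrite /ball /= lt_min => /andP[s1 s2].
  have sr : `|s| <= `|t| + 1.
    by have := ler_normD (s - t) t; rewrite subrK distrC; lra.
  rewrite (_ : V t - V s = RI (fun phi => v t phi - v s phi) 0 (pi *+ 2)); last first.
    by rewrite /V -RIN// -RID//; exact: contN.
  apply: le_lt_trans (RI_abs_le (M := K * `|t - s|) pi2 _ _) _.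
  - by apply: contD => //; exact: contN.
  - by move=> phi _; apply: HK => //; rewrite lerDl.
  rewrite subr0; rewrite ltr_pdivlMr// in s2; apply: le_lt_trans s2.
  by rewrite mulrAC mulrC ler_wpM2l// lerDl.
have dM (t : R) : is_derive t 1 M (V t).
  apply: is_deriveP => e e0.
  have [K K0 HK] := vlip (`|t| + 1).
  have D0 : 0 < K * (pi *+ 2) + 1 by rewrite ltr_wpDl// mulr_ge0.
  exists (Num.min 1 (e / (K * (pi *+ 2) + 1))).
    by rewrite /= lt_min ltr01 divr_gt0.
  move=> s; rewrite lt_min => /andP[s1 s2].
  have cu' x : continuous (fun phi => u (cis x phi)) by exact: cont_cis.
  have cs : continuous (fun phi => (s - t) * v t phi) by apply: contM => //; exact: cont_cst.
  rewrite (_ : _ - _ - _ = RI (fun phi => u (cis s phi) - u (cis t phi) - (s - t) * v t phi) 0 (pi *+ 2)); last first.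
    rewrite RID; [|apply: contD => //; exact: contN|exact: contN].
    rewrite RID//; last exact: contN.
    by rewrite !RIN// RIZ// mulrC.
  apply: le_trans (RI_abs_le (M := K * `|s - t| ^+ 2) pi2 _ _) _.
  - by apply: contD; [apply: contD => //; exact: contN|exact: contN].
  - move=> phi _; rewrite [_ * v t phi]mulrC.
    apply: (taylor1_le (df := v^~ phi) (dv phi)) => // x xs.
    apply: HK; last by rewrite lerDl.
    by have := ler_normD (x - t) t; rewrite subrK; lra.
  rewrite subr0 expr2 mulrA mulrAC ler_wpM2r// mulrAC ltW//.
  rewrite ltr_pdivlMr// in s2; apply: le_lt_trans s2.
  by rewrite [X in _ <= X]mulrC ler_wpM2r// lerDl.
have inner t : 0 < t -> (\int[(mu \x mu)%E]_(p in Disc t)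
       (uxx ((p.1 : R) +i* (p.2 : R)) + uyy ((p.1 : R) +i* (p.2 : R)))) / t = V t.
  move=> t0; rewrite RintegralD; last 3 first.
  - exact: measurable_Disc.
  - exact: integrable_Disc.
  - exact: integrable_Disc.
  rewrite (Disc_polar_x t0 cux luxx dux) (Disc_polar_y t0 cuy luyy duy).
  have c1 : continuous (fun phi => ux (cis t phi) * cos phi).
    by apply: contM; [exact: cont_cis|exact: cont_cos].
  have c2 : continuous (fun phi => uy (cis t phi) * sin phi).
    by apply: contM; [exact: cont_cis|exact: cont_sin].
  rewrite (@eq_RI _ _ (fun phi => t * (ux (cis t phi) * cos phi))); last by move=> phi; ring.
  rewrite RIZ// (@eq_RI _ (fun phi => _ * (t * _)) (fun phi => t * (uy (cis t phi) * sin phi))); last by move=> phi; ring.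
  by rewrite RIZ// -mulrDr -RID// mulrC mulKf// gt_eqF.
rewrite (@eq_Rintegral _ _ _ mu _ V); last first.
  by move=> t; rewrite inE /= in_itv /= => /andP[t0 _]; exact: inner.
rewrite /Rintegral -(@integral_itv_bndoo _ _ _ _ true false); last first.
  by apply/measurable_EFinP; apply: measurable_funTS; exact: continuous_measurable_fun.
rewrite -[LHS]/(Rintegral _ _ _) -RI_le ?ltW// (FTC 0 r cV dM); congr (_ - _).
rewrite /M (@eq_RI _ _ (fun=> u 0)); last by move=> phi; rewrite /cis !mul0r.
by rewrite RI_cst subr0 mulrC.
Qed.

End Jensen.

(** * Orthogonal polynomials and the Jacobi recurrence *)

Section OrthogonalPolynomials.
Context {R : realType}.
Variable s : nat -> R.
Hypothesis s0 : s 0%N = 1.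
Hypothesis s_pd : positive_definite_seq s.
Implicit Types p q : {poly R}.
Local Notation ip := (poly_ip s).
Local Notation P := (opoly s).

Lemma ip_widen p q n m : (size p <= n)%N -> (size q <= m)%N ->
  ip p q = \sum_(i < n) \sum_(j < m) p`_i * q`_j * s (i + j)%N.
Proof.
move=> pn qm; rewrite /poly_ip.
rewrite (big_ord_widen n (fun i => \sum_(j < size q) p`_i * q`_j * s (i + j)%N) pn).
rewrite big_mkcond; apply: eq_bigr => i _; case: ifPn => h.
  rewrite (big_ord_widen m (fun j => p`_i * q`_j * s (i + j)%N) qm) big_mkcond.
  apply: eq_bigr => j _; case: ifPn => // hj.
  by rewrite [q`_j]nth_default ?mulr0 ?mul0r// leqNgt.
by rewrite big1// => j _; rewrite nth_default ?mul0r// leqNgt.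
Qed.

Lemma ipC p q : ip p q = ip q p.
Proof.
rewrite /poly_ip exchange_big; apply: eq_bigr => i _; apply: eq_bigr => j _.
by rewrite addnC [p`_j * _]mulrC.
Qed.

Lemma ipDl p q r : ip (p + q) r = ip p r + ip q r.
Proof.
rewrite (ip_widen (size_polyD p q) (leqnn _)).
rewrite (ip_widen (leq_maxl (size p) (size q)) (leqnn (size r))).
rewrite (ip_widen (leq_maxr (size p) (size q)) (leqnn (size r))).
rewrite -big_split; apply: eq_bigr => i _; rewrite -big_split; apply: eq_bigr => j _.
by rewrite coefD !mulrDl.
Qed.

Lemma ipZl k p r : ip (k *: p) r = k * ip p r.
Proof.
rewrite (ip_widen (size_scale_leq k p) (leqnn _)) /poly_ip mulr_sumr.
apply: eq_bigr => i _; rewrite mulr_sumr; apply: eq_bigr => j _.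
by rewrite coefZ !mulrA.
Qed.

Lemma ipZr k p r : ip r (k *: p) = k * ip r p.
Proof. by rewrite ipC ipZl ipC. Qed.
Lemma ip0l r : ip 0 r = 0.
Proof. by rewrite -(scale0r 0) ipZl mul0r. Qed.
Lemma ipNl p r : ip (- p) r = - ip p r.
Proof. by rewrite -scaleN1r ipZl mulN1r. Qed.
Lemma ip_suml (I : Type) (r : seq I) (A : pred I) (F : I -> {poly R}) q :
  ip (\sum_(i <- r | A i) F i) q = \sum_(i <- r | A i) ip (F i) q.
Proof.
elim/big_rec2: _ => [|i y x _ <-]; first exact: ip0l.
by rewrite ipDl.
Qed.

Lemma ip_mulX p q : ip ('X * p) q = ip p ('X * q).
Proof.
have h (r : {poly R}) : (size ('X * r)%R <= (size r).+1)%N.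
  by rewrite (leq_trans (size_polyMleq _ _))// size_polyX.
rewrite (ip_widen (h p) (leqnn _)) (ip_widen (leqnn _) (h q)) big_ord_recl.
rewrite big1 ?add0r; last by move=> j _; rewrite coefXM /= !mul0r.
apply: eq_bigr => i _; rewrite [RHS]big_ord_recl (coefXM q) /= mulr0 mul0r add0r.
by apply: eq_bigr => j _; rewrite !coefXM /= addSn addnS.
Qed.

Lemma ip_gt0 p : p != 0 -> 0 < ip p p.
Proof.
move=> p0; have [n sn] : exists n, size p = n.+1.
  by exists (size p).-1; rewrite prednK// size_poly_gt0.
have := @s_pd n (fun i => (p`_i)%:C) _; rewrite /poly_ip sn.
have -> : (\sum_(i < n.+1) \sum_(j < n.+1) (s (i + j)%N)%:C * (p`_i)%:C * ((p`_j)%:C)^*%C)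
   = (\sum_(i < n.+1) \sum_(j < n.+1) p`_i * p`_j * s (i + j)%N)%:C :> R[i].
  rewrite rmorph_sum; apply: eq_bigr => i _; rewrite rmorph_sum; apply: eq_bigr => j _.
  by rewrite conjc_real -!rmorphM /=; congr (_%:C); ring.
rewrite ltcR; apply.
exists ord_max => /=; rewrite (_ : p`_n = lead_coef p); last by rewrite lead_coefE sn.
by apply/eqP => -[] /eqP; rewrite lead_coef_eq0 (negbTE p0).
Qed.

Lemma size_gs n : size (gram_schmidt s n) = n.
Proof. by elim: n => //= n IH; rewrite size_rcons IH. Qed.

Lemma nth_gs n k : (k < n)%N -> nth 0 (gram_schmidt s n) k = P k.
Proof.
elim: n => // n IH; rewrite ltnS leq_eqVlt => /predU1P[->|kn] //.
by rewrite /= nth_rcons size_gs kn IH.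
Qed.

Definition gs_res n : {poly R} := 'X^n - \sum_(k < n) ip 'X^n (P k) *: P k.

Lemma opolyE n : P n = (Num.sqrt (ip (gs_res n) (gs_res n)))^-1 *: gs_res n.
Proof.
rewrite /opoly /= nth_rcons size_gs ltnn eqxx; set g := (X in ip X X).
suff -> : gs_res n = g by [].
rewrite /gs_res /g; congr (_ - _).
rewrite (big_nth 0) big_mkord size_gs; apply: eq_bigr => k _.
by rewrite nth_gs.
Qed.

(** Orthonormality and degrees go in one induction: the degrees of the earlier P_k give the residual
    leading coefficient 1, so it is nonzero, and positivity of the form then allows normalising
    it. *)
Lemma opoly_inv n :
  [/\ forall i j, (i < n)%N -> (j < n)%N -> ip (P i) (P j) = (i == j)%:R &
      forall i, (i < n)%N -> size (P i) = i.+1 /\ 0 < lead_coef (P i)].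
Proof.
elim: n => [|n [IH1 IH2]]; first by [].
have szsum : (size (\sum_(k < n) ip 'X^n (P k) *: P k)%R <= n)%N.
  apply: (leq_trans (size_sum _ _ _)); apply/bigmax_leqP => k _.
  apply: (@leq_trans (size (P k))); first exact: size_scale_leq.
  by have [-> _] := IH2 k (ltn_ord k).
have szg : size (gs_res n) = n.+1.
  by rewrite /gs_res size_polyDl size_polyXn// size_polyN ltnS.
have lg : lead_coef (gs_res n) = 1.
  by rewrite /gs_res lead_coefDl ?lead_coefXn// size_polyN size_polyXn ltnS.
have g0 : gs_res n != 0 by rewrite -size_poly_gt0 szg.
have og j : (j < n)%N -> ip (gs_res n) (P j) = 0.
  move=> jn; rewrite /gs_res ipDl ipNl ip_suml (bigD1 (Ordinal jn))//= big1; last first.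
    move=> k; rewrite -val_eqE /= => kj; rewrite ipZl IH1//.
    by rewrite (negbTE kj) mulr0.
  by rewrite ipZl IH1// eqxx mulr1 addr0 subrr.
have gp := ip_gt0 g0.
have sgp : 0 < Num.sqrt (ip (gs_res n) (gs_res n)) by rewrite sqrtr_gt0.
have nn : ip (P n) (P n) = 1.
  rewrite opolyE ipZl ipZr mulrA -invfM -expr2 sqr_sqrtr ?(ltW gp)// mulVf//.
  by rewrite gt_eqF.
have nj j : (j < n)%N -> ip (P n) (P j) = 0.
  by move=> jn; rewrite opolyE ipZl og// mulr0.
split.
- move=> i j; rewrite !ltnS leq_eqVlt => /predU1P[->|iN]; rewrite leq_eqVlt => /predU1P[->|jN].
  + by rewrite eqxx.
  + by rewrite nj// gtn_eqF.
  + by rewrite ipC nj// ltn_eqF.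
  + exact: IH1.
- move=> i; rewrite ltnS leq_eqVlt => /predU1P[->|iN]; last exact: IH2.
  rewrite opolyE size_scale ?invr_eq0 ?gt_eqF// szg; split => //.
  by rewrite lead_coefZ lg mulr1 invr_gt0.
Qed.

Lemma ip_opoly i j : ip (P i) (P j) = (i == j)%:R.
Proof.
have [H _] := opoly_inv (maxn i j).+1.
by apply: H; rewrite ltnS ?leq_maxl ?leq_maxr.
Qed.

Lemma size_opoly n : size (P n) = n.+1.
Proof. by have [_ /(_ n (ltnSn n))[]] := opoly_inv n.+1. Qed.

Lemma lead_opoly n : 0 < lead_coef (P n).
Proof. by have [_ /(_ n (ltnSn n))[]] := opoly_inv n.+1. Qed.

Lemma orth_eq0 n p : (size p <= n)%N -> (forall k, (k < n)%N -> ip p (P k) = 0) -> p = 0.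
Proof.
elim: n p => [|n IH] p; first by rewrite leqn0 size_poly_eq0 => /eqP.
move=> sp op; pose c := p`_n / lead_coef (P n).
have l0 : lead_coef (P n) != 0 by rewrite gt_eqF// lead_opoly.
have E : p = c *: P n.
  apply/eqP; rewrite -subr_eq0; apply/eqP; apply: IH.
    apply/leq_sizeP => j nj; rewrite coefB coefZ.
    move: nj; rewrite leq_eqVlt => /predU1P[<-|nj].
      by rewrite /c [X in _ - _ * X](_ : _ = lead_coef (P n)) ?divfK ?subrr// lead_coefE size_opoly.
    by rewrite !nth_default ?mulr0 ?subrr// ?size_opoly// (leq_trans sp).
  move=> k kn; rewrite ipDl ipNl ipZl ip_opoly gtn_eqF// mulr0 subr0 op//.
  exact: ltnW.
have := op n (ltnSn n); rewrite E ipZl ip_opoly eqxx mulr1 => ->.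
by rewrite scale0r.
Qed.

Lemma opoly_expand n p : (size p <= n)%N -> p = \sum_(k < n) ip p (P k) *: P k.
Proof.
move=> sp; apply/eqP; rewrite -subr_eq0; apply/eqP; apply: (@orth_eq0 n).
  rewrite (leq_trans (size_polyD _ _))// geq_max sp size_polyN.
  apply: (leq_trans (size_sum _ _ _)); apply/bigmax_leqP => k _.
  by apply: (@leq_trans (size (P k))); [exact: size_scale_leq|rewrite size_opoly].
move=> j jn; rewrite ipDl ipNl ip_suml (bigD1 (Ordinal jn))//= big1; last first.
  by move=> k; rewrite -val_eqE /= => kj; rewrite ipZl ip_opoly (negbTE kj) mulr0.
by rewrite ipZl ip_opoly eqxx mulr1 addr0 subrr.
Qed.

Lemma ip_opoly_low n p : (size p <= n)%N -> ip p (P n) = 0.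
Proof.
move=> sp; rewrite (opoly_expand sp) ip_suml big1// => k _.
by rewrite ipZl ip_opoly ltn_eqF ?mulr0.
Qed.

Local Notation a := (jacobi_a s).
Local Notation b := (jacobi_b s).

Lemma size_XP n : size ('X * P n)%R = n.+2.
Proof. by rewrite mulrC size_mulX ?size_opoly// -size_poly_gt0 size_opoly. Qed.

Lemma opoly_rec0 : 'X * P 0 = a 0 *: P 1 + b 0 *: P 0.
Proof.
rewrite {1}(@opoly_expand 2 ('X * P 0)) ?size_XP//.
by rewrite !big_ord_recl big_ord0 addr0 addrC.
Qed.

(** Multiplication by X is symmetric for the form, so X P_(n+1) is orthogonal to P_k for k < n and
    only three terms of its expansion survive. *)
Lemma opoly_rec n : 'X * P n.+1 = a n.+1 *: P n.+2 + b n.+1 *: P n.+1 + a n *: P n.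
Proof.
rewrite {1}(@opoly_expand n.+3 ('X * P n.+1)) ?size_XP//.
rewrite !big_ord_recr /= big1 ?add0r; last first.
  move=> k _; rewrite ip_mulX ipC ip_opoly_low ?scale0r//.
  by rewrite size_XP !ltnS.
have -> : ip ('X * P n.+1) (P n) = a n by rewrite ip_mulX ipC.
by rewrite [RHS]addrC [a n.+1 *: _ + _]addrC addrA.
Qed.

(** Comparing leading coefficients in the recurrence shows that a_n is the quotient of those of P_n
    and P_(n+1), both positive. *)
Lemma jacobi_a_gt0 n : 0 < a n.
Proof.
have E : lead_coef (P n) = a n * lead_coef (P n.+1).
  have C (m : nat) : ('X * P m)`_m.+1 = lead_coef (P m).
    by rewrite coefXM /= lead_coefE size_opoly.
  have D (x y z : R) (p q r : {poly R}) m : size q = m -> (size r <= m)%N ->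
      (x *: p + y *: q + z *: r)`_m = x * p`_m.
    move=> sq sr; rewrite !coefD !coefZ [q`_m]nth_default ?sq// [r`_m]nth_default//.
    by rewrite !mulr0 !addr0.
  rewrite -C [in RHS]lead_coefE size_opoly /=.
  case: n {C} => [|n]; last by rewrite opoly_rec D ?size_opoly.
  have := @D (a 0) (b 0) 0 (P 1) (P 0) 0 1; rewrite scale0r addr0 opoly_rec0 => ->//.
    by rewrite size_opoly.
  by rewrite size_poly0.
by rewrite -(pmulr_lgt0 _ (lead_opoly n.+1)) -E lead_opoly.
Qed.

Lemma opoly0 : P 0 = 1.
Proof.
rewrite opolyE /gs_res big_ord0 subr0 expr0.
have -> : ip 1 1 = 1.
  by rewrite (@ip_widen 1 1 1 1) ?size_poly1// !big_ord1 coef1 s0 !mulr1.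
by rewrite sqrtr1 invr1 scale1r.
Qed.

End OrthogonalPolynomials.

(** * Wronskians and variation of constants for the Jacobi recurrence *)

Section JacobiRecurrence.
Context {R : realType}.
Local Notation C := R[i].
Variables (a b : nat -> R).
Hypothesis a_gt0 : forall n, 0 < a n.
Variables (P Q : C -> nat -> C).

(** Only the rows n >= 1 of the Jacobi matrix are imposed, so that P and Q are both solutions; the
    row n = 0 would exclude Q. *)
Definition solves (z : C) (x : nat -> C) := forall n,
  z * x n.+1 = (a n.+1)%:C * x n.+2 + (b n.+1)%:C * x n.+1 + (a n)%:C * x n.

Hypothesis P0 : forall z, P z 0%N = 1.
Hypothesis P1 : forall z, (a 0%N)%:C * P z 1%N = z - (b 0%N)%:C.
Hypothesis PS : forall z, solves z (P z).
Hypothesis Q0 : forall z, Q z 0%N = 0.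
Hypothesis Q1 : forall z, (a 0%N)%:C * Q z 1%N = 1.
Hypothesis QS : forall z, solves z (Q z).
Implicit Types (x y f : nat -> C) (z w : C).

Lemma aC_neq0 n : (a n)%:C != 0 :> C.
Proof. by rewrite eq_complex /= eqxx andbT gt_eqF. Qed.

(* The discrete Wronskian; it is constant in n when x and y solve the same
   recurrence. *)
Definition brk (n : nat) x y : C := (a n)%:C * (x n.+1 * y n - x n * y n.+1).

Lemma brkS n z w x y : solves z x -> solves w y ->
  brk n.+1 x y = brk n x y + (z - w) * (x n.+1 * y n.+1).
Proof.
move=> sx sy; have := sx n; have := sy n; rewrite /brk => Hy Hx.
have Ex : (a n.+1)%:C * x n.+2 = z * x n.+1 - (b n.+1)%:C * x n.+1 - (a n)%:C * x n.
  by rewrite Hx; ring.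
have Ey : (a n.+1)%:C * y n.+2 = w * y n.+1 - (b n.+1)%:C * y n.+1 - (a n)%:C * y n.
  by rewrite Hy; ring.
rewrite mulrBr !mulrA [(a n.+1)%:C * x n.+1]mulrC -(mulrA (x n.+1)) Ex Ey; ring.
Qed.

Lemma brk_sum n z w x y : solves z x -> solves w y ->
  brk n x y = brk 0 x y + (z - w) * (\sum_(1 <= k < n.+1) x k * y k).
Proof.
move=> sx sy; elim: n => [|n IH]; first by rewrite big_geq// mulr0 addr0.
by rewrite (brkS n sx sy) IH [in RHS]big_nat_recr//= mulrDr addrA.
Qed.

Lemma brk_PQ n z : brk n (P z) (Q z) = -1.
Proof.
rewrite (brk_sum n (@PS z) (@QS z)) subrr mul0r addr0 /brk Q0 P0 mulr0 mul1r sub0r.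
by rewrite mulrN Q1.
Qed.

(** A relation between 2 by 2 minors. It trades the Wronskian of a solution with its conjugate for
    Wronskians with the real reference solutions at 0. *)
Lemma brk_plucker n x y u v :
  brk n x y * brk n u v = brk n x u * brk n y v - brk n x v * brk n y u.
Proof. by rewrite /brk; ring. Qed.

Lemma brk_PP n z w : brk n (P z) (P w) = (z - w) * \sum_(k < n.+1) P z k * P w k.
Proof.
rewrite (brk_sum n (@PS z) (@PS w)) -(big_mkord xpredT (fun k => P z k * P w k)).
rewrite [in RHS]big_nat_recl// -(big_add1 _ _ 0 n.+1 xpredT (fun k => P z k * P w k)) mulrDr.
congr (_ + _); rewrite /brk !P0 mulr1 mul1r mulrBr !P1; ring.
Qed.

Lemma brk_PQ0 n z w : brk n (P z) (Q w) = -1 + (z - w) * \sum_(k < n.+1) P z k * Q w k.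
Proof.
rewrite (brk_sum n (@PS z) (@QS w)) -(big_mkord xpredT (fun k => P z k * Q w k)).
rewrite [in RHS]big_nat_recl// -(big_add1 _ _ 0 n.+1 xpredT (fun k => P z k * Q w k)).
rewrite [X in (z - w) * (X + _)]mulrC Q0 mul0r add0r.
congr (_ + _); rewrite /brk P0 Q0 mulr0 mul1r sub0r mulrN Q1//.
Qed.

Lemma brk_QP n z w : brk n (Q z) (P w) = 1 + (z - w) * \sum_(k < n.+1) Q z k * P w k.
Proof.
have -> : brk n (Q z) (P w) = - brk n (P w) (Q z) by rewrite /brk; ring.
rewrite brk_PQ0 opprD opprK; congr (_ + _).
rewrite -mulNr opprB; congr (_ * _); by apply: eq_bigr => k _; rewrite mulrC.
Qed.

Lemma brk_QQ n z w : brk n (Q z) (Q w) = (z - w) * \sum_(k < n.+1) Q z k * Q w k.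
Proof.
rewrite (brk_sum n (@QS z) (@QS w)) -(big_mkord xpredT (fun k => Q z k * Q w k)).
rewrite [in RHS]big_nat_recl// -(big_add1 _ _ 0 n.+1 xpredT (fun k => Q z k * Q w k)).
by rewrite /brk !Q0 !mulr0 !mul0r subr0 mulr0 !add0r.
Qed.

Definition green z n k := Q z n * P z k - P z n * Q z k.
(* Variation of constants: [green_op z f] solves the recurrence minus z with
   right-hand side f and vanishing initial value. *)
Definition green_op z f n : C := \sum_(k < n) green z n k * f k.

(** The inhomogeneous equation (J - z) x = f in all rows of the Jacobi matrix J, with x 0 = 0. *)
Definition vsolves z f x := [/\ x 0%N = 0, (a 0%N)%:C * x 1%N = f 0%N &
  forall n, (a n.+1)%:C * x n.+2 + (b n.+1)%:C * x n.+1 + (a n)%:C * x n = z * x n.+1 + f n.+1].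

Lemma green_diag z n : green z n n = 0. Proof. by rewrite /green mulrC subrr. Qed.
Lemma green_next z n : (a n)%:C * green z n.+1 n = 1.
Proof.
have := brk_PQ n z; rewrite /brk /green => h; apply: oppr_inj; rewrite -h; ring.
Qed.

Lemma green_op_vsolves z f : vsolves z f (green_op z f).
Proof.
split; first by rewrite /green_op big_ord0.
  by rewrite /green_op big_ord1 mulrA green_next mul1r.
move=> n.
have E1 : green_op z f n.+2 = \sum_(k < n.+1) green z n.+2 k * f k + green z n.+2 n.+1 * f n.+1.
  by rewrite /green_op big_ord_recr.
have E0 : green_op z f n = \sum_(k < n.+1) green z n k * f k.
  by rewrite big_ord_recr /= green_diag mul0r addr0.
rewrite E1 E0 mulrDr mulrA green_next mul1r.
have <- : (a n.+1)%:C * (\sum_(k < n.+1) green z n.+2 k * f k) + (b n.+1)%:C * green_op z f n.+1 +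
   (a n)%:C * (\sum_(k < n.+1) green z n k * f k) = z * green_op z f n.+1.
  rewrite /green_op !mulr_sumr -!big_split; apply: eq_bigr => k _ /=.
  have := @QS z n; have := @PS z n; rewrite /green => HP HQ.
  have -> : z * ((Q z n.+1 * P z k - P z n.+1 * Q z k) * f k) =
    (z * Q z n.+1 * P z k - z * P z n.+1 * Q z k) * f k by ring.
  by rewrite HP HQ; ring.
ring.
Qed.

Lemma vsolves_unique z f x y : vsolves z f x -> vsolves z f y -> x =1 y.
Proof.
move=> [x0 x1 xS] [y0 y1 yS].
suff H n : x n = y n /\ x n.+1 = y n.+1 by move=> n; case: (H n).
elim: n => [|n [IH1 IH2]].
  by split; [rewrite x0 y0|apply: (mulfI (aC_neq0 0)); rewrite x1 y1].
split => //; apply: (mulfI (aC_neq0 n.+1)).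
have := xS n; rewrite IH1 IH2 -yS => h.
by apply: (addIr ((b n.+1)%:C * y n.+1 + (a n)%:C * y n)); rewrite !addrA.
Qed.

(** The difference starts at 0 and satisfies the recurrence at z with right-hand side (w - z) P_w,
    so uniqueness identifies it. All dependence of P on the spectral parameter is studied through
    this formula. *)
Lemma green_op_P z w n : P w n - P z n = (w - z) * green_op z (P w) n.
Proof.
have H : vsolves z (fun k => (w - z) * P w k) (fun n => P w n - P z n).
  split; first by rewrite !P0 subrr.
    by rewrite mulrBr !P1 P0; ring.
  move=> m; have := @PS w m; have := @PS z m => h1 h2.
  have -> : z * (P w m.+1 - P z m.+1) + (w - z) * P w m.+1 = w * P w m.+1 - z * P z m.+1 by ring.
  by rewrite h1 h2; ring.
rewrite (vsolves_unique H (green_op_vsolves z _)) /green_op mulr_sumr; apply: eq_bigr => k _; ring.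
Qed.

Lemma green_op_Q z w n : Q w n - Q z n = (w - z) * green_op z (Q w) n.
Proof.
have H : vsolves z (fun k => (w - z) * Q w k) (fun n => Q w n - Q z n).
  split; first by rewrite !Q0 subrr.
    by rewrite mulrBr !Q1 Q0 mulr0 subrr.
  move=> m; have := @QS w m; have := @QS z m => h1 h2.
  have -> : z * (Q w m.+1 - Q z m.+1) + (w - z) * Q w m.+1 = w * Q w m.+1 - z * Q z m.+1 by ring.
  by rewrite h1 h2; ring.
rewrite (vsolves_unique H (green_op_vsolves z _)) /green_op mulr_sumr; apply: eq_bigr => k _; ring.
Qed.

(** The first resolvent identity. It compares Green operators at two points and so permits a second
    differentiation in z. *)
Lemma green_op_resolvent z w f n : green_op w f n = green_op z (fun k => f k + (w - z) * green_op w f k) n.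
Proof.
suff H : vsolves z (fun k => f k + (w - z) * green_op w f k) (green_op w f).
  exact: (vsolves_unique H (green_op_vsolves z _)).
have [h0 h1 hS] := green_op_vsolves w f; split => //; first by rewrite h1 h0 mulr0 addr0.
by move=> m; rewrite hS; ring.
Qed.

Lemma green_opD z f g n : green_op z (fun k => f k + g k) n = green_op z f n + green_op z g n.
Proof. by rewrite /green_op -big_split; apply: eq_bigr => k _; rewrite mulrDr. Qed.
Lemma green_opZ z (c : C) f n : green_op z (fun k => c * f k) n = c * green_op z f n.
Proof. by rewrite /green_op mulr_sumr; apply: eq_bigr => k _; rewrite mulrCA. Qed.

Definition sq (N : nat) x : R := \sum_(k < N) cmod (x k) ^+ 2.

Lemma sq_ge0 N x : 0 <= sq N x.
Proof. by apply: sumr_ge0 => k _; exact: sqr_ge0. Qed.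
Lemma sqS N x : sq N.+1 x = sq N x + cmod (x N) ^+ 2.
Proof. by rewrite /sq big_ord_recr. Qed.
Lemma sq_mono N M x : (N <= M)%N -> sq N x <= sq M x.
Proof.
move=> /subnK <-; elim: (M - N)%N => //= k IH; apply: le_trans IH _.
by rewrite addSn sqS lerDl sqr_ge0.
Qed.

Lemma cauchy_schwarz N x y : cmod (\sum_(k < N) x k * y k) ^+ 2 <= sq N x * sq N y.
Proof.
have H (u v : nat -> R) : (\sum_(k < N) u k * v k) ^+ 2 <=
    (\sum_(k < N) u k ^+ 2) * (\sum_(k < N) v k ^+ 2).
  elim: N => [|N IH]; first by rewrite !big_ord0 expr0n mul0r.
  rewrite !big_ord_recr /=.
  set A := \sum_(k < N) u k ^+ 2 in IH *; set B := \sum_(k < N) v k ^+ 2 in IH *.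
  set S := \sum_(k < N) u k * v k in IH *.
  have A0 : 0 <= A by apply: sumr_ge0 => k _; exact: sqr_ge0.
  have B0 : 0 <= B by apply: sumr_ge0 => k _; exact: sqr_ge0.
  have h : 2 * S * (u N * v N) <= A * v N ^+ 2 + B * u N ^+ 2.
    (* The cross term is compared through squares, since S^2 <= A B is the induction hypothesis and
       square roots of A and B are thus avoided. *)
    have h1 : (2 * S * (u N * v N)) ^+ 2 <= (A * v N ^+ 2 + B * u N ^+ 2) ^+ 2.
      rewrite (_ : (2 * S * (u N * v N)) ^+ 2 = 4 * (u N ^+ 2 * v N ^+ 2) * S ^+ 2); last by ring.
      apply: (@le_trans _ _ (4 * (u N ^+ 2 * v N ^+ 2) * (A * B))).
        by rewrite ler_wpM2l// mulr_ge0// mulr_ge0// sqr_ge0.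
      by have := sqr_ge0 (A * v N ^+ 2 - B * u N ^+ 2); nra.
    have Y0 : 0 <= A * v N ^+ 2 + B * u N ^+ 2 by rewrite addr_ge0// mulr_ge0// sqr_ge0.
    have [//|YX] := leP (2 * S * (u N * v N)) (A * v N ^+ 2 + B * u N ^+ 2).
    by move: h1; rewrite leNgt ltr_pXn2r ?nnegrE ?YX// (le_trans Y0)// ltW.
  by lra.
have h1 : cmod (\sum_(k < N) x k * y k) <= \sum_(k < N) cmod (x k) * cmod (y k).
  by apply: le_trans (cmod_sum _ _ _) _; apply: ler_sum => k _; rewrite cmodM.
apply: le_trans (H (fun k => cmod (x k)) (fun k => cmod (y k))).
rewrite ler_pXn2r ?nnegrE ?cmod_ge0//; apply: sumr_ge0 => k _; by rewrite mulr_ge0 ?cmod_ge0.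
Qed.

Definition bnd x (M : R) := forall N, sq N x <= M.

Lemma bnd_ge0 x M : bnd x M -> 0 <= M.
Proof. by move=> /(_ 0%N); rewrite /sq big_ord0. Qed.

Lemma green_op_point z f n (A : R) : bnd (P z) A -> bnd (Q z) A ->
  cmod (green_op z f n) ^+ 2 <= 2 * (cmod (P z n) ^+ 2 + cmod (Q z n) ^+ 2) * (A * sq n f).
Proof.
move=> bP bQ.
have -> : green_op z f n = Q z n * (\sum_(k < n) P z k * f k) + - P z n * (\sum_(k < n) Q z k * f k).
  rewrite !mulr_sumr -big_split; apply: eq_bigr => k _; rewrite /green /=; ring.
apply: le_trans (cmodD_sq _ _) _; rewrite -mulrA ler_wpM2l// !cmodM cmodN !exprMn.
rewrite addrC mulrDl; apply: lerD; rewrite ler_wpM2l ?sqr_ge0//.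
- by apply: le_trans (cauchy_schwarz _ _ _) _; rewrite ler_wpM2r// sq_ge0.
- by apply: le_trans (cauchy_schwarz _ _ _) _; rewrite ler_wpM2r// sq_ge0.
Qed.

(** A Hilbert-Schmidt bound: the kernel is built from the two square-summable sequences P and Q. *)
Lemma green_op_bnd z f (A F : R) : bnd (P z) A -> bnd (Q z) A -> bnd f F ->
  bnd (green_op z f) (4 * A ^+ 2 * F).
Proof.
move=> bP bQ bF N; have A0 := bnd_ge0 bP; have F0 := bnd_ge0 bF.
apply: (@le_trans _ _ (\sum_(k < N) 2 * (cmod (P z k) ^+ 2 + cmod (Q z k) ^+ 2) * (A * F))).
  apply: ler_sum => k _; apply: le_trans (green_op_point _ _ bP bQ) _.
  by rewrite ler_wpM2l ?mulr_ge0 ?addr_ge0 ?sqr_ge0// ler_wpM2l.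
rewrite -mulr_suml -mulr_sumr big_split /= -/(sq N (P z)) -/(sq N (Q z)).
rewrite (_ : 4 * A ^+ 2 * F = 2 * (A + A) * (A * F)); last by ring.
by rewrite ler_wpM2r ?mulr_ge0// ler_wpM2l// lerD.
Qed.

(** A discrete Gronwall inequality: 1 + [sq] n x grows at step n by a factor at most 1 + K al_n, and
    the al_n sum to at most 2 A. It carries square-summability from one point z0 to all z, uniformly
    on discs. *)
Lemma gronwall z0 x y (t : C) (A r : R) : bnd (P z0) A -> bnd (Q z0) A ->
  (forall n, x n = y n + t * green_op z0 x n) ->
  (forall n, cmod (y n) ^+ 2 <= cmod (P z0 n) ^+ 2 + cmod (Q z0 n) ^+ 2) ->
  cmod t <= r ->
  bnd x (expR ((2 + 4 * r ^+ 2 * A) * (2 * A))).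
Proof.
move=> bP bQ xE yle tr; have A0 := bnd_ge0 bP.
pose al n := cmod (P z0 n) ^+ 2 + cmod (Q z0 n) ^+ 2.
have al0 n : 0 <= al n by rewrite addr_ge0// sqr_ge0.
(* Splitting the square of a sum costs a factor 2; the term with the Green operator carries another
   2 r^2 A. *)
pose K := 2 + 4 * r ^+ 2 * A.
have K0 : 0 <= K by rewrite addr_ge0// mulr_ge0// mulr_ge0// sqr_ge0.
have step n : cmod (x n) ^+ 2 <= K * al n * (1 + sq n x).
  rewrite xE; apply: le_trans (cmodD_sq _ _) _.
  have h1 : cmod (t * green_op z0 x n) ^+ 2 <= r ^+ 2 * (2 * al n * (A * sq n x)).
    rewrite cmodM exprMn; apply: ler_pM; rewrite ?sqr_ge0//.
      by rewrite ler_pXn2r ?nnegrE ?cmod_ge0// (le_trans _ tr).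
    exact: green_op_point.
  have := yle n; rewrite -/(al n) => h2.
  have s0 := sq_ge0 n x.
  apply: (@le_trans _ _ (2 * (al n + r ^+ 2 * (2 * al n * (A * sq n x))))).
    by rewrite ler_wpM2l// lerD.
  rewrite /K.
  have : 0 <= 2 * al n * sq n x by rewrite !mulr_ge0.
  have : 0 <= 4 * r ^+ 2 * A * al n.
    by do 2 (apply: mulr_ge0 => //); apply: mulr_ge0 => //; exact: sqr_ge0.
  lra.
have prodb N : 1 + sq N x <= expR (K * \sum_(k < N) al k).
  elim: N => [|N IH]; first by rewrite /sq !big_ord0 mulr0 expR0 addr0.
  rewrite sqS big_ord_recr /= mulrDr expRD.
  apply: (@le_trans _ _ ((1 + sq N x) * (1 + K * al N))).
    by have := step N; lra.
  apply: ler_pM; rewrite ?addr_ge0 ?sq_ge0 ?mulr_ge0//.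
  exact: expR_ge1Dx.
move=> N; apply: (@le_trans _ _ (1 + sq N x)); first by rewrite lerDr.
apply: le_trans (prodb N) _; rewrite ler_expR -/K ler_wpM2l//.
by rewrite big_split /= mulr_natl mulr2n; apply: lerD; [exact: bP|exact: bQ].
Qed.

End JacobiRecurrence.

(** * Square-summable sequences *)

Section SquareSummable.
Context {R : realType}.
Local Notation C := R[i].
Implicit Types (x y u v : nat -> C) (l m : C).

Definition ccvg u l := forall e : R, 0 < e -> exists N, forall n, (N <= n)%N -> cmod (u n - l) < e.
Definition psum u (n : nat) : C := \sum_(k < n) u k.

Lemma ccvgP u l : ccvg u l <-> ((u : nat -> R[i]^o) @ \oo --> (l : R[i]^o)).
Proof.
split.
  move=> H; apply/cvgrPdist_lt => e e0; have [a0 b0] : 0 < Re e /\ Im e = 0.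
    by move: e0; rewrite ltcE /= => /andP[/eqP -> ->].
  have [N HN] := H _ a0; exists N => // n /= Nn.
  by rewrite normcR cmodC ltcE /= b0 eqxx HN.
move=> H e e0; have e0' : 0 < e%:C :> C by rewrite ltcR.
move/cvgrPdist_lt : H => /(_ _ e0')[N _ HN]; exists N => n Nn.
by have := HN n Nn; rewrite normcR ltcR cmodC.
Qed.

Lemma ccvg_unique u l m : ccvg u l -> ccvg u m -> l = m.
Proof.
move=> Hl Hm; apply/eqP; rewrite -subr_eq0 -cmod_eq0; apply/negPn/negP => n0.
have p0 : 0 < cmod (l - m) / 2 by rewrite divr_gt0// lt_neqAle eq_sym n0 cmod_ge0.
have [N1 H1] := Hl _ p0; have [N2 H2] := Hm _ p0.
have := H1 (maxn N1 N2) (leq_maxl _ _); have := H2 (maxn N1 N2) (leq_maxr _ _).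
have := cmodB (u (maxn N1 N2) - m) (u (maxn N1 N2) - l).
rewrite (_ : _ - _ - (_ - _) = l - m); [lra|ring].
Qed.

Lemma csumE u l : ccvg (psum u) l -> csum u = l.
Proof.
move=> /ccvgP H; rewrite /csum.
have -> : series (u : nat -> R[i]^o) = psum u.
  by apply/funext => n; rewrite /series /= /psum big_mkord.
exact: (cvg_lim (@norm_hausdorff _ R[i]^o) H).
Qed.

Lemma ccvgD u v l m : ccvg u l -> ccvg v m -> ccvg (fun n => u n + v n) (l + m).
Proof.
move=> Hu Hv e e0; have e20 : 0 < e / 2 by rewrite divr_gt0.
have [M HM] := Hu _ e20; have [N HN] := Hv _ e20; exists (maxn M N) => n.
rewrite geq_max => /andP[/HM h1 /HN h2]; rewrite opprD addrACA [e]splitr.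
by apply: le_lt_trans (cmodD _ _) _; exact: ltrD.
Qed.
Lemma ccvgZ c u l : ccvg u l -> ccvg (fun n => c * u n) (c * l).
Proof.
move=> H e e0; have c0 : 0 < cmod c + 1 by rewrite ltr_wpDl ?cmod_ge0.
have [N HN] := H _ (divr_gt0 e0 c0); exists N => n /HN.
rewrite ltr_pdivlMr// -mulrBr cmodM => h; apply: le_lt_trans h.
by rewrite mulrC ler_wpM2l ?cmod_ge0// lerDl.
Qed.
Lemma ccvg_cst c : ccvg (fun=> c) c.
Proof. by move=> e e0; exists 0%N => n _; rewrite subrr cmod0. Qed.
Lemma ccvg_shift u l : ccvg u l -> ccvg (fun n => u n.+1) l.
Proof. by move=> H e /H[N HN]; exists N => n Nn; apply: HN; exact: leqW. Qed.

Lemma ccvg_cmod u l : ccvg u l -> (fun n => cmod (u n)) @ \oo --> cmod l.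
Proof.
move=> H; apply/cvgrPdist_lt => e /H[N HN]; exists N => // n /= /HN.
apply: le_lt_trans; rewrite ler_norml cmodC.
have := cmod_triB l (u n); have := cmod_triB (u n) l; rewrite [cmod (u n - l)]cmodC; lra.
Qed.

Lemma ccvg_le u l M : ccvg u l -> (forall n, cmod (u n) <= M) -> cmod l <= M.
Proof.
move=> /ccvg_cmod H uM; apply: (@cvgr_to_le _ _ _ _ _ _ _ H).
exact: nearW.
Qed.

Lemma abs_ccvg u (M : R) : (forall n, \sum_(k < n) cmod (u k) <= M) ->
  exists l, ccvg (psum u) l.
Proof.
move=> H.
have cvR (f : nat -> R) : (forall k, `|f k| <= cmod (u k)) -> cvgn (series f).
  move=> fu; apply: normed_cvg; apply: nondecreasing_is_cvgn.
    by apply: nondecreasing_series => n _ _; exact: normr_ge0.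
  exists M => _ [n _ <-]; rewrite /normed_series_of seriesEord; apply: le_trans (H n).
  by apply: ler_sum => k _; exact: fu.
have /cvg_ex[lr Hr] := cvR (fun k => Re (u k)) (fun k => Re_le_cmod (u k)).
have /cvg_ex[li Hi] := cvR (fun k => Im (u k)) (fun k => Im_le_cmod (u k)).
exists (lr +i* li) => e e0; have e20 : 0 < e / 2 by rewrite divr_gt0.
move/cvgrPdist_lt : Hr => /(_ _ e20)[N1 _ H1].
move/cvgrPdist_lt : Hi => /(_ _ e20)[N2 _ H2].
exists (maxn N1 N2) => n; rewrite geq_max => /andP[/H1 h1 /H2 h2].
apply: le_lt_trans (cmod_le_ReIm _) _; rewrite !cE /= -/(psum u n).
move: h1 h2; rewrite /series /= !big_mkord distrC => h1; rewrite distrC => h2.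
by rewrite /psum cRe_sum cIm_sum; lra.
Qed.

Lemma l2_series x : series (fun n => cmod (x n) ^+ 2) = (fun n => sq n x).
Proof. by apply/funext => n; rewrite /series /= big_mkord. Qed.

Lemma sq_ndecr x : {homo (fun n => sq n x) : n m / (n <= m)%N >-> n <= m}.
Proof. by move=> n m; exact: sq_mono. Qed.

Lemma bnd_l2 x M : bnd x M -> is_l2 x /\ l2norm x ^+ 2 <= M.
Proof.
move=> bx; have cv : cvgn (fun n => sq n x).
  apply: nondecreasing_is_cvgn; first exact: sq_ndecr.
  by exists M => _ [n _ <-]; exact: bx.
split; first by rewrite /is_l2 l2_series.
rewrite /l2norm l2_series sqr_sqrtr.
  by apply: limr_le => //; exact: nearW.
by apply: limr_ge => //; apply: nearW => n; exact: sq_ge0.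
Qed.

Lemma l2_bnd x : is_l2 x -> bnd x (l2norm x ^+ 2).
Proof.
rewrite /is_l2 /l2norm l2_series => cv N; rewrite sqr_sqrtr.
  by apply: nondecreasing_cvgn_le => //; exact: sq_ndecr.
by apply: limr_ge => //; apply: nearW => n; exact: sq_ge0.
Qed.

Lemma l2norm_ge0 x : 0 <= l2norm x. Proof. exact: sqrtr_ge0. Qed.

Lemma l2norm_le x M : 0 <= M -> bnd x (M ^+ 2) -> l2norm x <= M.
Proof.
by move=> M0 /bnd_l2[_]; rewrite ler_pXn2r ?nnegrE ?l2norm_ge0.
Qed.

Lemma cmod_le_l2norm x n : is_l2 x -> cmod (x n) <= l2norm x.
Proof.
move=> /l2_bnd/(_ n.+1); rewrite sqS => h.
rewrite -(@ler_pXn2r _ 2) ?nnegrE ?cmod_ge0 ?l2norm_ge0//; apply: le_trans h.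
by rewrite lerDr sq_ge0.
Qed.

Lemma sqZ N c x : sq N (fun k => c * x k) = cmod c ^+ 2 * sq N x.
Proof. by rewrite /sq mulr_sumr; apply: eq_bigr => k _; rewrite cmodM exprMn. Qed.

Lemma bndZ c x M : bnd x M -> bnd (fun k => c * x k) (cmod c ^+ 2 * M).
Proof. by move=> bx N; rewrite sqZ ler_wpM2l ?sqr_ge0. Qed.

Lemma sqD_le N x y : sq N (fun k => x k + y k) <= 2 * (sq N x + sq N y).
Proof.
rewrite /sq -big_split mulr_sumr; apply: ler_sum => k _; exact: cmodD_sq.
Qed.

Lemma bndD x y M N : bnd x M -> bnd y N -> bnd (fun k => x k + y k) (2 * (M + N)).
Proof. by move=> bx bY n; apply: le_trans (sqD_le _ _ _) _; rewrite ler_wpM2l// lerD. Qed.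

Lemma bnd_le x M N : M <= N -> bnd x M -> bnd x N.
Proof. by move=> MN bx n; exact: le_trans (bx n) MN. Qed.

Lemma l2D x y : is_l2 x -> is_l2 y -> is_l2 (fun k => x k + y k).
Proof. by move=> /l2_bnd hx /l2_bnd hy; have [] := bnd_l2 (bndD hx hy). Qed.
Lemma l2Z c x : is_l2 x -> is_l2 (fun k => c * x k).
Proof. by move=> /l2_bnd hx; have [] := bnd_l2 (bndZ c hx). Qed.
Lemma l2B x y : is_l2 x -> is_l2 y -> is_l2 (fun k => x k - y k).
Proof.
move=> hx hy; have := l2D hx (l2Z (c := -1) hy).
by under eq_fun do rewrite mulN1r.
Qed.

Lemma l2normZ c x : is_l2 x -> l2norm (fun k => c * x k) = cmod c * l2norm x.
Proof.
move=> lx; apply/eqP; rewrite eq_le; apply/andP; split.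
  apply: l2norm_le; first by rewrite mulr_ge0 ?cmod_ge0 ?l2norm_ge0.
  by rewrite exprMn; apply: bndZ; exact: l2_bnd.
have [->|c0] := eqVneq c 0; first by rewrite cmod0 mul0r l2norm_ge0.
have cp : 0 < cmod c by rewrite cmod_gt0.
rewrite -ler_pdivlMl//; apply: l2norm_le.
  by rewrite mulr_ge0 ?invr_ge0 ?cmod_ge0 ?l2norm_ge0.
move=> N; rewrite exprMn -(ler_pdivrMl _ _ (exprn_gt0 2 _)) ?invr_gt0//.
rewrite exprVn invrK -sqZ; apply: l2_bnd; exact: l2Z.
Qed.

Lemma sqJ N x : sq N (fun k => (x k)^*%C) = sq N x.
Proof. by apply: eq_bigr => k _; rewrite cmodJ. Qed.

Lemma prod_ccvg x y A B : bnd x A -> bnd y B ->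
  ccvg (psum (fun k => x k * y k)) (csum (fun k => x k * y k)).
Proof.
move=> bx bY.
have [l Hl] : exists l, ccvg (psum (fun k => x k * y k)) l.
  apply: (@abs_ccvg _ (A + B)) => n.
  apply: (@le_trans _ _ (sq n x + sq n y)); last exact: lerD.
  rewrite /sq -big_split; apply: ler_sum => k _ /=; rewrite cmodM.
  have := sqr_ge0 (cmod (x k) - cmod (y k)); have := sqr_ge0 (cmod (x k)).
  have := sqr_ge0 (cmod (y k)); nra.
by rewrite (csumE Hl).
Qed.

Lemma csum_prod_le x y A B : 0 <= A -> 0 <= B -> bnd x (A ^+ 2) -> bnd y (B ^+ 2) ->
  cmod (csum (fun k => x k * y k)) <= A * B.
Proof.
move=> A0 B0 bx bY; apply: (ccvg_le (prod_ccvg bx bY)) => n.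
rewrite -(@ler_pXn2r _ 2) ?nnegrE ?cmod_ge0 ?mulr_ge0//.
apply: le_trans (cauchy_schwarz _ _ _) _; rewrite exprMn.
by apply: ler_pM => //; exact: sq_ge0.
Qed.

Lemma bndJ x M : bnd x M -> bnd (fun k => (x k)^*%C) M.
Proof. by move=> h N; rewrite sqJ. Qed.

Lemma l2ip_ccvg x y : is_l2 x -> is_l2 y ->
  ccvg (psum (fun k => x k * (y k)^*%C)) (l2ip x y).
Proof. by move=> /l2_bnd hx /l2_bnd/bndJ hy; exact: prod_ccvg hx hy. Qed.

Lemma l2ip_le x y : is_l2 x -> is_l2 y -> cmod (l2ip x y) <= l2norm x * l2norm y.
Proof.
move=> /l2_bnd hx /l2_bnd/bndJ hy.
by apply: csum_prod_le => //; exact: l2norm_ge0.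
Qed.

Lemma csumD u v l m : ccvg (psum u) l -> ccvg (psum v) m ->
  csum (fun k => u k + v k) = l + m.
Proof.
move=> Hu Hv; apply: csumE; have H := ccvgD Hu Hv.
by rewrite (_ : psum _ = fun n => psum u n + psum v n)//; apply/funext => n; rewrite /psum big_split.
Qed.

Lemma csumZ c u l : ccvg (psum u) l -> csum (fun k => c * u k) = c * l.
Proof.
move=> Hu; apply: csumE; have H := @ccvgZ c _ _ Hu.
by rewrite (_ : psum _ = fun n => c * psum u n)//; apply/funext => n; rewrite /psum mulr_sumr.
Qed.

Lemma csum_finite u n : (forall k, (n <= k)%N -> u k = 0) -> csum u = psum u n.
Proof.
move=> H; apply: csumE => e e0; exists n => m nm.
rewrite (_ : psum u m = psum u n) ?subrr ?cmod0//.
rewrite /psum -!(big_mkord xpredT u) (big_cat_nat (leq0n n) nm) /= [X in _ + X]big_nat_cond.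
by rewrite [X in _ + X]big1 ?addr0// => k /andP[/andP[h _] _]; exact: H.
Qed.

End SquareSummable.

(** * Weyl circle estimates at finite index *)

Section MomentSequences.
Context {R : realType}.
Local Notation C := R[i].
Variable s : nat -> R.
Hypothesis s0 : s 0%N = 1.
Hypothesis s_pd : positive_definite_seq s.
Local Notation a := (jacobi_a s).
Local Notation b := (jacobi_b s).
Implicit Types (z w : C) (n : nat).

Definition Pz z n : C := ceval (opoly s n) z.
Definition Qz z n : C := ceval (opoly2 s n) z.

Lemma cevalD p q z : ceval (p + q) z = ceval p z + ceval q z :> C.
Proof. by rewrite /ceval rmorphD hornerD. Qed.
Lemma cevalN p z : ceval (- p) z = - ceval p z :> C.
Proof. by rewrite /ceval rmorphN hornerN. Qed.
Lemma cevalZ (k : R) p z : ceval (k *: p) z = k%:C * ceval p z :> C.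
Proof. by rewrite /ceval map_polyZ hornerZ. Qed.
Lemma cevalX p z : ceval ('X * p) z = z * ceval p z :> C.
Proof. by rewrite /ceval rmorphM /= map_polyX hornerM hornerX. Qed.
Lemma cevalC (k : R) z : ceval k%:P z = k%:C :> C.
Proof. by rewrite /ceval map_polyC hornerC. Qed.

Lemma cevalJ (p : {poly R}) z : ceval p z^*%C = (ceval p z)^*%C :> C.
Proof.
rewrite /ceval -horner_map /=; congr (_.[_]).
by apply/polyP => i; rewrite [RHS]coef_map /= !coef_map /=; apply: ceqP => /=; rewrite ?cE ?oppr0.
Qed.

Lemma PzJ z n : Pz z^*%C n = (Pz z n)^*%C. Proof. exact: cevalJ. Qed.
Lemma QzJ z n : Qz z^*%C n = (Qz z n)^*%C. Proof. exact: cevalJ. Qed.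

Lemma a_gt0 n : 0 < a n. Proof. exact: jacobi_a_gt0. Qed.

Lemma Pz0 z : Pz z 0%N = 1.
Proof. by rewrite /Pz opoly0// -[1]/(1%:P) cevalC. Qed.
Lemma Pz1 z : (a 0%N)%:C * Pz z 1%N = z - (b 0%N)%:C.
Proof.
have : ceval ('X * opoly s 0) z = ceval (a 0%N *: opoly s 1 + b 0%N *: opoly s 0) z.
  by rewrite (opoly_rec0 s_pd).
rewrite cevalX cevalD (cevalZ (a 0)) (cevalZ (b 0)) -[ceval (opoly s 0) z]/(Pz z 0%N) Pz0 !mulr1 => h.
by apply/eqP; rewrite eq_sym subr_eq; apply/eqP.
Qed.
Lemma PzS z : solves a b z (Pz z).
Proof.
move=> n; rewrite /Pz -cevalX (opoly_rec s_pd n).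
by rewrite !cevalD (cevalZ (a n.+1)) (cevalZ (b n.+1)) (cevalZ (a n)).
Qed.
Lemma Qz0 z : Qz z 0%N = 0.
Proof. by rewrite /Qz -[opoly2 s 0]/(0%:P) cevalC. Qed.
Lemma Qz1 z : (a 0%N)%:C * Qz z 1%N = 1.
Proof.
rewrite /Qz -[opoly2 s 1]/((a 0%N)^-1%:P) cevalC -rmorphM divff// gt_eqF//.
exact: a_gt0.
Qed.
Lemma QzS z : solves a b z (Qz z).
Proof.
move=> n; rewrite /Qz.
have -> : opoly2 s n.+2 = (a n.+1)^-1 *: ('X * opoly2 s n.+1 - b n.+1 *: opoly2 s n.+1
         - a n *: opoly2 s n) by [].
rewrite cevalZ !cevalD !cevalN !cevalZ cevalX mulrA -rmorphM divff ?gt_eqF ?a_gt0//.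
by rewrite mul1r; ring.
Qed.

Local Notation wr := (brk a).

Lemma subJ z : z - z^*%C = (2 * Im z)%:C * 'i%C.
Proof. by apply: ceqP; rewrite !cE /=; ring. Qed.

Lemma cmod_subJ z : cmod (z - z^*%C) = 2 * `|Im z|.
Proof. by rewrite subJ cmodM cmod_rc cmod_i mulr1 normrM ger0_norm. Qed.

Lemma sum_mulJ N (x : nat -> C) : \sum_(k < N) x k * (x k)^*%C = (sq N x)%:C.
Proof. by rewrite /sq rmorph_sum; apply: eq_bigr => k _; rewrite mulcJ. Qed.

Lemma brkJ n (x y : nat -> C) :
  wr n (fun k => (x k)^*%C) (fun k => (y k)^*%C) = (wr n x y)^*%C.
Proof. by rewrite /brk !cconjM cconjB !cconjM cconjR. Qed.

Lemma PJE z : Pz z^*%C = (fun k => (Pz z k)^*%C).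
Proof. by apply/funext => k; rewrite PzJ. Qed.
Lemma QJE z : Qz z^*%C = (fun k => (Qz z k)^*%C).
Proof. by apply/funext => k; rewrite QzJ. Qed.

Lemma P0J : (fun k => (Pz 0 k)^*%C) = Pz 0. Proof. by rewrite -PJE conjc0. Qed.
Lemma Q0J : (fun k => (Qz 0 k)^*%C) = Qz 0. Proof. by rewrite -QJE conjc0. Qed.

Lemma sum_PPJ n z : wr n (Pz z) (Pz z^*%C) = (z - z^*%C) * (sq n.+1 (Pz z))%:C.
Proof.
rewrite (brk_PP Pz0 Pz1 PzS) -sum_mulJ; congr (_ * _).
by apply: eq_bigr => k _; rewrite PzJ.
Qed.

(** The relation [brk_plucker] for P_z, its conjugate, P_0 and Q_0. The left side is, up to sign, 2
    i Im z times the partial sum; as P_0 and Q_0 are real, the two products on the right are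
    conjugate, so the factor 2 cancels. *)
Lemma weyl_P n z : `|Im z| * sq n.+1 (Pz z) <=
  cmod (wr n (Pz z) (Qz 0)) * cmod (wr n (Pz z) (Pz 0)).
Proof.
have := @brk_plucker _ a n (Pz z) (Pz z^*%C) (Pz 0) (Qz 0).
rewrite (brk_PQ Pz0 PzS Qz0 Qz1 QzS) sum_PPJ => h.
have : cmod ((z - z^*%C) * (sq n.+1 (Pz z))%:C) <=
    2 * (cmod (wr n (Pz z) (Qz 0)) * cmod (wr n (Pz z) (Pz 0))).
  have e1 : wr n (Pz z^*%C) (Qz 0) = (wr n (Pz z) (Qz 0))^*%C by rewrite PJE -{1}Q0J brkJ.
  have e2 : wr n (Pz z^*%C) (Pz 0) = (wr n (Pz z) (Pz 0))^*%C by rewrite PJE -{1}P0J brkJ.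
  rewrite -cmodN -mulrN1 h e1 e2; apply: le_trans (cmodB _ _) _.
  by rewrite (cmodM (wr n (Pz z) (Pz 0))) (cmodM (wr n (Pz z) (Qz 0))) !cmodJ; lra.
rewrite cmodM cmod_subJ cmod_rc (ger0_norm (sq_ge0 _ _)); lra.
Qed.

(** The signs make both coefficients visible: -al is the initial value, and be is the defect of the
    combination in row 0 of J - z. *)
Definition comb (al be : C) z n := be * Qz z n - al * Pz z n.

Lemma comb_solves al be z : solves a b z (comb al be z).
Proof.
move=> n; have := QzS z n; have := PzS z n => h1 h2; rewrite /comb.
have -> : z * (be * Qz z n.+1 - al * Pz z n.+1) = be * (z * Qz z n.+1) - al * (z * Pz z n.+1) by ring.
by rewrite h1 h2; ring.
Qed.

Lemma solvesJ z (x : nat -> C) : solves a b z x -> solves a b z^*%C (fun k => (x k)^*%C).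
Proof.
by move=> sx n; rewrite -cconjM sx !cconjD !cconjM !cconjR.
Qed.

Lemma comb0 al be z : comb al be z 0%N = - al.
Proof. by rewrite /comb Qz0 Pz0 mulr0 sub0r mulr1. Qed.
Lemma comb1 al be z : (a 0%N)%:C * comb al be z 1%N = be - al * (z - (b 0%N)%:C).
Proof. by rewrite /comb mulrBr !(mulrCA (a 0%N)%:C) Qz1 Pz1 mulr1. Qed.

(** The hypothesis places al / be on the n-th Weyl circle. In Lagrange's identity only the boundary
    term at 0 is left, and it equals 2 i times the imaginary part of be times the conjugate of
    al. *)
Lemma weyl_comb n z al be :
  wr n (comb al be z) (fun k => (comb al be z k)^*%C) = 0 ->
  `|Im z| * sq n.+1 (comb al be z) <= cmod al * cmod be.
Proof.
set x := comb al be z => h0.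
have := brk_sum n (comb_solves al be z) (solvesJ (comb_solves al be z)).
rewrite -/x h0 => /esym h1.
have E : (z - z^*%C) * (sq n.+1 x)%:C = be * al^*%C - al * be^*%C.
  rewrite -sum_mulJ -(big_mkord xpredT (fun k => x k * (x k)^*%C)) big_nat_recl//.
  rewrite -(big_add1 _ _ 0 n.+1 xpredT (fun k => x k * (x k)^*%C)) mulrDr.
  have -> : (z - z^*%C) * (\sum_(1 <= k < n.+1) x k * (x k)^*%C) =
            - wr 0 x (fun k => (x k)^*%C).
    by apply/eqP; rewrite -subr_eq0 opprK addrC h1.
  have -> : wr 0 x (fun k => (x k)^*%C) =
      (a 0%N)%:C * x 1%N * (x 0%N)^*%C - x 0%N * ((a 0%N)%:C * x 1%N)^*%C.
    by rewrite /brk cconjM cconjR; ring.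
  by rewrite /x comb1 comb0 !(cconjN, cconjB, cconjM) cconjR; ring.
have : cmod ((z - z^*%C) * (sq n.+1 x)%:C) <= 2 * (cmod al * cmod be).
  rewrite E; apply: le_trans (cmodB _ _) _.
  rewrite !cmodM !cmodJ; lra.
rewrite cmodM cmod_subJ cmod_rc (ger0_norm (sq_ge0 _ _)); lra.
Qed.

Lemma sq_ge_first n (x : nat -> C) : cmod (x 0%N) ^+ 2 <= sq n.+1 x.
Proof. by apply: le_trans (sq_mono x (ltn0Sn n)); rewrite sqS lerDr sq_ge0. Qed.

Lemma sq_ge_two n (x : nat -> C) : cmod (x 0%N) ^+ 2 + cmod (x 1%N) ^+ 2 <= sq n.+2 x.
Proof.
by apply: le_trans (@sq_mono _ 2 n.+2 x _) => //; rewrite !sqS /sq big_ord0 add0r.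
Qed.

Lemma sq_Pz_ge1 n z : 1 <= sq n.+1 (Pz z).
Proof. by apply: le_trans (sq_ge_first _ _); rewrite Pz0 cmod1 expr1n. Qed.

(** The entry 0 alone contributes |al|^2 to the sum bounded by [weyl_comb]. *)
Lemma comb_le n z al be :
  wr n (comb al be z) (fun k => (comb al be z k)^*%C) = 0 ->
  `|Im z| * cmod al <= cmod be.
Proof.
move=> /weyl_comb h; have [->|al0] := eqVneq al 0; first by rewrite cmod0 mulr0 cmod_ge0.
have ap : 0 < cmod al by rewrite cmod_gt0.
rewrite -(ler_pM2l ap) mulrCA; apply: le_trans h; rewrite -expr2 ler_wpM2l//.
by apply: le_trans (sq_ge_first _ _); rewrite comb0 cmodN.
Qed.

(** The number be is a linear combination of the entries 0 and 1, so Cauchy-Schwarz bounds it by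
    their share of the sum; the index [n.+1] ensures that both entries are summed. *)
Lemma comb_ge n z al be :
  wr n.+1 (comb al be z) (fun k => (comb al be z k)^*%C) = 0 ->
  `|Im z| * cmod be <= (a 0%N ^+ 2 + cmod (z - (b 0%N)%:C) ^+ 2) * cmod al.
Proof.
move=> /weyl_comb h; have [->|be0] := eqVneq be 0.
  by rewrite cmod0 mulr0 mulr_ge0 ?cmod_ge0// addr_ge0// sqr_ge0.
have bp : 0 < cmod be by rewrite cmod_gt0.
set D := cmod (z - (b 0%N)%:C).
have a00 := a_gt0 0.
have hb : cmod be <= a 0%N * cmod (comb al be z 1%N) + cmod al * D.
  have E : be = (a 0%N)%:C * comb al be z 1%N + al * (z - (b 0%N)%:C) by rewrite comb1 subrK.
  rewrite {1}E; apply: le_trans (cmodD _ _) _.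
  by rewrite (cmodM _ (comb _ _ _ _)) (cmodM al) cmod_rc (ger0_norm (ltW a00)).
have h2 : cmod be ^+ 2 <= (a 0%N ^+ 2 + D ^+ 2) * (cmod al ^+ 2 + cmod (comb al be z 1%N) ^+ 2).
  apply: (@le_trans _ _ ((a 0%N * cmod (comb al be z 1%N) + cmod al * D) ^+ 2)).
    by rewrite ler_pXn2r ?nnegrE ?cmod_ge0// addr_ge0// mulr_ge0 ?cmod_ge0// ltW.
  have := sqr_ge0 (a 0%N * cmod al - D * cmod (comb al be z 1%N)); nra.
have h3 := sq_ge_two n (comb al be z); rewrite comb0 cmodN in h3.
have K0 : 0 <= a 0%N ^+ 2 + D ^+ 2 by rewrite addr_ge0// sqr_ge0.
rewrite -(ler_pM2l bp) mulrCA -expr2.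
apply: (@le_trans _ _ (`|Im z| * ((a 0%N ^+ 2 + D ^+ 2) * sq n.+2 (comb al be z)))).
  by rewrite ler_wpM2l//; apply: le_trans h2 _; rewrite ler_wpM2l.
rewrite mulrCA [X in _ <= X]mulrCA [cmod be * _]mulrC; exact: ler_wpM2l.
Qed.

Lemma brk_combl n al be z (u : nat -> C) :
  wr n (comb al be z) u = be * wr n (Qz z) u - al * wr n (Pz z) u.
Proof. by rewrite /brk /comb; ring. Qed.

(** The coefficients make x have zero Wronskian with u, and so does its conjugate because u is real;
    [brk_plucker] with v independent of u then kills the Wronskian of x with its conjugate. For u =
    Q_0 the coefficients tend to the entries a and b, for u = P_0 to c and d. *)
Lemma comb_null n z (u v : nat -> C) :
  (fun k => (u k)^*%C) = u -> wr n u v != 0 ->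
  let x := comb (wr n (Qz z) u) (wr n (Pz z) u) z in
  wr n x (fun k => (x k)^*%C) = 0.
Proof.
move=> uJ uv x.
have xu : wr n x u = 0 by rewrite /x brk_combl mulrC subrr.
have xu' : wr n (fun k => (x k)^*%C) u = 0 by rewrite -{1}uJ brkJ xu conjc0.
have := @brk_plucker _ a n x (fun k => (x k)^*%C) u v.
by rewrite xu xu' mul0r mulr0 subrr => /eqP; rewrite mulf_eq0 (negbTE uv) orbF => /eqP.
Qed.

Lemma brk_PQ00 n : wr n (Pz 0) (Qz 0) != 0.
Proof. by rewrite (brk_PQ Pz0 PzS Qz0 Qz1 QzS) oppr_eq0 oner_eq0. Qed.

Lemma brk_QP00 n : wr n (Qz 0) (Pz 0) != 0.
Proof.
have -> : wr n (Qz 0) (Pz 0) = - wr n (Pz 0) (Qz 0) by rewrite /brk; ring.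
by rewrite oppr_eq0 brk_PQ00.
Qed.

(* With al / be = Q_N / P_N the combination vanishes at N, so it lies on the
   N-th Weyl circle. *)
Lemma Qz_bnd z A : Im z != 0 -> bnd (Pz z) A ->
  bnd (Qz z) ((2 + 2 * A) / `|Im z| ^+ 2).
Proof.
move=> iz bP N; set t := `|Im z|.
have t0 : 0 < t by rewrite normr_gt0.
have A0 := bnd_ge0 bP.
suff H n : sq n.+1 (Qz z) <= (2 + 2 * A) / t ^+ 2.
  case: N => [|n]; last exact: H.
  by rewrite /sq big_ord0 divr_ge0 ?sqr_ge0// addr_ge0// mulr_ge0.
(* A zero of P_(n+1) at z would annihilate the Wronskian of P_z with its conjugate, which is 2 i Im
   z times a sum that is at least 1. *)
have be0 : Pz z n.+1 != 0.
  apply/negP => /eqP Pn; have := sum_PPJ n z.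
  rewrite /brk !PzJ !Pn conjc0 mul0r mulr0 subrr mulr0 => /esym/eqP.
  rewrite mulf_eq0 -cmod_eq0 cmod_subJ -cmod_eq0 cmod_rc mulf_eq0 pnatr_eq0 /= (gt_eqF t0) /=.
  by rewrite normr_eq0 gt_eqF// (lt_le_trans ltr01)// sq_Pz_ge1.
pose al := Qz z n.+1; pose be := Pz z n.+1.
have bp : 0 < cmod be by rewrite cmod_gt0.
have x0 : wr n (comb al be z) (fun k => (comb al be z k)^*%C) = 0.
  by rewrite /brk /comb /al /be [Qz z n.+1 * _]mulrC subrr conjc0 mul0r mulr0 subrr mulr0.
have h1 := weyl_comb x0; have h2 := comb_le x0; rewrite -/t in h1 h2.
have h3 : cmod be ^+ 2 * sq n.+1 (Qz z) <= 2 * (sq n.+1 (comb al be z) + cmod al ^+ 2 * sq n.+1 (Pz z)).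
  rewrite -!sqZ; have := sqD_le n.+1 (comb al be z) (fun k => al * Pz z k).
  by rewrite (_ : (fun k => _ + _) = (fun k => be * Qz z k))//; apply/funext => k; rewrite /comb subrK.
have h4 : t ^+ 2 * sq n.+1 (comb al be z) <= cmod be ^+ 2.
  rewrite expr2 -mulrA; apply: (@le_trans _ _ (t * (cmod al * cmod be))).
    by rewrite ler_wpM2l// ltW.
  by rewrite mulrA expr2 ler_wpM2r ?cmod_ge0.
have h5 : t ^+ 2 * (cmod al ^+ 2 * sq n.+1 (Pz z)) <= cmod be ^+ 2 * A.
  rewrite mulrA -exprMn; apply: ler_pM; rewrite ?sqr_ge0 ?sq_ge0//.
  by rewrite ler_pXn2r ?nnegrE ?cmod_ge0// mulr_ge0 ?cmod_ge0// ltW.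
have t2 : 0 < t ^+ 2 by rewrite exprn_gt0.
have b2 : 0 < cmod be ^+ 2 by rewrite exprn_gt0.
rewrite ler_pdivlMr// -(ler_pM2l b2) mulrA.
have := ler_wpM2l (ltW t2) h3; lra.
Qed.

End MomentSequences.

(** * Differentiable families in l^2 *)

Section HilbertCalculus.
Context {R : realType}.
Local Notation C := R[i].
Implicit Types (x y : nat -> C) (z w : C) (X Y : C -> nat -> C).

(* The l^2 norm of x is at most A. *)
Definition nb x (A : R) := 0 <= A /\ bnd x (A ^+ 2).

Lemma nb_le x A B : A <= B -> nb x A -> nb x B.
Proof.
move=> AB [A0 bA]; split; first exact: le_trans AB.
by apply: bnd_le bA; rewrite ler_pXn2r ?nnegrE// (le_trans A0).
Qed.

Lemma nbD x y A B : nb x A -> nb y B -> nb (fun k => x k + y k) (A + B).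
Proof.
move=> [A0 bA] [B0 bB]; split=> [|N]; first exact: addr_ge0.
have cs : \sum_(k < N) cmod (x k) * cmod (y k) <= A * B.
  have := @cauchy_schwarz _ N (fun k => (cmod (x k))%:C) (fun k => (cmod (y k))%:C).
  have e (v : nat -> C) : sq N (fun k => (cmod (v k))%:C) = sq N v.
    by apply: eq_bigr => k _; rewrite cmod_rc ger0_norm ?cmod_ge0.
  rewrite !e => h.
  have -> : \sum_(k < N) cmod (x k) * cmod (y k) = cmod (\sum_(k < N) (cmod (x k))%:C * (cmod (y k))%:C).
    under [in RHS]eq_bigr do rewrite -rmorphM.
    rewrite -rmorph_sum cmod_rc ger0_norm//.
    by apply: sumr_ge0 => k _; rewrite mulr_ge0 ?cmod_ge0.
  rewrite -(@ler_pXn2r _ 2) ?nnegrE ?cmod_ge0 ?mulr_ge0//; apply: (le_trans h).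
  by rewrite exprMn; apply: ler_pM => //; exact: sq_ge0.
apply: (@le_trans _ _ (sq N x + sq N y + 2 * \sum_(k < N) cmod (x k) * cmod (y k))).
  rewrite /sq mulr_sumr -!big_split; apply: ler_sum => k _ /=.
  apply: (@le_trans _ _ ((cmod (x k) + cmod (y k)) ^+ 2)).
    by rewrite ler_pXn2r ?nnegrE ?addr_ge0 ?cmod_ge0// cmodD.
  by rewrite le_eqVlt; apply/orP; left; apply/eqP; ring.
have := bA N; have := bB N; lra.
Qed.

Lemma nbZ c x A : nb x A -> nb (fun k => c * x k) (cmod c * A).
Proof.
move=> [A0 bA]; split; first by rewrite mulr_ge0 ?cmod_ge0.
by rewrite exprMn; exact: bndZ.
Qed.

Lemma nb_l2 x A : nb x A -> is_l2 x.
Proof. by move=> [_ /bnd_l2[]]. Qed.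

Lemma nb_l2norm x A : nb x A -> l2norm x <= A.
Proof. by move=> [A0 bA]; exact: l2norm_le. Qed.

Definition rip x y : R := Re (l2ip x y).

Lemma rip_le x y A B : nb x A -> nb y B -> `|rip x y| <= A * B.
Proof.
move=> nx ny; apply: le_trans (Re_le_cmod _) _.
apply: le_trans (l2ip_le (nb_l2 nx) (nb_l2 ny)) _.
by apply: ler_pM; rewrite ?l2norm_ge0 ?nb_l2norm.
Qed.

Lemma ripDl x x' y : is_l2 x -> is_l2 x' -> is_l2 y ->
  rip (fun k => x k + x' k) y = rip x y + rip x' y.
Proof.
move=> lx lx' ly; rewrite /rip -cReD; congr (Re _).
rewrite -(csumD (l2ip_ccvg lx ly) (l2ip_ccvg lx' ly)) /l2ip; congr csum.
by apply/funext => k; rewrite mulrDl.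
Qed.

Lemma l2ipC x y : is_l2 x -> is_l2 y -> l2ip y x = (l2ip x y)^*%C.
Proof.
move=> lx ly; apply: csumE => e e0; have [N HN] := l2ip_ccvg lx ly e0.
exists N => n /HN; rewrite -cmodJ cconjB; congr (cmod (_ - _) < _).
rewrite /psum rmorph_sum; apply: eq_bigr => k _ /=.
by rewrite cconjM conjcK mulrC.
Qed.

Lemma ripC x y : is_l2 x -> is_l2 y -> rip y x = rip x y.
Proof. by move=> lx ly; rewrite /rip l2ipC// cReJ. Qed.

Lemma ripDr x y y' : is_l2 x -> is_l2 y -> is_l2 y' ->
  rip x (fun k => y k + y' k) = rip x y + rip x y'.
Proof. by move=> lx ly ly'; rewrite -ripC ?ripDl 1?[rip y x]ripC 1?[rip y' x]ripC//; exact: l2D. Qed.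

Lemma l2ipZ c x y : is_l2 x -> is_l2 y -> l2ip (fun k => c * x k) y = c * l2ip x y.
Proof.
move=> lx ly; rewrite -(csumZ c (l2ip_ccvg lx ly)) /l2ip; congr csum.
by apply/funext => k; rewrite mulrA.
Qed.

(** Splits a complex increment into its two real directions, which is the form required by
    [rdiff]. *)
Lemma ripZ_split c x y : is_l2 x -> is_l2 y ->
  rip (fun k => c * x k) y = Re c * rip x y + Im c * rip (fun k => 'i%C * x k) y.
Proof.
by move=> lx ly; rewrite /rip !l2ipZ// !cE /=; ring.
Qed.

Lemma ripZ_splitr c x y : is_l2 x -> is_l2 y ->
  rip y (fun k => c * x k) = Re c * rip y x + Im c * rip y (fun k => 'i%C * x k).
Proof.
move=> lx ly; have lz c' := l2Z (c := c') lx.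
by rewrite (ripC (lz c) ly) ripZ_split// -(ripC lx ly) -(ripC (lz 'i%C) ly).
Qed.

(* X : C -> l^2 is bounded, Lipschitz and has the first order expansion given by
   DX on every disc. *)
Definition l2_smooth X DX := forall r : R, exists2 K : R, 0 <= K & forall z w,
  cmod z <= r -> cmod w <= r ->
  [/\ nb (X z) K, nb (DX z) K, nb (fun k => X w k - X z k) (K * cmod (w - z)) &
      nb (fun k => X w k - X z k - (w - z) * DX z k) (K * cmod (w - z) ^+ 2)].

Definition l2_lip X := forall r : R, exists2 K : R, 0 <= K & forall z w,
  cmod z <= r -> cmod w <= r ->
  nb (X z) K /\ nb (fun k => X w k - X z k) (K * cmod (w - z)).

Lemma smooth_lip X DX : l2_smooth X DX -> l2_lip X.
Proof.
by move=> H r; have [K K0 HK] := H r; exists K => // z w zr wr; have [] := HK z w zr wr.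
Qed.

Lemma lip_l2 X z : l2_lip X -> is_l2 (X z).
Proof. by move=> /(_ (cmod z))[K _ /(_ z z (lexx _) (lexx _))[/nb_l2]]. Qed.

Lemma locLip_rip X Y : l2_lip X -> l2_lip Y -> locLip (fun z => rip (X z) (Y z)).
Proof.
move=> sX sY r; have [K K0 HK] := sX r; have [L L0 HL] := sY r.
exists (2 * K * L); first by rewrite !mulr_ge0.
move=> w z wr zr; have [x1 x2] := HK z w zr wr; have [y1 y2] := HL z w zr wr.
have [x1' _] := HK w z wr zr; have [y1' _] := HL w z wr zr.
have E : rip (X w) (Y w) - rip (X z) (Y z) =
    rip (fun k => X w k - X z k) (Y w) + rip (X z) (fun k => Y w k - Y z k).
  have -> : rip (X w) (Y w) = rip (fun k => (X w k - X z k) + X z k) (Y w).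
    by congr (rip _ (Y w)); apply/funext => k; rewrite subrK.
  rewrite (ripDl (nb_l2 x2) (nb_l2 x1) (nb_l2 y1')).
  have -> : rip (X z) (Y w) = rip (X z) (fun k => (Y w k - Y z k) + Y z k).
    by congr (rip (X z) _); apply/funext => k; rewrite subrK.
  rewrite (ripDr (nb_l2 x1) (nb_l2 y2) (nb_l2 y1)); ring.
rewrite E; apply: le_trans (ler_normD _ _) _.
have := rip_le x2 y1'; have := rip_le x1 y2; lra.
Qed.

Lemma rdiff_rip X DX Y DY z : l2_smooth X DX -> l2_smooth Y DY ->
  rdiff (fun z => rip (X z) (Y z)) z
    (rip (DX z) (Y z) + rip (X z) (DY z))
    (rip (fun k => 'i%C * DX z k) (Y z) + rip (X z) (fun k => 'i%C * DY z k)).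
Proof.
move=> sX sY; pose r := cmod z + 1.
have [K K0 HK] := sX r; have [L L0 HL] := sY r.
have zr : cmod z <= r by rewrite lerDl.
move=> e e0.
(* Each of the three remainder terms in the expansion below is at most K L |h|^2. *)
have D0 : 0 < 3 * K * L + 1 by rewrite ltr_wpDl// !mulr_ge0.
exists (Num.min 1 (e / (3 * K * L + 1))); first by rewrite lt_min ltr01 divr_gt0.
move=> w; rewrite lt_min => /andP[w1 w2].
have wr : cmod w <= r by have := cmodD (w - z) z; rewrite subrK /r; lra.
have [x1 x2 x3 x4] := HK z w zr wr; have [y1 y2 y3 y4] := HL z w zr wr.
have [_ _ _ _] := HK w z wr zr; have [y1' _ _ _] := HL w z wr zr.
set h := w - z in w1 w2 x3 x4 y3 y4 *.
pose rX k := X w k - X z k - h * DX z k; pose rY k := Y w k - Y z k - h * DY z k.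
have hx := nbZ h x2; have hy := nbZ h y2.
have E : rip (X w) (Y w) - rip (X z) (Y z) -
  ((rip (DX z) (Y z) + rip (X z) (DY z)) * Re h +
   (rip (fun k => 'i%C * DX z k) (Y z) + rip (X z) (fun k => 'i%C * DY z k)) * Im h) =
  rip rX (Y w) + rip (fun k => h * DX z k) (fun k => Y w k - Y z k) + rip (X z) rY.
  have -> : rip (X w) (Y w) = rip (fun k => (rX k + h * DX z k) + X z k) (Y w).
    by congr (rip _ (Y w)); apply/funext => k; rewrite /rX; ring.
  rewrite (ripDl (l2D (nb_l2 x4) (nb_l2 hx)) (nb_l2 x1) (nb_l2 y1')).
  rewrite (ripDl (nb_l2 x4) (nb_l2 hx) (nb_l2 y1')).
  have -> : rip (fun k => h * DX z k) (Y w) = rip (fun k => h * DX z k) (fun k => (Y w k - Y z k) + Y z k).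
    by congr (rip _ _); apply/funext => k; rewrite subrK.
  rewrite (ripDr (nb_l2 hx) (nb_l2 y3) (nb_l2 y1)).
  have -> : rip (X z) (Y w) = rip (X z) (fun k => (rY k + h * DY z k) + Y z k).
    by congr (rip (X z) _); apply/funext => k; rewrite /rY; ring.
  rewrite (ripDr (nb_l2 x1) (l2D (nb_l2 y4) (nb_l2 hy)) (nb_l2 y1)).
  rewrite (ripDr (nb_l2 x1) (nb_l2 y4) (nb_l2 hy)).
  rewrite (ripZ_split h (nb_l2 x2) (nb_l2 y1)).
  rewrite (ripZ_splitr h (nb_l2 y2) (nb_l2 x1)).
  ring.
rewrite E.
have b1 := rip_le x4 y1'; have b2 := rip_le hx y3; have b3 := rip_le x1 y4.
apply: le_trans (ler_normD _ _) _; apply: le_trans (lerD (ler_normD _ _) (lexx _)) _.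
rewrite ltr_pdivlMr// in w2.
have h0 := cmod_ge0 h.
have : cmod h * (cmod h * (3 * K * L + 1)) <= cmod h * e by rewrite ler_wpM2l// ltW.
have : 0 <= cmod h * cmod h by rewrite mulr_ge0.
lra.
Qed.

Lemma smooth_i X DX : l2_smooth X DX ->
  l2_smooth (fun z k => 'i%C * X z k) (fun z k => 'i%C * DX z k).
Proof.
move=> H r; have [K K0 HK] := H r; exists K => // z w zr wr.
have [h1 h2 h3 h4] := HK z w zr wr.
have I (A : R) (x : nat -> C) : nb x A -> nb (fun k => 'i%C * x k) A by move=> /(nbZ 'i%C); rewrite cmod_i mul1r.
split; [exact: I|exact: I| |].
- by have := I _ _ h3; under eq_fun do rewrite mulrBr.
- have := I _ _ h4; rewrite (_ : (fun k => _) = (fun k => 'i%C * X w k - 'i%C * X z k - (w - z) * ('i%C * DX z k)))//.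
  by apply/funext => k; ring.
Qed.

Lemma rip_self x : is_l2 x -> rip x x = l2norm x ^+ 2.
Proof.
move=> lx; have H := l2ip_ccvg lx lx.
rewrite /rip (_ : l2ip x x = (l2norm x ^+ 2)%:C)//.
apply: (ccvg_unique H) => e e0.
have cv : (fun n => sq n x) @ \oo --> l2norm x ^+ 2.
  rewrite /l2norm l2_series sqr_sqrtr.
    by apply: nondecreasing_is_cvgn; [exact: sq_ndecr|exists (l2norm x ^+ 2) => _ [n _ <-]; exact: l2_bnd].
  apply: limr_ge; last by apply: nearW => n; exact: sq_ge0.
  by apply: nondecreasing_is_cvgn; [exact: sq_ndecr|exists (l2norm x ^+ 2) => _ [n _ <-]; exact: l2_bnd].
move/cvgrPdist_lt : cv => /(_ e e0)[N _ HN]; exists N => n /HN.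
rewrite distrC -cmod_rc rmorphB; congr (cmod (_ - _) < _).
by rewrite /psum /sq /= rmorph_sum; apply: eq_bigr => k _; rewrite mulcJ.
Qed.

End HilbertCalculus.

(** * Square-summability at every point and smoothness of K *)

Section DeficiencyVectors.
Context {R : realType}.
Local Notation C := R[i].
Variable s : nat -> R.
Hypothesis s0 : s 0%N = 1.
Hypothesis s_pd : positive_definite_seq s.
Variables (zb : C) (Ab : R).
Hypothesis zb_im : Im zb != 0.
Hypothesis zb_bnd : bnd (Pz s zb) Ab.
Local Notation a := (jacobi_a s).
Local Notation b := (jacobi_b s).
Local Notation P := (Pz s).
Local Notation Q := (Qz s).
Local Notation Vz := (green_op P Q).
Implicit Types (z w : C).

Let agt n : 0 < a n. Proof. exact: a_gt0. Qed.
Let p0 z : P z 0%N = 1. Proof. exact: Pz0. Qed.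
Let p1 z : (a 0%N)%:C * P z 1%N = z - (b 0%N)%:C. Proof. exact: Pz1. Qed.
Let pS z : solves a b z (P z). Proof. exact: PzS. Qed.
Let q0 z : Q z 0%N = 0. Proof. exact: Qz0. Qed.
Let q1 z : (a 0%N)%:C * Q z 1%N = 1. Proof. exact: Qz1. Qed.
Let qS z : solves a b z (Q z). Proof. exact: QzS. Qed.

(** Gronwall's inequality started at the base point [zb]: there P is square-summable by hypothesis,
    and Q by the Weyl circle argument [Qz_bnd]. *)
Lemma loc_nb (r : R) : exists2 M : R, 0 <= M & forall z, cmod z <= r -> nb (P z) M /\ nb (Q z) M.
Proof.
pose A := Num.max Ab ((2 + 2 * Ab) / `|Im zb| ^+ 2).
have bP : bnd (P zb) A by apply: bnd_le zb_bnd; rewrite le_max lexx.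
have bQ : bnd (Q zb) A.
  by apply: bnd_le (Qz_bnd s0 s_pd zb_im zb_bnd); rewrite le_max lexx orbT.
pose r' := r + cmod zb.
pose M2 := expR ((2 + 4 * r' ^+ 2 * A) * (2 * A)).
exists (Num.sqrt M2); first exact: sqrtr_ge0.
move=> z zr.
have zz : cmod (z - zb) <= r' by have := cmodB z zb; rewrite /r'; lra.
have E : Num.sqrt M2 ^+ 2 = M2 by rewrite sqr_sqrtr// expR_ge0.
split; (split; first exact: sqrtr_ge0); rewrite E.
- apply: (gronwall (t := z - zb) bP bQ _ _ zz (y := P zb)).
    by move=> n; rewrite -(green_op_P agt p0 p1 pS q0 q1 qS) addrC subrK.
  by move=> n; rewrite lerDl sqr_ge0.
- apply: (gronwall (t := z - zb) bP bQ _ _ zz (y := Q zb)).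
    by move=> n; rewrite -(green_op_Q agt p0 pS q0 q1 qS) addrC subrK.
  by move=> n; rewrite lerDr sqr_ge0.
Qed.

Lemma green_op_nb z f A F : nb (P z) A -> nb (Q z) A -> nb f F -> nb (Vz z f) (2 * A ^+ 2 * F).
Proof.
move=> [A0 bP] [_ bQ] [F0 bF]; split.
  by rewrite !mulr_ge0// sqr_ge0.
have := green_op_bnd bP bQ bF; rewrite (_ : 4 * _ * _ = (2 * A ^+ 2 * F) ^+ 2)//; ring.
Qed.

(** Letting w tend to z in [green_op_P] gives the derivative of P in z as the Green operator applied
    to P. Differentiating once more through the resolvent identity produces two equal terms, hence
    the factor 2 in [d2Pz]. *)
Definition dPz z := Vz z (P z).
Definition d2Pz z := Vz z (fun k => 2 * dPz z k).

(** The remainder of order one is (w - z) times the Green operator at z applied to P_w - P_z, so the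
    Lipschitz bound upgrades itself to a quadratic one. *)
Lemma smooth_P : l2_smooth P dPz.
Proof.
move=> r; have [M M0 HM] := loc_nb r.
pose L := 2 * M ^+ 2.
have L0 : 0 <= L by rewrite mulr_ge0// sqr_ge0.
have LM : 0 <= L * M by rewrite mulr_ge0.
have LLM : 0 <= L * (L * M) by rewrite mulr_ge0.
exists (M + L * M + L * (L * M)); first by rewrite !addr_ge0.
move=> z w zr wr; have [bP bQ] := HM z zr; have [bPw bQw] := HM w wr.
have h3 : nb (fun k => P w k - P z k) (L * M * cmod (w - z)).
  have := nbZ (w - z) (green_op_nb bP bQ bPw); rewrite -/L mulrC.
  rewrite (_ : (fun k => _) = (fun k => P w k - P z k))//.
  by apply/funext => k; rewrite (green_op_P agt p0 p1 pS q0 q1 qS).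
split.
- by apply: nb_le bP; lra.
- by apply: nb_le (green_op_nb bP bQ bP); rewrite -/L; lra.
- by apply: nb_le h3; rewrite ler_wpM2r ?cmod_ge0//; lra.
- have := nbZ (w - z) (green_op_nb bP bQ h3).
  rewrite (_ : (fun k => _) = (fun k => P w k - P z k - (w - z) * dPz z k)); last first.
    apply/funext => k; rewrite (green_op_P agt p0 p1 pS q0 q1 qS) -mulrBr; congr (_ * _).
    rewrite /dPz /green_op -sumrB; apply: eq_bigr => j _; ring.
  apply: nb_le; rewrite -/L.
  rewrite [X in X <= _](_ : _ = L * (L * M) * cmod (w - z) ^+ 2); last by ring.
  by rewrite ler_wpM2r ?sqr_ge0//; lra.
Qed.

Lemma loc_nbV (f : C -> nat -> C) : (forall r : R, exists2 M : R, 0 <= M & forall z, cmod z <= r -> nb (f z) M) ->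
  forall r : R, exists2 M : R, 0 <= M & forall z, cmod z <= r -> nb (Vz z (f z)) M.
Proof.
move=> H r; have [M M0 HM] := loc_nb r; have [F F0 HF] := H r.
exists (2 * M ^+ 2 * F); first by rewrite !mulr_ge0// sqr_ge0.
by move=> z zr; have [h1 h2] := HM z zr; apply: green_op_nb => //; exact: HF.
Qed.

Lemma loc_nb2 (f : C -> nat -> C) : (forall r : R, exists2 M : R, 0 <= M & forall z, cmod z <= r -> nb (f z) M) ->
  forall r : R, exists2 M : R, 0 <= M & forall z, cmod z <= r -> nb (fun k => 2 * f z k) M.
Proof.
move=> H r; have [M M0 HM] := H r; exists (cmod (2 : C) * M); first by rewrite mulr_ge0 ?cmod_ge0.
by move=> z /HM; exact: nbZ.
Qed.

Lemma loc_nbP r : exists2 M : R, 0 <= M & forall z, cmod z <= r -> nb (P z) M.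
Proof. by have [M M0 HM] := loc_nb r; exists M => // z /HM[]. Qed.

Lemma dPz_diff z w k : dPz w k - dPz z k =
  Vz z (fun j => P w j - P z j) k + (w - z) * Vz z (dPz w) k.
Proof.
rewrite {1}/dPz (green_op_resolvent agt p0 pS q0 q1 qS z w) green_opD green_opZ addrAC; congr (_ + _).
by rewrite /dPz /green_op -sumrB; apply: eq_bigr => j _; ring.
Qed.

Lemma d2Pz_diff z w k : d2Pz w k - d2Pz z k =
  Vz z (fun j => 2 * (dPz w j - dPz z j)) k + (w - z) * Vz z (d2Pz w) k.
Proof.
rewrite {1}/d2Pz (green_op_resolvent agt p0 pS q0 q1 qS z w) green_opD addrAC; congr (_ + _); last exact: green_opZ.
by rewrite /d2Pz /green_op -sumrB; apply: eq_bigr => j _; ring.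
Qed.

Lemma smooth_dPz : l2_smooth dPz d2Pz.
Proof.
move=> r; have [M M0 HM] := loc_nb r.
have [K K0 HK] := smooth_P r.
have [B B0 HB] := loc_nbV (loc_nb2 (loc_nbV loc_nbP)) r.
pose L := 2 * M ^+ 2.
have L0 : 0 <= L by rewrite mulr_ge0// sqr_ge0.
have LK : 0 <= L * K by rewrite mulr_ge0.
have LLK : 0 <= L * (L * K) by rewrite mulr_ge0.
exists (K + B + 2 * (L * K) + 2 * (L * (L * K)) + L * K); first by rewrite !addr_ge0 ?mulr_ge0.
move=> z w zr wr; have [bP bQ] := HM z zr; have [bPw bQw] := HM w wr.
have [k1 k2 k3 k4] := HK z w zr wr; have [_ k2w _ _] := HK w z wr zr.
have h3 : nb (fun k => dPz w k - dPz z k) (2 * (L * K) * cmod (w - z)).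
  have := nbD (green_op_nb bP bQ k3) (nbZ (w - z) (green_op_nb bP bQ k2w)); rewrite -/L.
  rewrite (_ : (fun k => _) = (fun k => dPz w k - dPz z k)); last first.
    by apply/funext => k; rewrite dPz_diff.
  by rewrite [X in nb _ X](_ : _ = 2 * (L * K) * cmod (w - z))//; ring.
split.
- by apply: nb_le k2; lra.
- by apply: nb_le (HB z zr); lra.
- by apply: nb_le h3; rewrite ler_wpM2r ?cmod_ge0//; lra.
- have := nbD (green_op_nb bP bQ k4) (nbZ (w - z) (green_op_nb bP bQ h3)); rewrite -/L.
  rewrite (_ : (fun k => _) = (fun k => dPz w k - dPz z k - (w - z) * d2Pz z k)); last first.
    apply/funext => k; rewrite dPz_diff /d2Pz /green_op !mulr_sumr -!big_split -sumrB /=.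
    by apply: eq_bigr => j _; ring.
  apply: nb_le.
  rewrite [X in X <= _](_ : _ = (L * K + 2 * (L * (L * K))) * cmod (w - z) ^+ 2); last by ring.
  by rewrite ler_wpM2r ?sqr_ge0//; lra.
Qed.

(** Jensen's formula asks the second derivatives of ln K only to be locally Lipschitz, so the
    iteration stops here. *)
Lemma lip_P2 : l2_lip d2Pz.
Proof.
move=> r; have [M M0 HM] := loc_nb r.
have [K K0 HK] := smooth_dPz r.
pose L := 2 * M ^+ 2.
have L0 : 0 <= L by rewrite mulr_ge0// sqr_ge0.
have c2 : 0 <= cmod (2 : C) by exact: cmod_ge0.
exists (K + L * (cmod (2 : C) * K) + L * K); first by rewrite !addr_ge0 ?mulr_ge0.
move=> z w zr wr; have [bP bQ] := HM z zr.
have [k1 k2 k3 k4] := HK z w zr wr; have [_ k2w _ _] := HK w z wr zr.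
have LK : 0 <= L * K by rewrite mulr_ge0.
have LcK : 0 <= L * (cmod (2 : C) * K) by rewrite mulr_ge0// mulr_ge0.
split; first by apply: nb_le k2; lra.
have := nbD (green_op_nb bP bQ (nbZ 2 k3)) (nbZ (w - z) (green_op_nb bP bQ k2w)); rewrite -/L.
rewrite (_ : (fun k => _) = (fun k => d2Pz w k - d2Pz z k)); last first.
  by apply/funext => k; rewrite d2Pz_diff.
apply: nb_le; rewrite [X in X <= _](_ : _ = (L * (cmod (2 : C) * K) + L * K) * cmod (w - z)); last by ring.
by rewrite ler_wpM2r ?cmod_ge0//; lra.
Qed.

Let sP := smooth_P.
Let sdPz := smooth_dPz.
Let lP := smooth_lip smooth_P.
Let ldPz := smooth_lip smooth_dPz.

Lemma l2P z : is_l2 (P z). Proof. exact: lip_l2 lP. Qed.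
Lemma l2dPz z : is_l2 (dPz z). Proof. exact: lip_l2 ldPz. Qed.
Lemma l2Q z : is_l2 (Q z).
Proof. by have [M _ /(_ z (lexx _))[_ /nb_l2]] := loc_nb (cmod z). Qed.

Definition KK z : R := rip (P z) (P z).

Lemma KKE z : KK z = l2norm (P z) ^+ 2. Proof. by apply: rip_self; exact: l2P. Qed.

Lemma KK_ge1 z : 1 <= KK z.
Proof.
rewrite KKE; have := cmod_le_l2norm 0 (@l2P z); rewrite p0 cmod1 => h.
by rewrite -[1](expr1n _ 2) ler_pXn2r ?nnegrE ?l2norm_ge0.
Qed.

Lemma KK_gt0 z : 0 < KK z. Proof. exact: lt_le_trans (KK_ge1 z). Qed.

Lemma l2norm_PJ z : l2norm (P z^*%C) = l2norm (P z).
Proof.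
rewrite /l2norm !l2_series; congr (Num.sqrt (limn _)); apply/funext => n.
by apply: eq_bigr => k _; rewrite PzJ cmodJ.
Qed.

Definition Kx z : R := rip (dPz z) (P z) + rip (P z) (dPz z).
Definition Ky z : R := rip (fun k => 'i%C * dPz z k) (P z) + rip (P z) (fun k => 'i%C * dPz z k).

Lemma rdiff_KK z : rdiff KK z (Kx z) (Ky z).
Proof. exact: rdiff_rip sP sP. Qed.

Let si1 := smooth_i sdPz.
Let i1 z k : C := 'i%C * dPz z k.
Let i2 z k : C := 'i%C * d2Pz z k.
Let ii2 z k : C := 'i%C * i2 z k.

Definition Kxx z := (rip (d2Pz z) (P z) + rip (dPz z) (dPz z)) + (rip (dPz z) (dPz z) + rip (P z) (d2Pz z)).
Definition Kxy z := (rip (i2 z) (P z) + rip (dPz z) (i1 z)) + (rip (i1 z) (dPz z) + rip (P z) (i2 z)).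
Definition Kyx z := (rip (i2 z) (P z) + rip (i1 z) (dPz z)) + (rip (dPz z) (i1 z) + rip (P z) (i2 z)).
Definition Kyy z := (rip (ii2 z) (P z) + rip (i1 z) (i1 z)) + (rip (i1 z) (i1 z) + rip (P z) (ii2 z)).

Lemma rdiff_Kx z : rdiff Kx z (Kxx z) (Kxy z).
Proof. by apply: rdiffD; [exact: rdiff_rip sdPz sP|exact: rdiff_rip sP sdPz]. Qed.

Lemma rdiff_Ky z : rdiff Ky z (Kyx z) (Kyy z).
Proof. by apply: rdiffD; [exact: rdiff_rip si1 sP|exact: rdiff_rip sP si1]. Qed.

Lemma lip_i X : l2_lip X -> l2_lip (fun z k => 'i%C * X z k).
Proof.
move=> H r; have [K K0 HK] := H r; exists K => // z w zr wr.
have [h1 h2] := HK z w zr wr.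
have I (A : R) (x : nat -> C) : nb x A -> nb (fun k => 'i%C * x k) A by move=> /(nbZ 'i%C); rewrite cmod_i mul1r.
split; first exact: I.
by have := I _ _ h2; under eq_fun do rewrite mulrBr.
Qed.

Let lP2 := lip_P2.
Let li1 := lip_i ldPz.
Let li2 := lip_i lP2.
Let lii2 := lip_i li2.

Lemma locLip_KK : locLip KK. Proof. exact: locLip_rip. Qed.
Lemma locLip_Kx : locLip Kx. Proof. by apply: locLipD; exact: locLip_rip. Qed.
Lemma locLip_Ky : locLip Ky. Proof. by apply: locLipD; exact: locLip_rip. Qed.
Lemma locLip_Kxx : locLip Kxx. Proof. by do 2 (apply: locLipD); exact: locLip_rip. Qed.
Lemma locLip_Kyy : locLip Kyy. Proof. by do 2 (apply: locLipD); exact: locLip_rip. Qed.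

Definition logK z : R := ln (KK z).
Definition ux z : R := Kx z * (KK z)^-1.
Definition uy z : R := Ky z * (KK z)^-1.
Definition uxx z : R := Kx z * (- (KK z) ^- 2 * Kx z) + (KK z)^-1 * Kxx z.
Definition uxy z : R := Kx z * (- (KK z) ^- 2 * Ky z) + (KK z)^-1 * Kxy z.
Definition uyx z : R := Ky z * (- (KK z) ^- 2 * Kx z) + (KK z)^-1 * Kyx z.
Definition uyy z : R := Ky z * (- (KK z) ^- 2 * Ky z) + (KK z)^-1 * Kyy z.

Lemma rdiff_logK z : rdiff logK z (ux z) (uy z).
Proof.
rewrite /ux /uy mulrC [Ky z * _]mulrC; apply: (rdiff_compD (rdiff_KK z)).
exact: is_derive1_ln (KK_gt0 z).
Qed.

Lemma rdiff_KKV z : rdiff (fun w => (KK w)^-1) z (- (KK z) ^- 2 * Kx z) (- (KK z) ^- 2 * Ky z).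
Proof.
have K0 : KK z != 0 by rewrite gt_eqF// KK_gt0.
apply: (rdiff_compD (rdiff_KK z) (phi := fun x => x^-1)).
have := is_deriveV K0 (is_derive_id (KK z) (1 : R)).
by rewrite /GRing.scale /= mulr1.
Qed.

Lemma rdiff_ux z : rdiff ux z (uxx z) (uxy z).
Proof. exact: rdiffM (rdiff_Kx z) (rdiff_KKV z). Qed.
Lemma rdiff_uy z : rdiff uy z (uyx z) (uyy z).
Proof. exact: rdiffM (rdiff_Ky z) (rdiff_KKV z). Qed.

Let lKV := locLipV KK_ge1 locLip_KK.

Lemma locLip_KV2 : locLip (fun z => - (KK z) ^- 2).
Proof.
apply: locLipN; have := locLipM lKV lKV.
by rewrite (_ : (fun z => _ * _) = (fun z => KK z ^- 2))//; apply/funext => z; rewrite expr2 invfM.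
Qed.

Lemma locLip_ux : locLip ux. Proof. exact: locLipM locLip_Kx lKV. Qed.
Lemma locLip_uy : locLip uy. Proof. exact: locLipM locLip_Ky lKV. Qed.
Lemma locLip_uxx : locLip uxx.
Proof.
exact: locLipD (locLipM locLip_Kx (locLipM locLip_KV2 locLip_Kx)) (locLipM lKV locLip_Kxx).
Qed.
Lemma locLip_uyy : locLip uyy.
Proof.
exact: locLipD (locLipM locLip_Ky (locLipM locLip_KV2 locLip_Ky)) (locLipM lKV locLip_Kyy).
Qed.

End DeficiencyVectors.

(** * Comparison of the characteristics *)

Section LogSine.
Context {R : realType}.
Implicit Types (D : R -> R).

Lemma is_derive_mul (f g : R -> R) (x a b : R) : is_derive x 1 f a -> is_derive x 1 g b ->
  is_derive x 1 (fun t => f t * g t) (a * g x + f x * b).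
Proof.
move=> df dg; have := @is_deriveM _ _ f g x 1 a b df dg.
by rewrite [a * _]mulrC addrC.
Qed.

(** The difference of the two sides has derivative x sin x, which is nonnegative on [0, pi]. *)
Lemma sin_ge_xcos (x : R) : 0 <= x <= pi -> x * cos x <= sin x.
Proof.
move=> /andP[x0 xpi].
pose g (t : R) := sin t - t * cos t.
have dg (t : R) : is_derive t 1 g (t * sin t).
  rewrite /g; have -> : t * sin t = cos t - (1 * cos t + t * - sin t) by ring.
  by apply: is_deriveB; apply: is_derive_mul.
have [->|xp] := eqVneq x 0; first by rewrite mul0r sin0.
have x00 : 0 < x by rewrite lt_neqAle eq_sym xp.
have [c c01 E] := MVT x00 (fun t _ => dg t) (continuous_subspaceT (is_derive_cont dg)).
move: c01; rewrite in_itv /= => /andP[c0 cx].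
have : 0 <= g x - g 0.
  rewrite E subr0; apply: mulr_ge0 => //; apply: mulr_ge0; first exact: ltW.
  by apply: sin_ge0_pi; rewrite (ltW c0) (le_trans (ltW cx)).
by rewrite /g sin0 mul0r subrr subr0 subr_ge0.
Qed.

(* On (0, pi/2] one has -ln (sin x) <= (- x ln (sin x))' + 1, because
   x cos x <= sin x. *)
Lemma quarter_logsin D : continuous D ->
  (forall x, 0 < x <= pi / 2 -> D x <= - ln (sin x)) ->
  RI D 0 (pi / 2) <= pi / 2.
Proof.
move=> cD HD.
have pi0 := pi_gt0 R.
have pi20 : 0 < pi / 2 :> R by rewrite divr_gt0.
have sinp (x : R) : 0 < x -> x <= pi / 2 -> 0 < sin x.
  by move=> x0 x1; apply: sin_gt0_pi; rewrite x0 /=; lra.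
(* The interval is cut at d because ln sin is singular at 0. The piece that is lost is at most M d,
   where M bounds D, and d is arbitrary. *)
have main (d : R) : 0 < d -> d < pi / 2 -> RI D d (pi / 2) <= pi / 2.
  move=> d0 d1.
  pose W (x : R) := RI D d x + x * ln (sin x) - x.
  pose dW (x : R) := D x + (1 * ln (sin x) + x * ((sin x)^-1 * cos x)) - 1.
  have dWP (x : R) : 0 < x -> x <= pi / 2 -> is_derive x 1 W (dW x).
    move=> x0 x1; apply: is_deriveB; apply: is_deriveD; first exact: is_derive_RI.
    have dl : is_derive x 1 (fun x => ln (sin x)) ((sin x)^-1 * cos x).
      by apply: (@is_derive1_comp _ (@ln R) sin); exact: is_derive1_ln (sinp x x0 x1).
    exact: is_derive_mul.
  have cW : {within `[d, pi / 2], continuous W}.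
    apply: derivable_within_continuous => x; rewrite in_itv /= => /andP[xd x1].
    by have [] := dWP x (lt_le_trans d0 xd) x1.
  have dW' (x : R) : x \in `]d, pi / 2[ -> is_derive x 1 W (dW x).
    rewrite in_itv /= => /andP[xd x1]; apply: dWP; [exact: lt_trans xd|exact: ltW].
  have [c c01 E] := MVT d1 dW' cW.
  move: c01; rewrite in_itv /= => /andP[cd c1].
  have c0 : 0 < c := lt_trans d0 cd.
  have sc := sinp c c0 (ltW c1).
  have dWc : dW c <= 0.
    have h1 : D c <= - ln (sin c) by apply: HD; rewrite c0 ltW.
    have h2 : c * ((sin c)^-1 * cos c) <= 1.
      rewrite mulrCA -ler_pdivlMl ?invr_gt0// invrK mulr1.
      by apply: sin_ge_xcos; rewrite (ltW c0) /=; lra.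
    by rewrite /dW; lra.
  have : W (pi / 2) - W d <= 0 by rewrite E mulr_le0_ge0// subr_ge0 ltW.
  rewrite /W RI_id sin_pihalf ln1 mulr0 addr0 add0r.
  have : d * ln (sin d) <= 0.
    by apply: mulr_ge0_le0; [exact: ltW|apply: ln_le0; exact: sin_le1].
  lra.
apply/ler_addgt0Pr => e e0.
have [M HM] : exists2 M : R, 0 <= M & forall x, 0 <= x <= pi / 2 -> `|D x| <= M.
  have cD' : {within `[0, pi / 2], continuous (fun t => `|D t|)}.
    by apply: continuous_subspaceT => t; apply: cvg_norm; exact: cD.
  have [c _ Hc] := EVT_max (ltW pi20) cD'.
  by exists `|D c| => // x xab; apply: Hc; rewrite in_itv.
move=> HD2; have M1 : 0 < M + 1 by rewrite ltr_wpDl.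
pose d := Num.min (pi / 4) (e / (M + 1)).
have d0 : 0 < d by rewrite lt_min !divr_gt0.
have d1 : d < pi / 2 by rewrite /d gt_min; apply/orP; left; lra.
rewrite -(RI_cat 0 d (pi / 2) cD).
have := main d d0 d1.
have : `|RI D 0 d| <= M * (d - 0).
  apply: RI_abs_le => //; first exact: ltW.
  by move=> x /andP[x0 xd]; apply: HD2; rewrite x0 /= (le_trans xd)// ltW.
rewrite subr0 ler_norml => /andP[_ h1].
have : M * d <= e.
  apply: (@le_trans _ _ ((M + 1) * d)); first by rewrite ler_wpM2r ?ltW// ltrDl.
  by rewrite mulrC -ler_pdivlMr// /d ge_min lexx orbT.
lra.
Qed.

(** Four quarter periods, each carried to (0, pi / 2] by a symmetry that preserves |sin|. Only
    continuous functions D below -ln |sin| are integrated, so no improper integral occurs; the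
    constant 2 pi is cruder than the true value 2 pi ln 2. *)
Lemma period_logsin D : continuous D ->
  (forall x, sin x != 0 -> D x <= - ln `|sin x|) ->
  RI D 0 (pi *+ 2) <= pi *+ 2.
Proof.
move=> cD HD; have pi0 := pi_gt0 R.
have sinp (x : R) : 0 < x <= pi / 2 -> 0 < sin x.
  by move=> /andP[x0 x1]; apply: sin_gt0_pi; rewrite x0 /=; lra.
have Q (g : R -> R) : continuous g -> (forall x, `|sin (g x)| = `|sin x|) ->
    RI (fun x => D (g x)) 0 (pi / 2) <= pi / 2.
  move=> cg Hg; apply: quarter_logsin; first by move=> t; apply: (continuous_comp (cg t)); exact: cD.
  move=> x x01; have sx := sinp x x01.
  have := HD (g x); rewrite -normr_gt0 Hg gtr0_norm// => /(_ sx).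
  by [].
have cid : continuous (fun x : R => x) by move=> t; exact: cvg_id.
have cc (k : R) : continuous (fun _ : R => k) by move=> t; exact: cvg_cst.
have q1 := Q (fun x => x) cid (fun x => erefl).
have q2 : RI (fun x => D (pi - x)) 0 (pi / 2) <= pi / 2.
  apply: (Q (fun x => pi - x)); first by apply: contD => //; exact: contN.
  by move=> x; rewrite addrC sinDpi sinN opprK.
have q3 : RI (fun x => D (pi + 1 * x)) 0 (pi / 2) <= pi / 2.
  apply: (Q (fun x => pi + 1 * x)); first exact: cont_affine.
  by move=> x; rewrite mul1r addrC sinDpi normrN.
have q4 : RI (fun x => D (pi *+ 2 - x)) 0 (pi / 2) <= pi / 2.
  apply: (Q (fun x => pi *+ 2 - x)); first by apply: contD => //; exact: contN.
  by move=> x; rewrite addrC mulr2n addrA !sinDpi opprK sinN normrN.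
rewrite RI_refl// subr0 in q2; rewrite RI_refl// subr0 in q4.
have q3' := RI_affine pi 1 0 (pi / 2) cD; rewrite !mul1r addr0 in q3'.
rewrite q3' in q3.
rewrite -(RI_cat 0 (pi / 2) (pi *+ 2) cD) -(RI_cat (pi / 2) pi (pi *+ 2) cD).
rewrite -(RI_cat pi (pi + pi / 2) (pi *+ 2) cD).
have e1 : pi - pi / 2 = pi / 2 :> R by field.
have e2 : pi *+ 2 - pi / 2 = pi + pi / 2 :> R by rewrite mulr2n; field.
rewrite e1 in q2; rewrite e2 in q4.
have {}q1 : RI D 0 (pi / 2) <= pi / 2 := q1.
have E : pi *+ 2 = pi / 2 + pi / 2 + (pi / 2 + pi / 2) :> R by rewrite mulr2n; field.
rewrite [X in _ <= X]E; lra.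
Qed.

Lemma mean_logsin (F G : R -> R) : continuous F -> continuous G ->
  (forall x, sin x != 0 -> F x <= G x - ln `|sin x|) ->
  RI F 0 (pi *+ 2) <= RI G 0 (pi *+ 2) + pi *+ 2.
Proof.
move=> cF cG H; rewrite -lerBlDl -RIN// -RID//; last exact: contN.
apply: period_logsin; first by apply: contD => //; exact: contN.
by move=> x /H; lra.
Qed.

End LogSine.

(** * The Nevanlinna entries as limits of Wronskians *)

Section NevanlinnaEntries.
Context {R : realType}.
Local Notation C := R[i].
Variable s : nat -> R.
Hypothesis s0 : s 0%N = 1.
Hypothesis s_pd : positive_definite_seq s.
Variables (zb : C) (Ab : R).
Hypothesis zb_im : Im zb != 0.
Hypothesis zb_bnd : bnd (Pz s zb) Ab.
Local Notation a := (jacobi_a s).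
Local Notation b := (jacobi_b s).
Local Notation P := (Pz s).
Local Notation Q := (Qz s).
Local Notation wr := (brk a).
Implicit Types (z w : C).

Let lnb r := loc_nb s0 s_pd zb_im zb_bnd r.
Let lP z : is_l2 (P z). Proof. exact: (l2P s0 s_pd zb_im zb_bnd). Qed.
Let lQ z : is_l2 (Q z). Proof. exact: (l2Q s0 s_pd zb_im zb_bnd). Qed.
Let p0 z : P z 0%N = 1. Proof. exact: Pz0. Qed.
Let p1 z : (a 0%N)%:C * P z 1%N = z - (b 0%N)%:C. Proof. exact: Pz1. Qed.
Let pS z : solves a b z (P z). Proof. exact: PzS. Qed.
Let q0 z : Q z 0%N = 0. Proof. exact: Qz0. Qed.
Let q1 z : (a 0%N)%:C * Q z 1%N = 1. Proof. exact: Qz1. Qed.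
Let qS z : solves a b z (Q z). Proof. exact: QzS. Qed.

Lemma csum_l2_ccvg (x y : nat -> C) : is_l2 x -> is_l2 y ->
  ccvg (psum (fun k => x k * y k)) (csum (fun k => x k * y k)).
Proof. by move=> /l2_bnd hx /l2_bnd hy; exact: prod_ccvg hx hy. Qed.

(** The summed Lagrange identity writes the Wronskian of solutions at z and at 0 as a partial sum of
    the series defining an entry, so each entry is a limit of Wronskians. Index n carries n + 1
    terms, whence the shift. *)
Lemma nev_gen_ccvg (x : nat -> C) (X : C -> nat -> C) (k z : C) (W : nat -> C) : is_l2 x -> is_l2 (X z) ->
  (forall n, W n = k + (z - 0) * \sum_(j < n.+1) X z j * x j) ->
  ccvg W (k + z * csum (fun n => x n * X z n)).
Proof.
move=> lx lX HW.
have h := ccvg_shift (csum_l2_ccvg lx lX).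
have := ccvgD (ccvg_cst k) (ccvgZ z h).
rewrite (_ : (fun n => _) = W)//; apply/funext => n; rewrite HW subr0; congr (_ + _ * _).
by apply: eq_bigr => j _; rewrite mulrC.
Qed.

Lemma nev_d_ccvg z : ccvg (fun n => wr n (P z) (P 0)) (nev_d s z).
Proof.
rewrite -[nev_d s z]add0r; apply: (@nev_gen_ccvg (P 0) P 0 z _ (@lP 0) (@lP z)) => n.
by rewrite (brk_PP p0 p1 pS) add0r.
Qed.
Lemma nev_b_ccvg z : ccvg (fun n => wr n (P z) (Q 0)) (nev_b s z).
Proof.
apply: (@nev_gen_ccvg (Q 0) P (-1) z _ (@lQ 0) (@lP z)) => n.
by rewrite (brk_PQ0 p0 pS q0 q1 qS).
Qed.
Lemma nev_c_ccvg z : ccvg (fun n => wr n (Q z) (P 0)) (nev_c s z).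
Proof.
apply: (@nev_gen_ccvg (P 0) Q 1 z _ (@lP 0) (@lQ z)) => n.
by rewrite (brk_QP p0 pS q0 q1 qS).
Qed.
Lemma nev_a_ccvg z : ccvg (fun n => wr n (Q z) (Q 0)) (nev_a s z).
Proof.
rewrite -[nev_a s z]add0r; apply: (@nev_gen_ccvg (Q 0) Q 0 z _ (@lQ 0) (@lQ z)) => n.
by rewrite (brk_QQ q0 qS) add0r.
Qed.

(** The inequality is asked at successors only, because the estimate [comb_ge] starts at index 1. *)
Lemma ccvg_lim_le (u v : nat -> C) (l m : C) (k : R) : ccvg u l -> ccvg v m ->
  (forall n, cmod (u n.+1) <= k * cmod (v n.+1)) -> cmod l <= k * cmod m.
Proof.
move=> /ccvg_shift/ccvg_cmod hu /ccvg_shift/ccvg_cmod hv H.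
have hkv : (fun n => k * cmod (v n.+1)) @ \oo --> k * cmod m.
  by apply: cvgM => //; exact: cvg_cst.
by apply: ler_cvg_to hu hkv _; exact: nearW.
Qed.

Local Notation KK := (KK s).

(** In [weyl_P] the left index is lowered to a fixed N, the right side goes to its limit in n, and
    only then N grows. *)
Lemma weyl_limit z : `|Im z| * KK z <= cmod (nev_b s z) * cmod (nev_d s z).
Proof.
have [->|iz] := eqVneq (Im z) 0; first by rewrite normr0 mul0r mulr_ge0 ?cmod_ge0.
have t0 : 0 < `|Im z| by rewrite normr_gt0.
have hb := ccvg_cmod (nev_b_ccvg z); have hd := ccvg_cmod (nev_d_ccvg z).
have hbd := cvgM hb hd.
rewrite (KKE s0 s_pd zb_im zb_bnd) mulrC -ler_pdivlMr//.
apply: (bnd_l2 (x := P z) _).2 => N.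
case: N => [|N]; first by rewrite /sq big_ord0 divr_ge0 ?mulr_ge0 ?cmod_ge0// ltW.
rewrite ler_pdivlMr// mulrC.
apply: (cvgr_to_ge (hbd _)); exists N => // n /= Nn.
apply: le_trans (weyl_P s0 s_pd n z); rewrite ler_wpM2l//.
by apply: sq_mono.
Qed.

Lemma nev_ab_le z : `|Im z| * cmod (nev_a s z) <= cmod (nev_b s z).
Proof.
have [->|iz] := eqVneq (Im z) 0; first by rewrite normr0 mul0r cmod_ge0.
have t0 : 0 < `|Im z| by rewrite normr_gt0.
rewrite mulrC -ler_pdivlMr// mulrC; apply: (ccvg_lim_le (nev_a_ccvg z) (nev_b_ccvg z)) => n.
rewrite mulrC ler_pdivlMr// mulrC; apply: (comb_le s0 s_pd).
exact: comb_null (Q0J s) (brk_QP00 s0 s_pd _).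
Qed.

Lemma nev_cd_le z : `|Im z| * cmod (nev_c s z) <= cmod (nev_d s z).
Proof.
have [->|iz] := eqVneq (Im z) 0; first by rewrite normr0 mul0r cmod_ge0.
have t0 : 0 < `|Im z| by rewrite normr_gt0.
rewrite mulrC -ler_pdivlMr// mulrC; apply: (ccvg_lim_le (nev_c_ccvg z) (nev_d_ccvg z)) => n.
rewrite mulrC ler_pdivlMr// mulrC; apply: (comb_le s0 s_pd).
exact: comb_null (P0J s) (brk_PQ00 s0 s_pd _).
Qed.

(** The constant of [comb_ge]. It grows like |z|^2, so it costs O(ln r) after taking logarithms. *)
Definition dist0 z : R := a 0%N ^+ 2 + cmod (z - (b 0%N)%:C) ^+ 2.

Lemma nev_ba_le z : `|Im z| * cmod (nev_b s z) <= dist0 z * cmod (nev_a s z).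
Proof.
have [->|iz] := eqVneq (Im z) 0.
  by rewrite normr0 mul0r mulr_ge0 ?cmod_ge0// addr_ge0// sqr_ge0.
have t0 : 0 < `|Im z| by rewrite normr_gt0.
rewrite mulrC -ler_pdivlMr// mulrAC; apply: (ccvg_lim_le (nev_b_ccvg z) (nev_a_ccvg z)) => n.
rewrite mulrAC ler_pdivlMr// mulrC; apply: (comb_ge s0 s_pd).
exact: comb_null (Q0J s) (brk_QP00 s0 s_pd _).
Qed.

Lemma nev_dc_le z : `|Im z| * cmod (nev_d s z) <= dist0 z * cmod (nev_c s z).
Proof.
have [->|iz] := eqVneq (Im z) 0.
  by rewrite normr0 mul0r mulr_ge0 ?cmod_ge0// addr_ge0// sqr_ge0.
have t0 : 0 < `|Im z| by rewrite normr_gt0.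
rewrite mulrC -ler_pdivlMr// mulrAC; apply: (ccvg_lim_le (nev_d_ccvg z) (nev_c_ccvg z)) => n.
rewrite mulrAC ler_pdivlMr// mulrC; apply: (comb_ge s0 s_pd).
exact: comb_null (P0J s) (brk_PQ00 s0 s_pd _).
Qed.

Lemma csum_l2_le (x y : nat -> C) : is_l2 x -> is_l2 y ->
  cmod (csum (fun k => x k * y k)) <= l2norm x * l2norm y.
Proof.
by move=> /l2_bnd hx /l2_bnd hy; apply: csum_prod_le => //; exact: l2norm_ge0.
Qed.

Definition rK z : R := l2norm (P z).

Lemma rK_ge1 z : 1 <= rK z.
Proof.
have := KK_ge1 s0 s_pd zb_im zb_bnd z; rewrite (KKE s0 s_pd zb_im zb_bnd) -/(rK z).
by rewrite -[X in X <= _](expr1n _ 2) ler_pXn2r ?nnegrE ?l2norm_ge0.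
Qed.

Lemma nev_d_le z : cmod (nev_d s z) <= (1 + cmod z * rK 0) * rK z.
Proof.
rewrite /nev_d cmodM mulrDl mul1r; apply: (@le_trans _ _ (cmod z * rK 0 * rK z)).
  by rewrite -mulrA ler_wpM2l ?cmod_ge0//; exact: (csum_l2_le (@lP 0) (@lP z)).
by rewrite lerDr (le_trans ler01)// rK_ge1.
Qed.

Lemma nev_b_le z : cmod (nev_b s z) <= (1 + cmod z * l2norm (Q 0)) * rK z.
Proof.
rewrite /nev_b; apply: le_trans (cmodD _ _) _; rewrite cmodN cmod1 mulrDl mul1r.
apply: lerD; first exact: rK_ge1.
rewrite cmodM -mulrA ler_wpM2l ?cmod_ge0//; exact: (csum_l2_le (@lQ 0) (@lP z)).
Qed.

(** Continuity of the entries makes their circle means of ln+ oriented integrals of continuous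
    functions. *)
Lemma csum_diff_ccont (x : nat -> C) (X : C -> nat -> C) (k : C) : is_l2 x -> l2_lip X ->
  ccont (fun z => k + z * csum (fun n => x n * X z n)).
Proof.
move=> lx HX.
have c1 z : ccont_at (fun z => csum (fun n => x n * X z n)) z.
  move=> e e0; have [K K0 HK] := HX (cmod z + 1).
  have D0 : 0 < l2norm x * K + 1 by rewrite ltr_wpDl// mulr_ge0 ?l2norm_ge0.
  exists (Num.min 1 (e / (l2norm x * K + 1))); first by rewrite lt_min ltr01 divr_gt0.
  move=> w; rewrite lt_min => /andP[w1 w2].
  have zr : cmod z <= cmod z + 1 by rewrite lerDl.
  have wr : cmod w <= cmod z + 1 by have := cmodD (w - z) z; rewrite subrK; lra.
  have [_ h] := HK z w zr wr; have [/nb_l2 lz _] := HK z w zr wr; have [/nb_l2 lw _] := HK w z wr zr.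
  have -> : csum (fun n => x n * X w n) - csum (fun n => x n * X z n) =
    csum (fun n => x n * (X w n - X z n)).
    have := csumD (csum_l2_ccvg lx (nb_l2 h)) (csum_l2_ccvg lx lz).
    rewrite (_ : (fun n => x n * (X w n - X z n) + x n * X z n) = (fun n => x n * X w n)).
      by move=> ->; rewrite addrK.
    by apply/funext => n; ring.
  apply: le_lt_trans (csum_l2_le lx (nb_l2 h)) _.
  rewrite ltr_pdivlMr// in w2; apply: le_lt_trans w2.
  apply: (@le_trans _ _ (l2norm x * (K * cmod (w - z)))).
    by rewrite ler_wpM2l ?l2norm_ge0// nb_l2norm.
  by rewrite mulrA mulrC ler_wpM2l ?cmod_ge0// lerDl.
move=> z e e0.
set g := (fun z => csum _) in c1.
pose A := cmod z + 1; pose B := cmod (g z) + 1.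
have A0 : 0 < A by rewrite ltr_wpDl ?cmod_ge0.
have B0 : 0 < B by rewrite ltr_wpDl ?cmod_ge0.
have [d1 d10 H1] := c1 z (e / 2 / A) (divr_gt0 (divr_gt0 e0 (ltr0n _ 2)) A0).
exists (Num.min (Num.min 1 d1) (e / 2 / B)); first by rewrite !lt_min ltr01 d10 !divr_gt0.
move=> w; rewrite !lt_min => /andP[/andP[w1 /H1 w2] w3].
rewrite (_ : _ - _ = w * (g w - g z) + (w - z) * g z); last by rewrite /g; ring.
have wA : cmod w <= A by have := cmodD (w - z) z; rewrite subrK /A; lra.
have b1 : cmod (w * (g w - g z)) <= e / 2.
  rewrite cmodM; apply: (@le_trans _ _ (A * cmod (g w - g z))); first by rewrite ler_wpM2r ?cmod_ge0.
  by rewrite mulrC -ler_pdivlMr// ltW.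
have b2 : cmod ((w - z) * g z) < e / 2.
  rewrite cmodM; apply: (@le_lt_trans _ _ (cmod (w - z) * B)).
    by rewrite ler_wpM2l ?cmod_ge0// lerDl.
  by rewrite -ltr_pdivlMr.
by apply: le_lt_trans (cmodD _ _) _; lra.
Qed.

Lemma lip_Q : l2_lip Q.
Proof.
move=> r; have [M M0 HM] := lnb r.
exists (M + 2 * M ^+ 2 * M); first by rewrite addr_ge0// !mulr_ge0// sqr_ge0.
have h0 : 0 <= 2 * M ^+ 2 * M by rewrite !mulr_ge0// sqr_ge0.
move=> z w zr wr; have [bP bQ] := HM z zr; have [_ bQw] := HM w wr.
split; first by apply: nb_le bQ; lra.
have := nbZ (w - z) (green_op_nb bP bQ bQw).
rewrite (_ : (fun k => _) = (fun k => Q w k - Q z k)); last first.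
  by apply/funext => k; rewrite (green_op_Q (a_gt0 s_pd) p0 pS q0 q1 qS).
by apply: nb_le; rewrite mulrC ler_wpM2r ?cmod_ge0//; lra.
Qed.

Lemma nev_ccont (f : C -> C) :
  f = nev_a s \/ f = nev_b s \/ f = nev_c s \/ f = nev_d s -> ccont f.
Proof.
have sP := smooth_lip (smooth_P s0 s_pd zb_im zb_bnd).
have z0 (g h : C -> C) : (forall z, g z = h z) -> ccont g -> ccont h.
  by move=> gh; rewrite (_ : g = h)//; apply/funext.
move=> [->|[->|[->|->]]].
- apply: z0 (csum_diff_ccont 0 (@lQ 0) lip_Q) => z; by rewrite add0r.
- exact: (csum_diff_ccont (-1) (@lQ 0) sP).
- exact: (csum_diff_ccont 1 (@lP 0) lip_Q).
- apply: z0 (csum_diff_ccont 0 (@lP 0) sP) => z; by rewrite add0r.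
Qed.

End NevanlinnaEntries.

(** * Circle means of ln+ of the entries and of ln K *)

Section NevanlinnaComparison.
Context {R : realType}.
Local Notation C := R[i].
Variable s : nat -> R.
Hypothesis s0 : s 0%N = 1.
Hypothesis s_pd : positive_definite_seq s.
Variables (zb : C) (Ab : R).
Hypothesis zb_im : Im zb != 0.
Hypothesis zb_bnd : bnd (Pz s zb) Ab.
Implicit Types (z w : C) (f g : C -> C) (r : R).

(** The maximum is taken inside the logarithm, so that continuity persists through the zeros of
    f. *)
Definition log_plus f z : R := ln (Num.max 1 (cmod (f z))).

Let max1 (x : R) : 0 < Num.max 1 x. Proof. by rewrite lt_max ltr01. Qed.

Lemma ccontR_log_plus f : ccont f -> ccontR (log_plus f).
Proof.
move=> cf z.
have c : {for Num.max 1 (cmod (f z)), continuous (@ln R)} by exact: continuous_ln.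
move=> e e0; move/cvgrPdist_lt: c => /(_ e e0)[d /= d0 Hd].
have [d' d'0 Hd'] := cf z d d0; exists d' => // w /Hd' wz.
rewrite distrC; apply: Hd => /=.
apply: le_lt_trans wz.
have h1 := cmod_triB (f w) (f z); have h2 := cmod_triB (f z) (f w).
rewrite [cmod (f z - f w)]cmodC in h2.
rewrite ler_norml /Num.max; case: ltP => ?; case: ltP => ?; lra.
Qed.

Lemma cont_log_plus f r : ccont f -> continuous (fun phi => log_plus f (cis r phi)).
Proof. by move=> /ccontR_log_plus; exact: cont_cis. Qed.

Definition mean_log_plus f r : R := RI (fun phi => log_plus f (cis r phi)) 0 (pi *+ 2).

Lemma nevanlinna_charE f r : nevanlinna_char f r = (pi *+ 2)^-1 * mean_log_plus f r.
Proof.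
have p0 : 0 <= (pi : R) *+ 2 by rewrite mulrn_wge0// pi_ge0.
rewrite /nevanlinna_char /mean_log_plus RI_le// mulr_natl; congr (_ * _).
apply: eq_Rintegral => phi _.
have -> : r%:C * (cos phi +i* sin phi) = cis r phi by apply: ceqP; rewrite !cE /=; ring.
rewrite /log_plus; move: (cmod _) => x.
rewrite /Num.max; case: (ltP 1 x) => x1; case: ltP => lx; rewrite ?ln1//.
  by apply/eqP; rewrite eq_le lx ln_ge0// ltW.
by move: (le_lt_trans (ln_le0 x1) lx); rewrite ltxx.
Qed.

Lemma im_cis_ge r phi : 1 <= r -> `|sin phi| <= `|Im (cis r phi)|.
Proof. by move=> r1; rewrite /= normrM ler_peMl// ger0_norm// (le_trans ler01). Qed.

(** For r >= 1 one has |Im z| = r |sin phi| >= |sin phi| on the circle, so dividing by |Im z| costs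
    at most the integral of -ln |sin|, independently of r. *)
Lemma mean_log_plus_sin_le f g r (D : R) : ccont f -> ccont g -> 1 <= r -> 1 <= D ->
  (forall z, cmod z = r -> `|Im z| * cmod (f z) <= D * cmod (g z)) ->
  mean_log_plus f r <= mean_log_plus g r + pi *+ 2 * ln D + pi *+ 2.
Proof.
move=> cf cg r1 D1 H.
have D0 : 0 < D by exact: lt_le_trans D1.
have cc : continuous (fun _ : R => ln D) by exact: cont_cst.
rewrite /mean_log_plus; have -> : pi *+ 2 * ln D = RI (fun=> ln D) 0 (pi *+ 2) by rewrite RI_cst subr0 mulrC.
rewrite -RID//; last exact: cont_log_plus.
apply: mean_logsin; first exact: cont_log_plus.
  by apply: contD => //; exact: cont_log_plus.
move=> phi sp; have t0 : 0 < `|sin phi| by rewrite normr_gt0.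
rewrite lerBrDr -lnM ?posrE// -lnM ?posrE// ler_ln ?posrE ?mulr_gt0//.
set z := cis r phi.
have zr : cmod z = r by rewrite cmod_cis// (le_trans ler01).
have := H z zr; have := im_cis_ge phi r1; rewrite -/z => h1 h2.
have g0 : 0 <= cmod (g z) by rewrite cmod_ge0.
have f0 : 0 <= cmod (f z) by rewrite cmod_ge0.
have h3 : cmod (f z) * `|sin phi| <= cmod (g z) * D.
  by rewrite [_ * D]mulrC; apply: le_trans h2; rewrite mulrC ler_wpM2r.
have t1 : `|sin phi| <= 1 by exact: sin_max.
have m1 : 1 <= Num.max 1 (cmod (g z)) by rewrite le_max lexx.
have m2 : cmod (g z) <= Num.max 1 (cmod (g z)) by rewrite le_max lexx orbT.
have h4 : 1 * 1 <= Num.max 1 (cmod (g z)) * D by exact: ler_pM.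
have h5 : cmod (g z) * D <= Num.max 1 (cmod (g z)) * D by rewrite ler_wpM2r// ltW.
rewrite {1}/Num.max; case: ifP => _; lra.
Qed.

Local Notation KK := (KK s).
Local Notation LK := (logK s).
Local Notation rk := (rK s).
Definition mean_logK r : R := RI (fun phi => LK (cis r phi)) 0 (pi *+ 2).

Let ccR_logK : ccontR LK.
Proof. exact: rdiff_ccontR (rdiff_logK s0 s_pd zb_im zb_bnd). Qed.
Let cont_logK r : continuous (fun phi => LK (cis r phi)).
Proof. exact: cont_cis. Qed.
Let rK1 z : 1 <= rk z. Proof. exact: (rK_ge1 s0 s_pd zb_im zb_bnd). Qed.

Lemma logKE z : LK z = ln (rk z) *+ 2.
Proof.
rewrite /logK (KKE s0 s_pd zb_im zb_bnd) lnXn// /rK.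
exact: lt_le_trans (rK1 z).
Qed.

Lemma log_plus_le f (c : R) z : 0 <= c -> cmod (f z) <= (1 + cmod z * c) * rk z ->
  log_plus f z <= ln (1 + cmod z * c) + 2^-1 * LK z.
Proof.
move=> c0 H; rewrite logKE -[ln (rk z) *+ 2]mulr_natl mulKf ?pnatr_eq0//.
have A1 : 1 <= 1 + cmod z * c by rewrite lerDl mulr_ge0 ?cmod_ge0.
have A0 := lt_le_trans ltr01 A1; have r0 := lt_le_trans ltr01 (rK1 z).
rewrite -lnM ?posrE// ler_ln ?posrE ?mulr_gt0// ge_max H andbT.
by rewrite -[X in X <= _](mulr1 1); exact: ler_pM.
Qed.

Lemma mean_log_plus_le f (c : R) r : ccont f -> 0 <= c -> 0 <= r ->
  (forall z, cmod (f z) <= (1 + cmod z * c) * rk z) ->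
  mean_log_plus f r <= pi *+ 2 * ln (1 + r * c) + 2^-1 * mean_logK r.
Proof.
move=> cf c0 r0 H.
have cc : continuous (fun _ : R => ln (1 + r * c)) by exact: cont_cst.
have ch : continuous (fun phi => 2^-1 * LK (cis r phi)).
  by apply: contM => //; exact: cont_cst.
rewrite /mean_log_plus /mean_logK; set l := ln _.
have -> : pi *+ 2 * l = RI (fun=> l) 0 (pi *+ 2) by rewrite RI_cst subr0 mulrC.
rewrite -RIZ// -RID//.
apply: le_RI; [by rewrite mulrn_wge0// pi_ge0|exact: cont_log_plus|exact: contD|move=> phi _].
by have := log_plus_le c0 (H (cis r phi)); rewrite cmod_cis.
Qed.

Let cca : ccont (nev_a s). Proof. by apply: (nev_ccont s0 s_pd zb_im zb_bnd); left. Qed.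
Let ccb : ccont (nev_b s). Proof. by apply: (nev_ccont s0 s_pd zb_im zb_bnd); right; left. Qed.
Let ccc : ccont (nev_c s). Proof. by apply: (nev_ccont s0 s_pd zb_im zb_bnd); right; right; left. Qed.
Let ccd : ccont (nev_d s). Proof. by apply: (nev_ccont s0 s_pd zb_im zb_bnd); do 3 right. Qed.

(** The logarithm of the Weyl disc bound, with |Im z| again replaced by |sin phi|. *)
Lemma mean_logK_le r : 1 <= r ->
  mean_logK r <= mean_log_plus (nev_b s) r + mean_log_plus (nev_d s) r + pi *+ 2.
Proof.
move=> r1; rewrite /mean_log_plus -RID; [|exact: cont_log_plus|exact: cont_log_plus].
apply: mean_logsin => //; first by apply: contD; exact: cont_log_plus.
move=> phi sp; have t0 : 0 < `|sin phi| by rewrite normr_gt0.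
have K0 := KK_gt0 s0 s_pd zb_im zb_bnd (cis r phi).
rewrite lerBrDr /logK /log_plus -!lnM ?posrE// ler_ln ?posrE ?mulr_gt0//.
have := weyl_limit s0 s_pd zb_im zb_bnd (cis r phi); have := im_cis_ge phi r1.
move=> h1 h2; apply: (@le_trans _ _ (cmod (nev_b s (cis r phi)) * cmod (nev_d s (cis r phi)))).
  by apply: le_trans h2; rewrite mulrC ler_wpM2r// ltW.
by apply: ler_pM; rewrite ?cmod_ge0// le_max lexx orbT.
Qed.

Lemma dist0_le z : dist0 s z <= 1 + jacobi_a s 0 ^+ 2 + (cmod z + `|jacobi_b s 0|) ^+ 2.
Proof.
rewrite /dist0 -addrA -[X in X <= _]add0r lerD// lerD2l.
rewrite ler_pXn2r ?nnegrE ?addr_ge0 ?cmod_ge0//.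
by apply: le_trans (cmodB _ _) _; rewrite lerD2l cmod_rc.
Qed.

(** The linear bookkeeping for all four entries at once: ma, mb, mc, md are their means of ln+, L is
    that of ln K, p is 2 pi and u is 2 pi ln r. The upper bound on one of mb, md gives the lower
    bound on the other through L <= mb + md + p; ma and mc follow by comparison. *)
Lemma mean_arith (p u v w B E L ma mb mc md m : R) :
  p <= u -> 0 <= v -> 0 <= w -> B <= u + v -> 0 <= E -> E <= 2 * u + w -> 0 <= p ->
  m = ma \/ m = mb \/ m = mc \/ m = md ->
  mb <= B + 2^-1 * L -> md <= B + 2^-1 * L -> L <= mb + md + p ->
  ma <= mb + p -> mc <= md + p -> mb <= ma + E + p -> md <= mc + E + p ->
  `|m - 2^-1 * L| <= 5 * u + v + w.
Proof.
move=> *; rewrite ler_norml.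
by match goal with H : _ \/ _ |- _ => case: H => [->|[->|[->|->]]] end; apply/andP; split; lra.
Qed.

Lemma characteristic_compare f :
  f = nev_a s \/ f = nev_b s \/ f = nev_c s \/ f = nev_d s ->
  exists c : R, forall r, expR 1 <= r ->
    `|(4 * pi)^-1 * (mean_logK r - pi *+ 2 * LK 0) - nevanlinna_char f r| <= c * ln r.
Proof.
move=> Hf.
pose c := rk 0 + l2norm (Qz s 0).
have c0 : 0 <= c by rewrite addr_ge0 ?l2norm_ge0.
pose D0 := 1 + jacobi_a s 0 ^+ 2 + (1 + `|jacobi_b s 0|) ^+ 2.
have D01 : 1 <= D0 by rewrite /D0 -addrA lerDl addr_ge0// sqr_ge0.
(* From r = e on one has ln r >= 1, so every constant can be charged to ln r. *)
exists (5 + ln (1 + c) + ln D0 + `|LK 0|) => r re.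
have e1 : (1 : R) <= expR 1 by rewrite -expR0 ler_expR.
have r1 : 1 <= r by exact: le_trans e1 re.
have r0 : 0 < r by exact: lt_le_trans r1.
have lr : 1 <= ln r by rewrite -[X in X <= _]expRK ler_ln ?posrE// expR_gt0.
set p : R := pi *+ 2.
have p0 : 0 < p by rewrite mulrn_wgt0// pi_gt0.
pose D := 1 + jacobi_a s 0 ^+ 2 + (r + `|jacobi_b s 0|) ^+ 2.
have D1 : 1 <= D by rewrite /D -addrA lerDl addr_ge0// sqr_ge0.
have Dp := lt_le_trans ltr01 D1; have D0p := lt_le_trans ltr01 D01.
have lD0 : 0 <= ln D0 by exact: ln_ge0.
have lc0 : 0 <= ln (1 + c) by apply: ln_ge0; rewrite lerDl.
have lD : ln D <= 2 * ln r + ln D0.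
  rewrite mulr_natl -lnXn// -lnM ?posrE ?exprn_gt0// ler_ln ?posrE ?mulr_gt0 ?exprn_gt0//.
  rewrite /D /D0 mulrDr; apply: lerD.
    apply: ler_peMl; first by rewrite addr_ge0// sqr_ge0.
    by rewrite exprn_ege1.
  have b0 : 0 <= `|jacobi_b s 0| by [].
  have rb : 0 <= r + `|jacobi_b s 0| by lra.
  have h : r + `|jacobi_b s 0| <= r * (1 + `|jacobi_b s 0|).
    by rewrite mulrDr mulr1 lerD2l ler_peMl.
  by rewrite -exprMn ler_pXn2r ?nnegrE// (le_trans rb h).
have lrho : ln (1 + r * c) <= ln r + ln (1 + c).
  have c1 : 0 < 1 + c by lra.
  have rc : 0 <= r * c by rewrite mulr_ge0// ltW.
  have rc1 : 0 < 1 + r * c by lra.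
  rewrite -lnM ?posrE// ler_ln ?posrE ?mulr_gt0//.
  by rewrite [r * (1 + c)]mulrDr mulr1 lerD2r.
set L := mean_logK r.
have mle g (c' : R) : ccont g -> 0 <= c' -> c' <= c -> (forall z, cmod (g z) <= (1 + cmod z * c') * rk z) ->
    mean_log_plus g r <= p * ln (1 + r * c) + 2^-1 * L.
  move=> cg c'0 c'c H; apply: mean_log_plus_le => // [|z]; first exact: ltW.
  apply: le_trans (H z) _; rewrite ler_wpM2r ?l2norm_ge0//.
  by rewrite lerD2l ler_wpM2l ?cmod_ge0.
have hb : mean_log_plus (nev_b s) r <= p * ln (1 + r * c) + 2^-1 * L.
  apply: mle (nev_b_le s0 s_pd zb_im zb_bnd) => //; first exact: l2norm_ge0.
  by rewrite lerDr l2norm_ge0.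
have hd : mean_log_plus (nev_d s) r <= p * ln (1 + r * c) + 2^-1 * L.
  apply: mle (nev_d_le s0 s_pd zb_im zb_bnd) => //; first exact: l2norm_ge0.
  by rewrite lerDl l2norm_ge0.
have hL := mean_logK_le r1.
have dD z : cmod z = r -> dist0 s z <= D by move=> zr; apply: le_trans (dist0_le z) _; rewrite zr.
have w f1 g1 : (forall z, `|Im z| * cmod (f1 z) <= cmod (g1 z)) ->
    ccont f1 -> ccont g1 -> mean_log_plus f1 r <= mean_log_plus g1 r + p.
  move=> H cf cg; have := @mean_log_plus_sin_le f1 g1 r 1 cf cg r1 (lexx _).
  by rewrite ln1 mulr0 addr0; apply => z _; rewrite mul1r.
have w' f1 g1 : (forall z, `|Im z| * cmod (f1 z) <= dist0 s z * cmod (g1 z)) ->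
    ccont f1 -> ccont g1 -> mean_log_plus f1 r <= mean_log_plus g1 r + p * ln D + p.
  move=> H cf cg; apply: mean_log_plus_sin_le => // z zr.
  by apply: le_trans (H z) _; rewrite ler_wpM2r ?cmod_ge0// dD.
have hab := w _ _ (nev_ab_le s0 s_pd zb_im zb_bnd) cca ccb.
have hcd := w _ _ (nev_cd_le s0 s_pd zb_im zb_bnd) ccc ccd.
have hba := w' _ _ (nev_ba_le s0 s_pd zb_im zb_bnd) ccb cca.
have hdc := w' _ _ (nev_dc_le s0 s_pd zb_im zb_bnd) ccd ccc.
have key : `|mean_log_plus f r - 2^-1 * L| <= 5 * (p * ln r) + p * ln (1 + c) + p * ln D0.
  apply: (@mean_arith p _ _ _ (p * ln (1 + r * c)) (p * ln D) L _ _ _ _ _ _ _ _ _ _ _ _ _ hb hd hL hab hcd hba hdc).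
  - by rewrite ler_peMr// ltW.
  - by rewrite mulr_ge0// ltW.
  - by rewrite mulr_ge0// ltW.
  - by rewrite -mulrDr ler_pM2l.
  - by rewrite mulr_ge0 ?ln_ge0// ltW.
  - by rewrite mulrCA -mulrDr ler_pM2l.
  - exact: ltW.
  - by case: Hf => [->|[->|[->|->]]]; [left|right; left|right; right; left|do 3 right].
rewrite mulrCA -!mulrDr in key.
have pE : (4 * pi : R) = 2 * p by rewrite /p -[pi *+ 2]mulr_natl mulrA -natrM.
have -> : (4 * pi)^-1 * (L - p * LK 0) - nevanlinna_char f r =
    - (p^-1 * (mean_log_plus f r - 2^-1 * L)) - 2^-1 * LK 0.
  have pn0 : p != 0 by rewrite gt_eqF.
  rewrite nevanlinna_charE -/p pE; clearbody L p; move: (mean_log_plus _ _) (LK 0) => M l0.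
  by field.
apply: le_trans (ler_normD _ _) _; rewrite !normrN !normrM.
rewrite (ger0_norm (ltW (_ : 0 < p^-1))) ?invr_gt0//.
have k1 : p^-1 * `|mean_log_plus f r - 2^-1 * L| <= 5 * ln r + ln (1 + c) + ln D0.
  by rewrite ler_pdivrMl.
have k2 : `|LK 0| <= `|LK 0| * ln r by rewrite ler_peMr.
have k3 : ln (1 + c) <= ln (1 + c) * ln r by rewrite ler_peMr.
have k4 : ln D0 <= ln D0 * ln r by rewrite ler_peMr.
have k5 : `|2^-1 : R| * `|LK 0| <= `|LK 0|.
  by rewrite ler_piMl// ger0_norm ?invr_ge0// invf_le1// ler1n.
apply: le_trans (lerD k1 (le_trans k5 k2)) _.
move: k3 k4; move: (ln (1 + c)) (ln D0) (ln r) `|LK 0| => x y l u k3 k4.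
by rewrite !mulrDl lerD2r; apply: lerD => //; rewrite lerD2l.
Qed.

End NevanlinnaComparison.

(** * The characteristic line bundle *)

Section DeficiencySpace.
Context {R : realType}.
Local Notation C := R[i].
Variable s : nat -> R.
Hypothesis s0 : s 0%N = 1.
Hypothesis s_pd : positive_definite_seq s.
Local Notation a := (jacobi_a s).
Local Notation b := (jacobi_b s).
Local Notation P := (Pz s).
Implicit Types (z c : C) (x y : nat -> C).

Lemma fin_l2 x m : (forall k, (m <= k)%N -> x k = 0) -> is_l2 x.
Proof.
move=> H; have [] // := @bnd_l2 _ x (sq m x) _.
move=> N; case: (leqP N m) => [|/ltnW] mN; first exact: sq_mono.
rewrite -(subnKC mN); elim: (N - m)%N => [|d IH]; first by rewrite addn0.
by rewrite addnS sqS H ?leq_addr// cmod0 expr0n addr0.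
Qed.

Lemma l2ipDl x x' y : is_l2 x -> is_l2 x' -> is_l2 y ->
  l2ip (fun k => x k + x' k) y = l2ip x y + l2ip x' y.
Proof.
move=> lx lx' ly; rewrite -(csumD (l2ip_ccvg lx ly) (l2ip_ccvg lx' ly)) /l2ip.
by congr csum; apply/funext => k; rewrite mulrDl.
Qed.

Lemma l2ip_sum N (c : nat -> C) (f : nat -> nat -> C) y :
  (forall n, is_l2 (f n)) -> is_l2 y ->
  is_l2 (fun k => \sum_(n < N) c n * f n k) /\
  l2ip (fun k => \sum_(n < N) c n * f n k) y = \sum_(n < N) c n * l2ip (f n) y.
Proof.
move=> lf ly; elim: N => [|N [IH1 IH2]].
  have E : (fun k => \sum_(n < 0) c n * f n k) = (fun=> 0).
    by apply/funext => k; rewrite big_ord0.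
  rewrite E; split; first exact: (@fin_l2 _ 0).
  by rewrite big_ord0 /l2ip (csum_finite (n := 0)) /psum ?big_ord0// => k _; rewrite mul0r.
have E : (fun k => \sum_(n < N.+1) c n * f n k) =
    (fun k => (\sum_(n < N) c n * f n k) + c N * f N k).
  by apply/funext => k; rewrite big_ord_recr.
have lN := l2Z (c := c N) (@lf N).
rewrite E; split; first exact: l2D.
by rewrite (l2ipDl IH1 lN ly) IH2 (l2ipZ _ (@lf N) ly) big_ord_recr.
Qed.

Lemma e_diag n : @e_ R n n = 1. Proof. by rewrite /e_ eqxx. Qed.
Lemma e_off n k : (k != n)%N -> @e_ R n k = 0. Proof. by rewrite /e_ => /negbTE ->. Qed.

Lemma l2_e n : is_l2 (@e_ R n).
Proof. by apply: (@fin_l2 _ n.+1) => k nk; rewrite e_off// gtn_eqF. Qed.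

Lemma l2ip_e n y : l2ip (e_ n) y = (y n)^*%C.
Proof.
rewrite /l2ip (csum_finite (n := n.+1)) => [|k nk]; last by rewrite e_off ?mul0r// gtn_eqF.
rewrite /psum big_ord_recr big1 => [|k _]; last by rewrite /= e_off ?mul0r// ltn_eqF.
by rewrite /= e_diag mul1r add0r.
Qed.

Lemma l2_jacobi_e n : is_l2 (jacobi_e s n).
Proof.
apply: (@fin_l2 _ n.+2) => k nk; have nk1 := ltnW nk.
rewrite /jacobi_e !e_off ?gtn_eqF// !mulr0 !add0r.
by case: n nk nk1 => // m mk mk1; rewrite e_off ?mulr0// gtn_eqF// ltnW.
Qed.

Lemma l2ip_jacobi_e n y : is_l2 y -> l2ip (jacobi_e s n) y =
  (a n)%:C * (y n.+1)^*%C + (b n)%:C * (y n)^*%C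
  + (if n is m.+1 then (a m)%:C * (y m)^*%C else 0).
Proof.
move=> ly.
have le k c := l2Z (c := c) (@l2_e k).
have ip k c : l2ip (fun j => c * e_ k j) y = c * (y k)^*%C by rewrite l2ipZ ?l2ip_e//; exact: l2_e.
case: n => [|m].
  rewrite (_ : jacobi_e s 0 = fun k => (a 0)%:C * e_ 1 k + (b 0)%:C * e_ 0 k).
    by rewrite l2ipDl// !ip addr0.
  by apply/funext => k; rewrite /jacobi_e addr0.
rewrite (_ : jacobi_e s m.+1 = fun k => ((a m.+1)%:C * e_ m.+2 k + (b m.+1)%:C * e_ m.+1 k)
   + (a m)%:C * e_ m k)//.
by rewrite l2ipDl ?l2ipDl ?ip//; exact: l2D.
Qed.

Lemma closure_mem (G : l2graph) x y : G (x, y) -> is_l2 x -> is_l2 y -> closure_graph G (x, y).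
Proof.
move=> Gxy lx ly; split => // e e0; exists (x, y); split => //=.
- apply: le_lt_trans e0; apply: (nb_l2norm (A := 0)); split => // N.
  by rewrite /sq big1 ?expr0n// => k _; rewrite /= subrr cmod0 expr0n.
- apply: le_lt_trans e0; apply: (nb_l2norm (A := 0)); split => // N.
  by rewrite /sq big1 ?expr0n// => k _; rewrite /= subrr cmod0 expr0n.
Qed.

Lemma jacobi_fin_e n : jacobi_fin s (e_ n, jacobi_e s n).
Proof.
exists n.+1, (fun k => (k == n)%:R) => /=.
have H (f : nat -> nat -> C) k : f n k = \sum_(j < n.+1) (val j == n)%:R * f j k.
  rewrite big_ord_recr big1 => [|j _]; last by rewrite /= ltn_eqF// mul0r.
  by rewrite /= eqxx mul1r add0r.
by split; apply/funext => k; [exact: H e_ k|exact: H (jacobi_e s) k].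
Qed.

(** The adjoint relation is tested on the basis vectors, which lie in the graph of the closed
    operator. *)
Lemma fiberE_recurrence z x : fiberE (jacobi_op s) z x -> is_l2 x /\ forall n,
  (a n)%:C * x n.+1 + (b n)%:C * x n + (if n is m.+1 then (a m)%:C * x m else 0) = z * x n.
Proof.
move=> [lx _ H]; split => // n.
have := H (e_ n, jacobi_e s n) (closure_mem (jacobi_fin_e n) (@l2_e n) (@l2_jacobi_e n)).
rewrite /= l2ip_e l2ip_jacobi_e// => /(congr1 (fun w => w^*%C)).
rewrite conjcK => <-; rewrite !cconjD !cconjM !cconjR !conjcK.
by case: n => [|m]; rewrite ?cconjM ?cconjR ?conjcK// conjc0.
Qed.

(** Subtracting x_0 P_z leaves a solution of the homogeneous equation in all rows with initial value
    0, which vanishes by uniqueness. *)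
Lemma fiberE_P z x : fiberE (jacobi_op s) z x -> x = (fun n => x 0%N * P z n).
Proof.
move=> /fiberE_recurrence[_ H]; apply/funext => n; apply/eqP; rewrite -subr_eq0; apply/eqP.
apply: (@vsolves_unique _ a b (a_gt0 s_pd) z (fun=> 0) (fun n => x n - x 0%N * P z n) (fun=> 0)); last first.
  by split; rewrite ?mulr0// => m; rewrite !mulr0 !addr0.
split; first by rewrite (Pz0 s0) mulr1 subrr.
- have := H 0%N => /=; rewrite addr0 => h; rewrite mulrBr mulrCA (Pz1 s0 s_pd).
  have -> : (a 0)%:C * x 1 = z * x 0%N - (b 0)%:C * x 0%N by rewrite -h addrK.
  ring.
- move=> m; have := H m.+1; have := PzS s_pd z m => /= h1 h2.
  have -> : z * (x m.+1 - x 0%N * P z m.+1) = z * x m.+1 - x 0%N * (z * P z m.+1) by ring.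
  by rewrite -h2 h1; ring.
Qed.

Lemma jacobi_fin_adjoint z x u v : is_l2 x -> (forall n,
    (a n)%:C * x n.+1 + (b n)%:C * x n + (if n is m.+1 then (a m)%:C * x m else 0) = z * x n) ->
  jacobi_fin s (u, v) -> [/\ is_l2 u, is_l2 v & l2ip v x = l2ip u (fun n => z * x n)].
Proof.
move=> lx H [N [c [/= -> ->]]].
have lz := l2Z (c := z) lx.
have [h1 h2] := @l2ip_sum N c e_ _ (@l2_e) lz.
have [h3 h4] := @l2ip_sum N c (jacobi_e s) _ (@l2_jacobi_e) lx.
split => //; rewrite h2 h4; apply: eq_bigr => n _; congr (_ * _).
rewrite l2ip_e l2ip_jacobi_e// -H !cconjD !cconjM !cconjR.
by case: (nat_of_ord n) => [|m]; rewrite ?conjc0// cconjM cconjR.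
Qed.

Lemma recurrence_fiberE z x : is_l2 x -> (forall n,
    (a n)%:C * x n.+1 + (b n)%:C * x n + (if n is m.+1 then (a m)%:C * x m else 0) = z * x n) ->
  fiberE (jacobi_op s) z x.
Proof.
move=> lx H; have lz := l2Z (c := z) lx; split => //= -[u v] [/= lu lv Huv].
apply/eqP; rewrite -subr_eq0 -cmod_eq0; apply/negPn/negP => n0.
set D := l2ip v x - _ in n0.
have D0 : 0 < cmod D by rewrite lt_neqAle eq_sym n0 cmod_ge0.
(* M exceeds the sum of the norms of x and z x, so an approximation within |D| / M would bound the
   defect D by less than |D|. *)
pose M := l2norm x + l2norm (fun n => z * x n) + 1.
have M0 : 0 < M by rewrite ltr_wpDl// addr_ge0 ?l2norm_ge0.
have [[u' v'] [/= /(jacobi_fin_adjoint lx H)[lu' lv' E] hu hv]] := Huv _ (divr_gt0 D0 M0).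
have ldu := l2B lu lu'; have ldv := l2B lv lv'.
have Ev : l2ip v x = l2ip (v \- v') x + l2ip v' x.
  by rewrite -l2ipDl//; congr (l2ip _ x); apply/funext => k /=; rewrite subrK.
have Eu : l2ip u (fun n => z * x n) = l2ip (u \- u') (fun n => z * x n) + l2ip u' (fun n => z * x n).
  by rewrite -l2ipDl//; congr (l2ip _ _); apply/funext => k /=; rewrite subrK.
have DE : D = l2ip (v \- v') x - l2ip (u \- u') (fun n => z * x n).
  by rewrite /D Ev Eu E; ring.
have h1 := l2ip_le ldv lx; have h2 := l2ip_le ldu lz.
have h3 : l2norm (v \- v') * l2norm x <= cmod D / M * l2norm x.
  by rewrite ler_wpM2r ?l2norm_ge0// ltW.
have h4 : l2norm (u \- u') * l2norm (fun n => z * x n) <= cmod D / M * l2norm (fun n => z * x n).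
  by rewrite ler_wpM2r ?l2norm_ge0// ltW.
have h5 : cmod D <= cmod D / M * (M - 1).
  have := cmodB (l2ip (v \- v') x) (l2ip (u \- u') (fun n => z * x n)); rewrite -DE => h.
  rewrite /M addrK mulrDr; apply: le_trans h _; apply: lerD.
    exact: le_trans h1 h3.
  exact: le_trans h2 h4.
have : cmod D / M * (M - 1) < cmod D.
  by rewrite mulrAC ltr_pdivrMr// ltr_pM2l// ltrBlDr ltrDl.
by rewrite ltNge h5.
Qed.

End DeficiencySpace.

(** * P as a holomorphic section of E *)

Section CharacteristicFibre.
Context {R : realType}.
Local Notation C := R[i].
Variable s : nat -> R.
Hypothesis s0 : s 0%N = 1.
Hypothesis s_pd : positive_definite_seq s.
Variables (zb : C) (Ab : R).
Hypothesis zb_im : Im zb != 0.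
Hypothesis zb_bnd : bnd (Pz s zb) Ab.
Local Notation P := (Pz s).
Local Notation T := (jacobi_op s).
Implicit Types (z c : C) (x : nat -> C).

Lemma fiberE_ZP z c : fiberE T z (fun n => c * P z n).
Proof.
apply: recurrence_fiberE; first by apply: l2Z; exact: (l2P s0 s_pd zb_im zb_bnd).
case=> [|m].
  have h := Pz1 s0 s_pd z; rewrite addr0 mulrCA h (Pz0 s0); ring.
by rewrite [z * _]mulrCA (PzS s_pd z m); ring.
Qed.

Lemma holomorphic_P (U : set C) : holomorphic_section_E T U P.
Proof.
split=> [z _|z _].
  by have := fiberE_ZP z 1; under eq_fun do rewrite mul1r.
have lP := l2P s0 s_pd zb_im zb_bnd.
split; first exact: lP.
exists (dPz s z); first exact: (l2dPz s0 s_pd zb_im zb_bnd).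
have [K K0 HK] := smooth_P s0 s_pd zb_im zb_bnd (cmod z + 1).
apply/cvgrPdist_lt => e e0; rewrite near_withinE; apply/nbhs_cP.
exists (Num.min 1 (e / (K + 1))); first by rewrite lt_min ltr01 divr_gt0// ltr_wpDl.
move=> h; rewrite subr0 lt_min => /andP[h1 h2] h0; rewrite sub0r normrN ger0_norm ?l2norm_ge0//.
have zr : cmod z <= cmod z + 1 by rewrite lerDl.
have wr : cmod (z + h) <= cmod z + 1 by have := cmodD z h; lra.
have [_ _ _ n4] := HK z (z + h) zr wr.
have E : z + h - z = h by rewrite addrAC subrr add0r.
rewrite E in n4; have := nbZ h^-1 n4.
rewrite (_ : (fun k => _) = (fun n => h^-1 * (P (z + h) n - P z n) - dPz s z n)); last first.
  by apply/funext => k; rewrite [in LHS]mulrBr mulrA mulVf// mul1r.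
move/nb_l2norm => n5; apply: (le_lt_trans n5).
have hp : 0 < cmod h by rewrite cmod_gt0.
have -> : cmod h^-1 * (K * cmod h ^+ 2) = K * cmod h.
  rewrite cmodV; move: (cmod h) hp => u u0; field; by rewrite gt_eqF.
rewrite ltr_pdivlMr ?ltr_wpDl// in h2; apply: le_lt_trans h2.
by rewrite mulrC ler_wpM2l ?cmod_ge0// lerDl.
Qed.

End CharacteristicFibre.

(** * Wirtinger derivatives of logarithms of norms *)

Section Wirtinger.
Context {R : realType}.
Local Notation C := R[i].
Implicit Types (F G : C -> R) (z w l : C) (g : C -> C).

Lemma rdiff_near F G z (a b : R) :
  (exists2 d : R, 0 < d & forall w, cmod (w - z) < d -> F w = G w) ->
  rdiff F z a b -> rdiff G z a b.
Proof.
move=> [d d0 Hd] H e e0; have [d' d'0 Hd'] := H e e0.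
exists (Num.min d d'); first by rewrite lt_min d0.
move=> w; rewrite lt_min => /andP[w1 w2]; rewrite -(Hd w w1) -(Hd z) ?subrr ?cmod0//.
exact: Hd'.
Qed.

Lemma rdiffZ F z (k a b : R) : rdiff F z a b -> rdiff (fun w => k * F w) z (k * a) (k * b).
Proof.
move=> H e e0; have k0 : 0 < `|k| + 1 by rewrite ltr_wpDl.
have [d d0 Hd] := H (e / (`|k| + 1)) (divr_gt0 e0 k0); exists d => // w /Hd h.
rewrite [X in `|X|](_ : _ = k * (F w - F z - (a * Re (w - z) + b * Im (w - z)))); last by ring.
rewrite normrM; apply: (@le_trans _ _ (`|k| * (e / (`|k| + 1) * cmod (w - z)))).
  by rewrite ler_wpM2l.
rewrite mulrA ler_wpM2r ?cmod_ge0// mulrCA -[X in _ <= X]mulr1 ler_wpM2l ?(ltW e0)//.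
by rewrite ler_pdivrMr// mul1r lerDl.
Qed.

Lemma cdiff_rdiff g z l : cdiff g z l ->
  rdiff (fun w => Re (g w)) z (Re l) (- Im l) /\ rdiff (fun w => Im (g w)) z (Im l) (Re l).
Proof.
move=> H; split=> e /H[d d0 Hd]; exists d => // w /(Hd w I); apply: le_trans.
- by apply: le_trans (Re_le_cmod _); rewrite !cE le_eqVlt; apply/orP; left; apply/eqP; congr `|_|; ring.
- by apply: le_trans (Im_le_cmod _); rewrite !cE le_eqVlt; apply/orP; left; apply/eqP; congr `|_|; ring.
Qed.

Lemma partials g z (a b c d : R) : rdiff (fun w => Re (g w)) z a b ->
  rdiff (fun w => Im (g w)) z c d -> partial_x g z = a +i* c /\ partial_y g z = b +i* d.
Proof.
case: z => x y HRe HIm; rewrite /partial_x /partial_y /=.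
have h1 := rdiff_x HRe; have h2 := rdiff_x HIm.
have h3 := rdiff_y HRe; have h4 := rdiff_y HIm.
by split; apply: ceqP; rewrite /= derive1E; [case: h1|case: h2|case: h3|case: h4].
Qed.

Lemma d_z_rdiff g z (a b c d : R) : rdiff (fun w => Re (g w)) z a b ->
  rdiff (fun w => Im (g w)) z c d ->
  d_z g z = ((a + d) / 2) +i* ((c - b) / 2) /\ d_zbar g z = ((a - d) / 2) +i* ((c + b) / 2).
Proof.
move=> HRe HIm; have [Ex Ey] := partials HRe HIm; rewrite /d_z /d_zbar Ex Ey.
have i2 : (2 : C)^-1 = (2^-1 : R)%:C.
  by rewrite -[(2^-1)%:C]/(real_complex R 2^-1) fmorphV rmorph_nat.
by rewrite i2; split; apply: ceqP; rewrite !cE /=; ring.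
Qed.

(** This is d ln |g|^2 = 2 Re (g'/g dz), read in the two real directions. *)
Lemma rdiff_log_normsq g z l : g z != 0 -> cdiff g z l ->
  rdiff (fun w => ln (cmod (g w) ^+ 2)) z (2 * Re (l / g z)) (- (2 * Im (l / g z))).
Proof.
move=> gz /cdiff_rdiff[HRe HIm].
have n0 : 0 < cmod (g z) ^+ 2 by rewrite exprn_gt0// cmod_gt0.
have H := rdiffD (rdiffM HRe HRe) (rdiffM HIm HIm).
have Hd : is_derive (Re (g z) * Re (g z) + Im (g z) * Im (g z)) 1 (@ln R) (cmod (g z) ^+ 2)^-1.
  by rewrite cmod_sq !expr2; apply: is_derive1_ln; rewrite -!expr2 -cmod_sq.
have := rdiff_compD H Hd; rewrite (_ : (fun w => ln _) = fun w => ln (cmod (g w) ^+ 2)); last first.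
  by apply/funext => w; rewrite cmod_sq !expr2.
have E : l / g z = l * (g z)^*%C * ((cmod (g z) ^+ 2)^-1)%:C.
  have h : g z * (g z)^*%C = (cmod (g z) ^+ 2)%:C.
    by rewrite cmod_sq; case: (g z) => u v; apply: ceqP; rewrite !cE /=; ring.
  rewrite -[(_^-1)%:C]/(real_complex R (cmod (g z) ^+ 2)^-1) fmorphV /= -h; field; rewrite gz andbT /=.
  by apply/eqP => h0; move: gz; rewrite -(conjcK (g z)) h0 conjc0 eqxx.
rewrite E; move: (_^-1) => k.
rewrite [X in rdiff _ _ X _](_ : _ = 2 * Re (l * (g z)^*%C * k%:C)); last first.
  by rewrite !cE /=; ring.
rewrite [X in rdiff _ _ _ X](_ : _ = - (2 * Im (l * (g z)^*%C * k%:C)))//.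
by rewrite !cE /=; ring.
Qed.

(* [d_zbar] of [g'/g] vanishes because a holomorphic [g] has a holomorphic
   derivative; only the real function [u] contributes. *)
Lemma dbar_d_log g (u ux uy : C -> R) (uxx uxy uyx uyy : R) (h : C -> R) (U : set C) z0 :
  open (U : set R[i]^o) -> U z0 ->
  (forall z, U z -> exists l, cdiff g z l) -> (forall z, U z -> g z != 0) ->
  (forall z, rdiff u z (ux z) (uy z)) ->
  rdiff ux z0 uxx uxy -> rdiff uy z0 uyx uyy ->
  (forall z, U z -> h z = ln (cmod (g z) ^+ 2) - u z) ->
  Re (d_zbar (d_z (fun w => (h w)%:C)) z0) = - ((uxx + uyy) / 4).
Proof.
move=> oU Uz hg gn0 du dux duy hE.
have [d1 d10 Hd1] := (open_cP U).1 oU z0 Uz.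
have [r [g1 [r0 Hg1 [l Hl]]]] := cdiff_regular oU hg Uz.
pose d := Num.min d1 r.
have d0 : 0 < d by rewrite lt_min d10.
have dd w : cmod (w - z0) < d -> U w /\ cmod (w - z0) < r.
  by rewrite lt_min => /andP[/Hd1 ? ?].
pose q w := g1 w / g w.
(* In complex form the right side is g'/g - (ux - i uy) / 2; it holds on a whole disc, as a further
   derivative is taken. *)
have dz w : cmod (w - z0) < d -> d_z (fun w => (h w)%:C) w =
    (Re (q w) - 2^-1 * ux w) +i* (Im (q w) + 2^-1 * uy w).
  move=> wd; have [Uw wr] := dd w wd.
  have H1 : rdiff (fun w => Re ((h w)%:C)) w (2 * Re (q w) + -1 * ux w) (- (2 * Im (q w)) + -1 * uy w).
    apply: rdiff_near (rdiffD (rdiff_log_normsq (gn0 w Uw) (Hg1 w wr)) (rdiffZ (-1) (du w))).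
    have [e e0 He] := (open_cP U).1 oU w Uw; exists e => // v /He Uv.
    by rewrite /= hE// mulN1r.
  have H2 : rdiff (fun w => Im ((h w)%:C)) w 0 0.
    move=> e e0; exists 1 => // v _; rewrite /= !mul0r addr0 !subrr normr0.
    by rewrite mulr_ge0 ?cmod_ge0// ltW.
  have [-> _] := d_z_rdiff H1 H2.
  by apply: ceqP => /=; field.
have gz0 := gn0 z0 Uz.
have Hq := cdiffM Hl (cdiffV gz0 (Hg1 z0 _)); rewrite subrr cmod0 in Hq; have {}Hq := Hq r0.
have [HqR HqI] := cdiff_rdiff Hq.
set lq := _ + _ in HqR HqI.
have near : exists2 e : R, 0 < e & forall w, cmod (w - z0) < e ->
  (Re (q w) - 2^-1 * ux w) +i* (Im (q w) + 2^-1 * uy w) = d_z (fun w => (h w)%:C) w.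
  by exists d => // w /dz ->.
have H1 : rdiff (fun w => Re (d_z (fun w => (h w)%:C) w)) z0 (Re lq + - 2^-1 * uxx) (- Im lq + - 2^-1 * uxy).
  apply: rdiff_near (rdiffD HqR (rdiffZ (- 2^-1) dux)).
  by exists d => // w /dz ->; rewrite /= mulNr.
have H2 : rdiff (fun w => Im (d_z (fun w => (h w)%:C) w)) z0 (Im lq + 2^-1 * uyx) (Re lq + 2^-1 * uyy).
  apply: rdiff_near (rdiffD HqI (rdiffZ 2^-1 duy)).
  by exists d => // w /dz ->.
have [_ ->] := d_z_rdiff H1 H2.
by rewrite /=; field.
Qed.

End Wirtinger.

(** * Frames, norm and curvature of F *)

Section CharacteristicLineBundle.
Context {R : realType}.
Local Notation C := R[i].
Variable s : nat -> R.
Hypothesis s0 : s 0%N = 1.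
Hypothesis s_pd : positive_definite_seq s.
Variables (zb : C) (Ab : R).
Hypothesis zb_im : Im zb != 0.
Hypothesis zb_bnd : bnd (Pz s zb) Ab.
Local Notation P := (Pz s).
Local Notation T := (jacobi_op s).
Local Notation KK := (KK s).
Implicit Types (z w c : C) (x : nat -> C) (U : set C) (sigma : C -> (nat -> C) -> C).

Let lP z : is_l2 (P z). Proof. exact: (l2P s0 s_pd zb_im zb_bnd). Qed.

Lemma cdiff_conj g z l : cdiff g z^*%C l -> cdiff (fun w => (g w^*%C)^*%C) z l^*%C.
Proof.
move=> H e /H[d d0 Hd]; exists d => // w _ wd.
have -> : (g w^*%C)^*%C - (g z^*%C)^*%C - l^*%C * (w - z) =
    (g w^*%C - g z^*%C - l * (w^*%C - z^*%C))^*%C by rewrite !cconjB cconjM cconjB !conjcK.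
by rewrite cmodJ -(cmodJ (w - z)) cconjB; apply: Hd => //; rewrite -cconjB cmodJ.
Qed.

(** The conjugate of the coordinate 0 is a global frame: it equals 1 on P because P_0 = 1. Its
    pairing with a section of E conjugates both the variable and the value, which preserves
    holomorphy. *)
Lemma frame_exists : holomorphic_frame_F T setT (fun _ x => (x 0%N)^*%C).
Proof.
split; last first.
  move=> z _; exists (P z^*%C).
    by have := fiberE_ZP s0 s_pd zb_im zb_bnd z^*%C 1; under eq_fun do rewrite mul1r.
  by rewrite (Pz0 s0) conjc1; apply/eqP; rewrite oner_eq0.
split=> [z _ c x y _ _|V v oV [_ hv] z [_ Vz]]; first by rewrite cconjD cconjM.
apply/derivable_cdiff; have [lv [w lw]] := hv _ Vz.
move=> /cvgrPdist_lt H; exists (w 0%N)^*%C; apply: (@cdiff_conj (fun u => v u 0%N)) => e e0.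
have := H e e0; rewrite near_withinE => /nbhs_cP[d d0 Hd].
have [d' d'0 Hd'] := (open_cP V).1 oV _ Vz.
exists (Num.min d d'); first by rewrite lt_min d0.
move=> u _; rewrite lt_min => /andP[u1 u2].
have [->|uz] := eqVneq u z^*%C; first by rewrite !subrr mulr0 subrr cmod0 mulr0.
have uz0 : u - z^*%C != 0 by rewrite subr_eq0.
have := Hd (u - z^*%C); rewrite subr0 => /(_ u1 uz0).
have E : z^*%C + (u - z^*%C) = u by rewrite addrC subrK.
rewrite sub0r normrN ger0_norm ?l2norm_ge0// E => /ltW.
set q := (fun n => _) => h.
have lu : is_l2 (v u) by case: (hv u (Hd' u u2)).
have lq : is_l2 q by apply: l2B => //; apply: l2Z; exact: l2B.
have := le_trans (@cmod_le_l2norm _ q 0 lq) h.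
have -> : v u 0%N - v z^*%C 0%N - w 0%N * (u - z^*%C) = q 0%N * (u - z^*%C).
  by rewrite /q; field.
by rewrite cmodM => ?; rewrite ler_wpM2r ?cmod_ge0.
Qed.

Lemma frame_on_fiber U sigma z c : holomorphic_frame_F T U sigma -> U z ->
  sigma z (fun n => c * P z^*%C n) = c^*%C * sigma z (P z^*%C).
Proof.
move=> [[lin _] _] Uz.
have f1 := fiberE_ZP s0 s_pd zb_im zb_bnd z^*%C.
have fP : fiberE T z^*%C (P z^*%C) by have := f1 1; under eq_fun do rewrite mul1r.
have f0 : fiberE T z^*%C (fun=> 0) by have := f1 0; under eq_fun do rewrite mul0r.
have s00 : sigma z (fun=> 0) = 0.
  (* Conjugate linearity is phrased for c x + y only; taking c = 1 and x = y = 0 recovers the value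
     0 at 0. *)
  have := lin z Uz 1 _ _ f0 f0; under eq_fun do rewrite mulr0 addr0.
  by rewrite conjc1 mul1r => /eqP; rewrite -subr_eq0 opprD addrA subrr sub0r oppr_eq0 => /eqP.
have := lin z Uz c _ _ fP f0; rewrite s00 addr0 => <-.
by congr (sigma z _); apply/funext => n; rewrite addr0.
Qed.

Lemma frame_neq0 U sigma z : holomorphic_frame_F T U sigma -> U z ->
  sigma z (P z^*%C) != 0.
Proof.
move=> F Uz; have [_ /(_ z Uz)[x fx]] := F.
rewrite (fiberE_P s0 s_pd fx) (frame_on_fiber _ F Uz) => n0.
by apply/eqP => h; apply: n0; rewrite h mulr0.
Qed.

(** Pairing the frame with the holomorphic section P of E yields the scalar function g whose modulus
    enters the norm of the frame. *)
Lemma frame_holomorphic U sigma z : holomorphic_frame_F T U sigma -> U z ->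
  exists l, cdiff (fun w => sigma w (P w^*%C)) z l.
Proof.
move=> [[_ hol] _] Uz; apply/derivable_cdiff.
by apply: (hol setT P openT (holomorphic_P s0 s_pd zb_im zb_bnd setT)).
Qed.

(** The unit ball of the fibre consists of multiples of P at the conjugate point, so the supremum is
    attained at the normalised vector; conjugation does not change the norm of P. *)
Lemma normF_frame U sigma z : holomorphic_frame_F T U sigma -> U z ->
  normF T z (sigma z) = cmod (sigma z (P z^*%C)) / l2norm (P z).
Proof.
move=> F Uz; rewrite -(l2norm_PJ s z).
set g := sigma z _; set k := l2norm _.
have k0 : 0 < k.
  rewrite /k l2norm_PJ; apply: lt_le_trans ltr01 _; exact: (rK_ge1 s0 s_pd zb_im zb_bnd).
have ub : ubound [set cmod (sigma z x) | x in [set x | fiberE T z^*%C x /\ l2norm x <= 1]] (cmod g / k).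
  move=> _ [x [fx x1] <-]; move: x1; rewrite (fiberE_P s0 s_pd fx) (frame_on_fiber _ F Uz).
  rewrite (l2normZ _ (@lP _)) -/g -/k cmodM cmodJ => h.
  by rewrite ler_pdivlMr// mulrAC -[X in _ <= X]mul1r ler_wpM2r ?cmod_ge0.
have mem : [set cmod (sigma z x) | x in [set x | fiberE T z^*%C x /\ l2norm x <= 1]] (cmod g / k).
  exists (fun n => (k^-1)%:C * P z^*%C n).
    split; first exact: (fiberE_ZP s0 s_pd zb_im zb_bnd).
    by rewrite (l2normZ _ (@lP _)) -/k cmod_rc ger0_norm ?invr_ge0 ?mulVf ?gt_eqF// ltW.
  by rewrite (frame_on_fiber _ F Uz) cmodM cmodJ cmod_rc ger0_norm ?invr_ge0 1?mulrC// ltW.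
apply/eqP; rewrite eq_le; apply/andP; split.
  by apply: sup_le_ub => //; exists (cmod g / k).
by apply: ub_le_sup => //; exists (cmod g / k).
Qed.

Lemma chern_coef_frame U sigma z : open (U : set R[i]^o) -> holomorphic_frame_F T U sigma -> U z ->
  Re (chern_coef T sigma z) = - ((uxx s z + uyy s z) / 4).
Proof.
move=> oU F Uz.
apply: (dbar_d_log (g := fun w => sigma w (P w^*%C)) (u := logK s) oU Uz).
- by move=> w; exact: frame_holomorphic F.
- by move=> w; exact: frame_neq0 F.
- exact: (rdiff_logK s0 s_pd zb_im zb_bnd).
- exact: (rdiff_ux s0 s_pd zb_im zb_bnd z).
- exact: (rdiff_uy s0 s_pd zb_im zb_bnd z).
- move=> w Uw; rewrite (normF_frame F Uw) exprMn lnM ?posrE.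
  + by rewrite exprVn -(KKE s0 s_pd zb_im zb_bnd) lnV // posrE (KK_gt0 s0 s_pd zb_im zb_bnd).
  + by rewrite exprn_gt0// cmod_gt0 (frame_neq0 F).
  + by rewrite exprn_gt0// invr_gt0 (lt_le_trans ltr01)// (rK_ge1 s0 s_pd zb_im zb_bnd).
Qed.

(** All frames give the same number, so the choice made by [xget] is harmless, and the global frame
    shows that its default value is not taken. *)
Lemma c1_densityE z : c1_density T z = (4 * pi)^-1 * (uxx s z + uyy s z).
Proof.
have H U sigma : open (U : set R[i]^o) -> U z -> holomorphic_frame_F T U sigma ->
    Re ('i%C / (2 * pi)%:C * chern_coef T sigma z * (2 * 'i%C)) = (4 * pi)^-1 * (uxx s z + uyy s z).
  move=> oU Uz F; have := chern_coef_frame oU F Uz; move: (chern_coef T sigma z) => k hk.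
  have -> : ((2 * pi)%:C : C)^-1 = ((2 * pi)^-1)%:C.
    by rewrite -[RHS]/(real_complex R (2 * pi)^-1) fmorphV.
  (* The scalar i / (2 pi) * 2 i = -1 / pi is real, so only the real part of the Chern coefficient
     is seen, and its sign is reversed. *)
  have -> : 'i%C * ((2 * pi)^-1)%:C * k * (2 * 'i%C) = (- (2 * (2 * pi)^-1))%:C * k.
    by apply: ceqP; rewrite !cE /=; ring.
  rewrite !cE /= mul0r subr0 hk; have := pi_gt0 R; move: (pi : R) => q q0; field; rewrite gt_eqF//.
apply: xget_unique.
  exists setT, (fun _ x => (x 0%N)^*%C); split => //; first exact: openT; first exact: frame_exists.
  by rewrite (H setT) //; [exact: openT|exact: frame_exists].
by move=> k [U [sigma [oU Uz F ->]]]; exact: (H U).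
Qed.

Lemma charFE (r : R) : 0 < r ->
  charF T r = (4 * pi)^-1 * (mean_logK s r - pi *+ 2 * logK s 0).
Proof.
move=> r0; pose k : R := (4 * pi)^-1.
have lk := @locLip_cst R k.
have du z : rdiff (fun w => k * logK s w) z (k * ux s z) (k * uy s z).
  by apply: rdiffZ; exact: (rdiff_logK s0 s_pd zb_im zb_bnd).
have dux z := rdiffZ k (rdiff_ux s0 s_pd zb_im zb_bnd z).
have duy z := rdiffZ k (rdiff_uy s0 s_pd zb_im zb_bnd z).
have := jensen_disc r0 du
  (locLipM lk (locLip_ux s0 s_pd zb_im zb_bnd)) (locLipM lk (locLip_uy s0 s_pd zb_im zb_bnd))
  (locLipM lk (locLip_uxx s0 s_pd zb_im zb_bnd)) (locLipM lk (locLip_uyy s0 s_pd zb_im zb_bnd))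
  (fun u v => rdiff_x (dux (u +i* v))) (fun u v => rdiff_y (duy (u +i* v))).
have cK : continuous (fun phi => logK s (cis r phi)).
  by apply: cont_cis; exact: (rdiff_ccontR (rdiff_logK s0 s_pd zb_im zb_bnd)).
rewrite RIZ// mulrCA -mulrBr => <-.
rewrite /charF; apply: eq_Rintegral => t _; congr (_ / _).
rewrite /c1_disc; apply: eq_Rintegral => p _.
by rewrite c1_densityE mulrDr.
Qed.

End CharacteristicLineBundle.

(** * Indeterminacy and square-summability *)

Section StieltjesInversion.
Context {R : realType}.
Local Notation mR := (measurableTypeR R).
Implicit Types (mu nu : {measure set mR -> \bar R}) (f g : R -> R).

Definition expect mu f : R := \int[mu]_(x in [set: mR]) f x.

Section Expectation.
Variable mu : {measure set mR -> \bar R}.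
Hypothesis mu1 : mu setT = 1%E.

Definition integ f := mu.-integrable setT (EFin \o (f : mR -> R)).

Lemma cont_meas f : continuous f -> measurable_fun setT (f : mR -> R).
Proof. exact: continuous_measurable_fun. Qed.

Lemma bounded_integ f (M : R) : continuous f -> (forall x, `|f x| <= M) -> integ f.
Proof.
move=> cf fM; apply: measurable_bounded_integrable => //.
- by have -> : mu setT = 1%E by []; rewrite ltry.
- exact: cont_meas.
- exists M; split; first exact: num_real.
  by move=> N MN p _; apply: le_trans (ltW MN).
Qed.

Lemma expectB f g : integ f -> integ g -> expect mu (fun x => f x - g x) = expect mu f - expect mu g.
Proof. by move=> hf hg; exact: RintegralB. Qed.

Lemma expectZ (k : R) f : integ f -> expect mu (fun x => k * f x) = k * expect mu f.
Proof. by move=> hf; exact: RintegralZl. Qed.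

Lemma expect_cst (k : R) : expect mu (fun=> k) = k.
Proof. by rewrite /expect Rintegral_cst// (_ : mu setT = 1%E)//= mulr1. Qed.

Lemma integ_cst (k : R) : integ (fun=> k).
Proof. by apply: (@bounded_integ _ `|k|) => //; exact: cont_cst. Qed.

Lemma le_expect f g : integ f -> integ g -> (forall x, f x <= g x) -> expect mu f <= expect mu g.
Proof. by move=> hf hg fg; apply: le_Rintegral => // x _. Qed.

Lemma integ_abs f : integ f -> integ (fun x => `|f x|).
Proof. by move=> /integrable_abse; rewrite /integ; congr (mu.-integrable _ _). Qed.

Lemma expect_abs f : integ f -> `|expect mu f| <= expect mu (fun x => `|f x|).
Proof. by move=> hf; exact: le_normr_Rintegral. Qed.

Lemma expect_abs_le f (M : R) : integ f -> (forall x, `|f x| <= M) -> `|expect mu f| <= M.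
Proof.
move=> hf fM; apply: le_trans (expect_abs hf) _.
by rewrite -(expect_cst M); apply: le_expect => //; [exact: integ_abs|exact: integ_cst].
Qed.

End Expectation.

(** Up to the factor v this is the imaginary part of 1 / (x - u - i v), the Poisson kernel without
    its normalisation. *)
Definition rho (u v x : R) : R := ((x - u) ^+ 2 + v ^+ 2)^-1.

Lemma rho_den (u v x : R) : 0 < v -> 0 < (x - u) ^+ 2 + v ^+ 2.
Proof. by move=> v0; rewrite ltr_wpDl ?sqr_ge0// exprn_gt0. Qed.

Lemma cont_id : continuous (fun x : R => x). Proof. by move=> x; exact: cvg_id. Qed.

Lemma cont_rho u v : 0 < v -> continuous (rho u v).
Proof.
move=> v0 x; apply: cvgV; first by rewrite gt_eqF// rho_den.
have h : continuous (fun x : R => x - u).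
  by apply: contD; [exact: cont_id|exact: cont_cst].
by apply: (contD (contM h h) (@cont_cst R (v ^+ 2))).
Qed.

Lemma rho_ge0 u v x : 0 < v -> 0 <= rho u v x.
Proof. by move=> v0; rewrite invr_ge0 ltW// rho_den. Qed.

Lemma rho_le u v x : 0 < v -> `|rho u v x| <= v ^- 2.
Proof.
move=> v0; rewrite ger0_norm ?rho_ge0// lef_pV2 ?posrE ?exprn_gt0 ?rho_den//.
by rewrite lerDr sqr_ge0.
Qed.

Let datan (w : R) := (1 + w ^+ 2)^-1.

Lemma datan_lip (v w : R) : `|datan v - datan w| <= `|v - w|.
Proof.
have pv : 0 < 1 + v ^+ 2 by rewrite ltr_wpDr ?sqr_ge0.
have pw : 0 < 1 + w ^+ 2 by rewrite ltr_wpDr ?sqr_ge0.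
have -> : datan v - datan w = (v - w) * (- (v + w) * ((1 + v ^+ 2)^-1 * (1 + w ^+ 2)^-1)).
  by rewrite /datan; field; rewrite !gt_eqF.
rewrite normrM ler_piMr// normrM (@ger0_norm _ (_ * _)) ?mulr_ge0 ?invr_ge0 ?(ltW pv) ?(ltW pw)//.
rewrite -invfM ler_pdivrMr ?mulr_gt0// mul1r normrN.
apply: le_trans (ler_normD _ _) _.
have hv : `|v| ^+ 2 = v ^+ 2 by rewrite real_normK// num_real.
have hw : `|w| ^+ 2 = w ^+ 2 by rewrite real_normK// num_real.
have := sqr_ge0 (`|v| - 1); have := sqr_ge0 (`|w| - 1).
have : 0 <= v ^+ 2 * w ^+ 2 by rewrite mulr_ge0 ?sqr_ge0.
by rewrite -hv -hw; nra.
Qed.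

(** With v = 1 / k the kernel v [rho] is the derivative in u of an arctangent, so equal Poisson
    integrals integrate to equal smoothed distribution functions. *)
Lemma is_derive_atan_kernel (k t y : R) : 0 < k ->
  is_derive y 1 (fun y => atan (k * (y - t))) (k^-1 * rho y k^-1 t).
Proof.
move=> k0; have -> : k^-1 * rho y k^-1 t = datan (k * (y - t)) * k.
  by rewrite /rho /datan; field; rewrite !gt_eqF ?ltr_wpDr ?sqr_ge0 ?ltr_wpDl ?sqr_ge0 ?exprn_gt0.
have h1 : is_derive y 1 (fun y => - (k * t) + k * y) k by exact: is_derive_affine.
have h2 := is_derive1_atan (- (k * t) + k * y).
rewrite (_ : (fun y => atan _) = atan \o (fun y => - (k * t) + k * y)); last first.
  by apply/funext => x /=; congr atan; ring.
rewrite (_ : k * (y - t) = - (k * t) + k * y); last by ring.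
exact: (@is_derive1_comp R atan (fun y => - (k * t) + k * y) y _ _ h2 h1).
Qed.

(** The bound is uniform in t, which permits differentiating under the expectation directly. *)
Lemma atan_kernel_taylor (k t y s : R) : 0 < k ->
  `|atan (k * (s - t)) - atan (k * (y - t)) - k^-1 * rho y k^-1 t * (s - y)|
    <= k ^+ 2 * `|s - y| ^+ 2.
Proof.
move=> k0; apply: (@taylor1_le R (fun y => atan (k * (y - t))) (fun y => k^-1 * rho y k^-1 t)).
- by move=> x; exact: is_derive_atan_kernel.
- have E x : k^-1 * rho x k^-1 t = k * datan (k * (x - t)).
    by rewrite /rho /datan; field; rewrite !gt_eqF ?ltr_wpDr ?sqr_ge0 ?ltr_wpDl ?sqr_ge0 ?exprn_gt0.
  move=> x _; rewrite !E -mulrBr normrM (ger0_norm (ltW k0)) expr2 -mulrA ler_wpM2l ?(ltW k0)//.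
  apply: le_trans (datan_lip _ _) _.
  rewrite -mulrBr normrM (ger0_norm (ltW k0)) ler_wpM2l ?(ltW k0)//.
  by rewrite opprB addrA subrK.
- exact: sqr_ge0.
Qed.

Lemma atan_bounded (w : R) : `|atan w| <= pi.
Proof.
have := atan_gtNpi2 w; have := atan_ltpi2 w; have := pi_gt0 R.
by rewrite ler_norml => p h1 h2; apply/andP; split; lra.
Qed.

Lemma cont_atan_kernel (k y : R) : continuous (fun t => atan (k * (y - t))).
Proof.
apply: (contcomp (f := atan)); first by move=> x; exact: continuous_atan.
apply: contM; first exact: cont_cst.
by apply: contD; [exact: cont_cst|apply: contN; exact: cont_id].
Qed.

Section Uniqueness.
Variables mu nu : {measure set mR -> \bar R}.
Hypotheses (mu1 : mu setT = 1%E) (nu1 : nu setT = 1%E).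
Hypothesis rho_eq : forall u v : R, 0 < v -> expect mu (rho u v) = expect nu (rho u v).

Lemma expect_atan_kernel_diff (k y s : R) (m : {measure set mR -> \bar R}) : 0 < k ->
  m setT = 1%E ->
  `|expect m (fun t => atan (k * (s - t))) - expect m (fun t => atan (k * (y - t)))
    - (s - y) * k^-1 * expect m (rho y k^-1)| <= k ^+ 2 * `|s - y| ^+ 2.
Proof.
move=> k0 m1.
have kV : 0 < k^-1 by rewrite invr_gt0.
have ia z : integ m (fun t => atan (k * (z - t))).
  apply: (bounded_integ m1 (M := pi)); [exact: cont_atan_kernel|move=> x; exact: atan_bounded].
have ir : integ m (rho y k^-1).
  by apply: (bounded_integ m1 (M := k^-1 ^- 2)) => [|x]; [exact: cont_rho|exact: rho_le].
have crk : continuous (fun t => (s - y) * k^-1 * rho y k^-1 t).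
  by apply: contM; [exact: cont_cst|exact: cont_rho].
have irk : integ m (fun t => (s - y) * k^-1 * rho y k^-1 t).
  apply: (bounded_integ m1 (M := `|(s - y) * k^-1| * k^-1 ^- 2)) => [|x]; first exact: crk.
  by rewrite normrM ler_wpM2l// rho_le.
have iab : integ m (fun t => atan (k * (s - t)) - atan (k * (y - t))).
  apply: (bounded_integ m1 (M := pi + pi)).
    by apply: contD; [exact: cont_atan_kernel|apply: contN; exact: cont_atan_kernel].
  by move=> x; apply: le_trans (ler_normB _ _) _; apply: lerD; exact: atan_bounded.
rewrite -expectZ// -expectB// -expectB//.
apply: expect_abs_le => // [|x].
  apply: (bounded_integ m1 (M := k ^+ 2 * `|s - y| ^+ 2)).
    apply: contD; last exact: contN.
    by apply: contD; [exact: cont_atan_kernel|apply: contN; exact: cont_atan_kernel].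
  move=> x; have := atan_kernel_taylor x y s k0.
  by rewrite (_ : k^-1 * _ * _ = (s - y) * k^-1 * rho y k^-1 x)//; ring.
have := atan_kernel_taylor x y s k0.
by rewrite (_ : k^-1 * _ * _ = (s - y) * k^-1 * rho y k^-1 x)//; ring.
Qed.

Lemma expect_atan_kernel_eq (k a b : R) : 0 < k ->
  expect mu (fun t => atan (k * (b - t)) - atan (k * (a - t))) =
  expect nu (fun t => atan (k * (b - t)) - atan (k * (a - t))).
Proof.
move=> k0.
pose D y := expect mu (fun t => atan (k * (y - t))) - expect nu (fun t => atan (k * (y - t))).
have dD (y : R) : is_derive y 1 D (0 : R).
  apply: is_deriveP => e e0; have k20 : 0 < 2 * k ^+ 2 by rewrite mulr_gt0// exprn_gt0.
  exists (e / (2 * k ^+ 2)); first by rewrite divr_gt0.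
  move=> s sy; have h1 := expect_atan_kernel_diff y s k0 mu1.
  have h2 := expect_atan_kernel_diff y s k0 nu1.
  rewrite rho_eq ?invr_gt0// in h1; rewrite mul0r subr0.
  set A := _ * expect nu _ in h1 h2.
  have -> : D s - D y =
    (expect mu (fun t => atan (k * (s - t))) - expect mu (fun t => atan (k * (y - t))) - A) -
    (expect nu (fun t => atan (k * (s - t))) - expect nu (fun t => atan (k * (y - t))) - A).
    by rewrite /D; ring.
  apply: le_trans (ler_normB _ _) _; apply: le_trans (lerD h1 h2) _.
  rewrite -mulr2n -mulr_natl mulrA expr2 mulrA ler_wpM2r//.
  by rewrite mulrC -ler_pdivlMr// ltW.
have E : D b = D a.
  by apply/eqP; rewrite -subr_eq0 -(FTC a b (cont_cst (k := 0)) dD) RI_cst mul0r.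
have ia (m : {measure set mR -> \bar R}) z : m setT = 1%E -> integ m (fun t => atan (k * (z - t))).
  move=> m1; apply: (bounded_integ m1 (M := pi)); [exact: cont_atan_kernel|move=> x; exact: atan_bounded].
rewrite !expectB//; try exact: ia.
by move: E; rewrite /D; lra.
Qed.

(** For n >= 1, the indicator of the interval from -n to b - 1/n, smoothed at scale 1/n^2. The shift
    1/n is large against that scale, so the limit at t = b is 0 and the open ray is obtained. *)
Definition step (b : R) (n : nat) (t : R) : R :=
  pi^-1 * (atan (n%:R ^+ 2 * (b - n%:R^-1 - t)) - atan (n%:R ^+ 2 * (- n%:R - t))).

Lemma atan_cvgy (w : nat -> R) (N : nat) : (forall n, (N <= n)%N -> n%:R <= w n) ->
  (fun n => atan (w n)) @ \oo --> pi / 2.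
Proof.
move=> H; apply: cvg_comp (@cvgy_atan R).
apply/cvgryPge => A; near=> n; apply: (@le_trans _ _ n%:R); last first.
  by apply: H; near: n; exact: nbhs_infty_ge.
by near: n; exact: nbhs_infty_ger.
Unshelve. all: by end_near. Qed.

Lemma step_cvg b t : (fun n => step b n t) @ \oo --> (\1_(`]-oo, b[%classic) t : R).
Proof.
have pn0 : pi != 0 :> R by rewrite gt_eqF// pi_gt0.
have nat_big (x : R) : exists N : nat, forall n, (N <= n)%N -> x <= n%:R.
  have := @nbhs_infty_ger R x; case=> N _ HN; exists N => n Nn; exact: HN.
have h1 : (fun n => atan (n%:R ^+ 2 * (- n%:R - t))) @ \oo --> - (pi / 2).
  have [N HN] := nat_big (1 + `|t|).
  have h (n : nat) : (N <= n)%N -> n%:R <= - (n%:R ^+ 2 * (- n%:R - t)).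
    move=> /HN nt; have t1 := ler_norm (- t); rewrite normrN in t1.
    have n1 : 1 <= n%:R :> R by have := normr_ge0 t; lra.
    rewrite -mulrN opprD !opprK expr2 -mulrA ler_peMr// ?ler0n//.
    have : 1 <= n%:R + t by lra.
    by move=> h; rewrite -[X in X <= _]mulr1; apply: ler_pM.
  have -> : (fun n => atan (n%:R ^+ 2 * (- n%:R - t))) = (fun n => - atan (- (n%:R ^+ 2 * (- n%:R - t)))).
    by apply/funext => n; rewrite atanN opprK.
  by apply: cvgN; exact: atan_cvgy h.
have h2 : (fun n => atan (n%:R ^+ 2 * (b - n%:R^-1 - t))) @ \oo --> (if t < b then pi / 2 else - (pi / 2)).
  case: ltP => tb.
    have [N HN] := nat_big (1 + 2 / (b - t)).
    apply: (@atan_cvgy _ N) => n /HN nt.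
    have bt : 0 < b - t by rewrite subr_gt0.
    have q0 : 0 < 2 / (b - t) by rewrite divr_gt0.
    have n1 : 1 <= n%:R :> R by lra.
    have n0 : n%:R != 0 :> R by rewrite gt_eqF//; lra.
    have -> : n%:R ^+ 2 * (b - n%:R^-1 - t) = n%:R * (n%:R * (b - t) - 1) by field.
    rewrite ler_peMr ?ler0n// lerBrDr.
    have : 2 / (b - t) <= n%:R by lra.
    by rewrite ler_pdivrMr//; lra.
  have h (n : nat) : (1 <= n)%N -> n%:R <= - (n%:R ^+ 2 * (b - n%:R^-1 - t)).
    move=> n1; have n0 : n%:R != 0 :> R by rewrite pnatr_eq0 -lt0n.
    have -> : - (n%:R ^+ 2 * (b - n%:R^-1 - t)) = n%:R + n%:R ^+ 2 * (t - b) by field.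
    by rewrite lerDl mulr_ge0 ?sqr_ge0// subr_ge0.
  have -> : (fun n => atan (n%:R ^+ 2 * (b - n%:R^-1 - t))) = (fun n => - atan (- (n%:R ^+ 2 * (b - n%:R^-1 - t)))).
    by apply/funext => n; rewrite atanN opprK.
  by apply: cvgN; exact: atan_cvgy h.
have -> : \1_(`]-oo, b[%classic) t = pi^-1 * ((if t < b then pi / 2 else - (pi / 2)) - - (pi / 2)) :> R.
  rewrite indicE mem_setE in_itv /=; case: ltP => _ /=; first by rewrite opprK -mulrDl -mulr2n -[pi *+ 2]mulr_natr mulfK ?pnatr_eq0// mulVf.
  by rewrite subrr mulr0.
by apply: cvgM; [exact: cvg_cst|exact: cvgB].
Qed.

Lemma cont_step b n : continuous (step b n).
Proof.
apply: contM; first exact: cont_cst.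
by apply: contD; [exact: cont_atan_kernel|apply: contN; exact: cont_atan_kernel].
Qed.

Lemma step_le b n t : `|step b n t| <= 2.
Proof.
rewrite /step normrM ger0_norm ?invr_ge0 ?pi_ge0// mulrC ler_pdivrMr ?pi_gt0//.
apply: le_trans (ler_normB _ _) _; rewrite mulr_natl mulr2n; apply: lerD; exact: atan_bounded.
Qed.

Lemma expect_step_cvg (m : {measure set mR -> \bar R}) b : m setT = 1%E ->
  (fun n => (expect m (step b n))%:E) @ \oo --> m (`]-oo, b[%classic : set mR).
Proof.
move=> m1.
have := @dominated_cvg _ _ R m setT measurableT (fun n (t : mR) => (step b n t)%:E)
  (fun t : mR => (\1_(`]-oo, b[%classic : set mR) t)%:E) (fun=> 2%:E).
rewrite integral_indic//= ?setIT => H.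
have is_ n : integ m (step b n) := bounded_integ m1 (@cont_step b n) (step_le b n).
rewrite (_ : (fun n => (expect m (step b n))%:E) = (fun n => \int[m]_(x in setT) (step b n x)%:E)%E).
  apply: H => //.
  - by move=> n; apply/measurable_EFinP; apply: (@cont_meas (step b n)); exact: cont_step.
  - by move=> t _; apply: cvg_EFin; [exact: nearW|exact: step_cvg].
  - exact: (integ_cst m1 2).
  - by move=> n t _; rewrite lee_fin step_le.
apply/funext => n; rewrite /expect /Rintegral fineK//.
exact: (integrable_fin_num measurableT (is_ n)).
Qed.

Lemma ray_eq b : mu (`]-oo, b[%classic : set mR) = nu (`]-oo, b[%classic : set mR).
Proof.
have h1 := expect_step_cvg (b := b) mu1; have h2 := expect_step_cvg (b := b) nu1.
apply: (@cvg_unique _ (@ereal_hausdorff R)) h1 _.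
(* The comparison starts at n = 1 because the arctangent identity asks for a positive scale. *)
apply: cvg_trans h2; apply: near_eq_cvg; exists 1%N => // n /= n1; congr _%:E.
have n20 : 0 < n%:R ^+ 2 :> R by rewrite exprn_gt0// ltr0n.
have ic (m : {measure set mR -> \bar R}) : m setT = 1%E ->
    integ m (fun t => atan (n%:R ^+ 2 * (b - n%:R^-1 - t)) - atan (n%:R ^+ 2 * (- n%:R - t))).
  move=> m1; apply: (bounded_integ m1 (M := pi + pi)).
    by apply: contD; [exact: cont_atan_kernel|apply: contN; exact: cont_atan_kernel].
  by move=> x; apply: le_trans (ler_normB _ _) _; apply: lerD; exact: atan_bounded.
by rewrite /step !expectZ ?expect_atan_kernel_eq//; exact: ic.
Qed.

(** Open left rays are stable under intersection, generate the Borel sets and exhaust the line, so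
    agreement on them suffices. *)
Theorem stieltjes_unique (A : set mR) : measurable A -> mu A = nu A.
Proof.
apply: (@measure_unique _ R mR (@RGenInftyO.G R) (fun n => `]-oo, n%:R[%classic)).
- exact: RGenInftyO.measurableE.
- move=> _ _ [x ->] [y ->]; exists (Num.min x y).
  apply/seteqP; split => t /=; rewrite !in_itv /= lt_min.
    by move=> [-> ->].
  by move=> /andP[].
- by move=> n; exists n%:R.
- apply/seteqP; split => // x _; exists (Num.truncn `|x|).+1 => //=.
  by rewrite in_itv /=; apply: le_lt_trans (ler_norm x) _; exact: truncnS_gt.
- by move=> _ [x ->]; exact: ray_eq.
- move=> n; apply: (@le_lt_trans _ _ (mu setT)); last by rewrite mu1 ltry.
  by apply: le_measure; rewrite ?inE//; exact: measurable_itv.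
Qed.

End Uniqueness.
End StieltjesInversion.

(** * A non-real point where P is square-summable *)

Section IndeterminateBound.
Context {R : realType}.
Local Notation C := R[i].
Local Notation mR := (measurableTypeR R).
Variable s : nat -> R.
Implicit Types (mu nu : {measure set mR -> \bar R}) (p q : {poly R}).

(** The integral of p for every solution alike; it cancels when two solutions are subtracted. *)
Definition moment_sum p : R := \sum_(i < size p) p`_i * s i.

Section Moments.
Variable mu : {measure set mR -> \bar R}.
Hypothesis mu_s : moment_solution s mu.

Lemma integ_power (i : nat) : integ mu (fun x => x ^+ i). Proof. by have [] := mu_s i. Qed.

Lemma expect_power (i : nat) : expect mu (fun x => x ^+ i) = s i.
Proof. by have [_ h] := mu_s i; rewrite /expect /Rintegral h. Qed.

Lemma integD (f g : R -> R) : integ mu f -> integ mu g -> integ mu (fun x => f x + g x).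
Proof. by move=> hf hg; apply: eq_integrable (integrableD measurableT hf hg). Qed.

Lemma integZ (k : R) (f : R -> R) : integ mu f -> integ mu (fun x => k * f x).
Proof. by move=> hf; apply: eq_integrable (integrableZl measurableT k hf). Qed.

Lemma expectD (f g : R -> R) : integ mu f -> integ mu g ->
  expect mu (fun x => f x + g x) = expect mu f + expect mu g.
Proof. by move=> hf hg; exact: RintegralD. Qed.

Lemma expect_sum n (c : nat -> R) (f : nat -> R -> R) : (forall i, integ mu (f i)) ->
  integ mu (fun x => \sum_(i < n) c i * f i x) /\
  expect mu (fun x => \sum_(i < n) c i * f i x) = \sum_(i < n) c i * expect mu (f i).
Proof.
move=> hf; elim: n => [|n [IH1 IH2]].
  rewrite (_ : (fun x => _) = fun x => 0 * x ^+ 0); last by apply/funext => x; rewrite big_ord0 mul0r.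
  split; first by apply: integZ; exact: integ_power.
  by rewrite expectZ ?mul0r ?big_ord0//; exact: integ_power.
have h := integZ (c n) (hf n).
rewrite (_ : (fun x => _) = fun x => (\sum_(i < n) c i * f i x) + c n * f n x); last first.
  by apply/funext => x; rewrite big_ord_recr.
by split; [exact: integD|rewrite expectD// IH2 expectZ// big_ord_recr].
Qed.

Lemma expect_horner p : integ mu (fun x => p.[x]) /\ expect mu (fun x => p.[x]) = moment_sum p.
Proof.
have [h1 h2] := @expect_sum (size p) (fun i => p`_i) (fun i x => x ^+ i) integ_power.
rewrite (_ : (fun x => p.[x]) = fun x => \sum_(i < size p) p`_i * x ^+ i); last first.
  by apply/funext => x; rewrite horner_coef.
by split => //; rewrite h2; apply: eq_bigr => i _; rewrite expect_power.
Qed.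

Lemma expect_sq p : integ mu (fun x => p.[x] ^+ 2) /\
  expect mu (fun x => p.[x] ^+ 2) = poly_ip s p p.
Proof.
have h i := @expect_sum (size p) (fun j => p`_j) (fun j x => x ^+ (i + j)) (fun j => integ_power _).
have [h1 h2] := @expect_sum (size p) (fun i => p`_i)
  (fun i x => \sum_(j < size p) p`_j * x ^+ (i + j)) (fun i => (h i).1).
rewrite (_ : (fun x => p.[x] ^+ 2) =
    fun x => \sum_(i < size p) p`_i * \sum_(j < size p) p`_j * x ^+ (i + j)); last first.
  apply/funext => x; rewrite expr2 {1}horner_coef mulr_suml; apply: eq_bigr => i _.
  rewrite -mulrA horner_coef mulr_sumr; congr (_ * _); apply: eq_bigr => j _.
  by rewrite exprD; ring.
split => //; rewrite h2; apply: eq_bigr => i _; rewrite (h i).2 mulr_sumr.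
by apply: eq_bigr => j _; rewrite expect_power mulrA.
Qed.

Hypothesis s0 : s 0%N = 1.

Lemma moment_mass : mu setT = 1%E.
Proof.
have [_] := mu_s 0; rewrite s0 => <-.
by under eq_integral do rewrite expr0; rewrite integral_cst// mul1e.
Qed.

(** From |p| <= p^2 / (2 t) + t / 2, which replaces the Cauchy-Schwarz inequality for integrals. *)
Lemma expect_abs_poly p (t : R) : 0 < t -> poly_ip s p p = t ^+ 2 ->
  integ mu (fun x => `|p.[x]|) /\ expect mu (fun x => `|p.[x]|) <= t.
Proof.
move=> t0 pt; have [h1 _] := expect_horner p; have [h2 h3] := expect_sq p.
have h4 := integ_abs h1; split => //.
have hc := integ_cst moment_mass (2^-1 * t).
have hz := integZ (2^-1 * t^-1) h2.
apply: (@le_trans _ _ (expect mu (fun x => 2^-1 * t^-1 * p.[x] ^+ 2 + 2^-1 * t))).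
  apply: le_expect => //; first exact: integD.
  move=> x; have := sqr_ge0 (`|p.[x]| - t).
  have hx : `|p.[x]| ^+ 2 = p.[x] ^+ 2 by rewrite real_normK// num_real.
  rewrite -hx; move: (`|_|) => y h.
  have -> : 2^-1 * t^-1 * y ^+ 2 + 2^-1 * t = y + 2^-1 * t^-1 * (y - t) ^+ 2.
    by field; rewrite gt_eqF.
  by rewrite lerDl mulr_ge0// mulr_ge0 ?invr_ge0// ltW.
rewrite expectD// expectZ// h3 pt (expect_cst moment_mass).
by rewrite le_eqVlt; apply/orP; left; apply/eqP; field; rewrite gt_eqF.
Qed.

Variables u v : R.
Hypothesis v0 : 0 < v.
Local Notation e0 := (expect mu (rho u v)).
Local Notation e1 := (expect mu (fun x => (x - u) * rho u v x)).
Let D : {poly R} := ('X - u%:P) ^+ 2 + (v ^+ 2)%:P.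

Lemma cont_xrho : continuous (fun x => (x - u) * rho u v x).
Proof.
apply: contM; last exact: cont_rho.
by apply: contD; [exact: cont_id|exact: cont_cst].
Qed.

Lemma xrho_le x : `|(x - u) * rho u v x| <= v^-1.
Proof.
have d0 := rho_den u x v0.
rewrite normrM (ger0_norm (rho_ge0 _ _ v0)) ler_pdivrMr// mulrC ler_pdivlMr//.
have hx : `|x - u| ^+ 2 = (x - u) ^+ 2 by rewrite real_normK// num_real.
have := sqr_ge0 (`|x - u| - v); have := sqr_ge0 `|x - u|; have := sqr_ge0 v.
by rewrite -hx; nra.
Qed.

Let irho : integ mu (rho u v).
Proof. by apply: (bounded_integ moment_mass (M := v ^- 2)) => [|x]; [exact: cont_rho|exact: rho_le]. Qed.
Let ixrho : integ mu (fun x => (x - u) * rho u v x).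
Proof. by apply: (bounded_integ moment_mass (M := v^-1)) => [|x]; [exact: cont_xrho|exact: xrho_le]. Qed.

Lemma expect_abs_mul_le p (f : R -> R) (t M : R) : 0 < t -> 0 <= M ->
  poly_ip s p p = t ^+ 2 -> integ mu (fun x => p.[x] * f x) -> (forall x, `|f x| <= M) ->
  `|expect mu (fun x => p.[x] * f x)| <= M * t.
Proof.
move=> t0 M0 pt hi fM; have [h1 h2] := expect_abs_poly t0 pt.
apply: le_trans (expect_abs hi) _.
apply: (@le_trans _ _ (expect mu (fun x => M * `|p.[x]|))).
  apply: le_expect; [exact: integ_abs|exact: integZ|].
  by move=> x; rewrite normrM mulrC ler_wpM2r.
by rewrite expectZ// ler_wpM2l.
Qed.

Lemma expect_rho_poly p q (al be t : R) : 0 < t -> poly_ip s p p = t ^+ 2 ->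
  p = q * D + (al *: ('X - u%:P) + be%:P) ->
  `|moment_sum q + (al * e1 + be * e0)| <= v ^- 2 * t /\
  `|moment_sum (('X - u%:P) * q) + (al * (1 - v ^+ 2 * e0) + be * e1)| <= v^-1 * t.
Proof.
move=> t0 pt pE.
have px x : p.[x] = q.[x] * ((x - u) ^+ 2 + v ^+ 2) + (al * (x - u) + be).
  by rewrite pE /D !hornerE.
have dx x : (x - u) ^+ 2 + v ^+ 2 != 0 by rewrite gt_eqF// rho_den.
have [hq1 hq2] := expect_horner q; have [hX1 hX2] := expect_horner (('X - u%:P) * q).
split.
- have E : (fun x => p.[x] * rho u v x) =
      fun x => q.[x] + (al * ((x - u) * rho u v x) + be * rho u v x).
    by apply/funext => x; rewrite px /rho; field.
  have hi : integ mu (fun x => p.[x] * rho u v x).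
    by rewrite E; apply: integD => //; apply: integD; exact: integZ.
  have := expect_abs_mul_le t0 _ pt hi (fun x => rho_le u x v0).
  rewrite E expectD// ?hq2 ?expectD ?expectZ//; try exact: integZ.
    by apply; rewrite invr_ge0 exprn_ge0// ltW.
  by apply: integD; exact: integZ.
- have E : (fun x => p.[x] * ((x - u) * rho u v x)) =
      fun x => (('X - u%:P) * q).[x] + (al * (1 - v ^+ 2 * rho u v x) + be * ((x - u) * rho u v x)).
    by apply/funext => x; rewrite px /rho hornerM hornerXsubC; field.
  have h1 : integ mu (fun x => 1 - v ^+ 2 * rho u v x).
    have := integD (integ_cst moment_mass 1) (integZ (- v ^+ 2) irho).
    by congr (integ mu _); apply/funext => x; rewrite mulNr.
  have hi : integ mu (fun x => p.[x] * ((x - u) * rho u v x)).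
    by rewrite E; apply: integD => //; apply: integD; exact: integZ.
  have := expect_abs_mul_le t0 _ pt hi xrho_le.
  rewrite E expectD// ?hX2 ?expectD ?expectZ//; try exact: integZ.
  + rewrite expectB ?expectZ ?(expect_cst moment_mass)//; [|exact: integ_cst moment_mass _|exact: integZ].
    by apply; rewrite invr_ge0 ltW.
  + by apply: integD; exact: integZ.
Qed.

End Moments.

Hypothesis s0 : s 0%N = 1.
Hypothesis s_pd : positive_definite_seq s.

Lemma indeterminate_rho : indeterminate s -> exists mu nu (u v : R),
  [/\ moment_solution s mu, moment_solution s nu, 0 < v & expect mu (rho u v) != expect nu (rho u v)].
Proof.
move=> [mu [nu [hmu hnu [A mA Aneq]]]]; exists mu, nu; apply: contrapT => H; apply: Aneq.
apply: stieltjes_unique (moment_mass hmu s0) (moment_mass hnu s0) _ _ mA => u v v0.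
by apply/eqP/negPn/negP => h; apply: H; exists u, v.
Qed.

(* Integrals of [p rho] and [(x - u) p rho] are small when [p] is; subtracting
   them for two solutions leaves two linear equations for the value of [p] at
   [u + i v], whose determinant is positive. *)
Lemma eval_bound mu nu (u v : R) : moment_solution s mu -> moment_solution s nu -> 0 < v ->
  expect mu (rho u v) != expect nu (rho u v) ->
  exists2 M : R, 0 <= M & forall p (t : R), 0 < t -> poly_ip s p p = t ^+ 2 ->
    `|Re (ceval p (u +i* v))| <= M * t /\ `|Im (ceval p (u +i* v))| <= M * t.
Proof.
move=> hmu hnu v0 neq.
pose d0 := expect mu (rho u v) - expect nu (rho u v).
pose d1 := expect mu (fun x => (x - u) * rho u v x) - expect nu (fun x => (x - u) * rho u v x).
have d00 : d0 != 0 by rewrite subr_eq0.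
pose N := d1 ^+ 2 + v ^+ 2 * d0 ^+ 2.
have d02 : 0 < d0 ^+ 2 by rewrite exprn_even_gt0//= d00 orbT.
have N0 : 0 < N by rewrite ltr_wpDl ?sqr_ge0// mulr_gt0// exprn_gt0.
pose A := 2 * v ^- 2; pose B := 2 * v^-1.
have A0 : 0 <= A by rewrite mulr_ge0// invr_ge0 exprn_ge0// ltW.
have B0 : 0 <= B by rewrite mulr_ge0// invr_ge0 ltW.
(* Cramer's rule bounds v |al| and |be| separately; their sum serves for both parts. A and B are
   twice the bounds of [expect_rho_poly] because two solutions are subtracted. *)
exists ((v * (`|d1| * A + `|d0| * B) + (v ^+ 2 * `|d0| * A + `|d1| * B)) / N).
  apply: divr_ge0; last exact: ltW.
  by do ?[exact: sqr_ge0|exact: normr_ge0|exact: ltW|exact: A0|exact: B0|apply: addr_ge0|apply: mulr_ge0].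
move=> p t t0 pt.
pose D : {poly R} := ('X - u%:P) ^+ 2 + (v ^+ 2)%:P.
have sD : size D = 3.
  rewrite /D size_polyDl ?size_exp_XsubC//.
  by apply: leq_ltn_trans (size_polyC_leq1 _) _.
have D0 : D != 0 by rewrite -size_poly_eq0 sD.
pose r := p %% D; pose al := r`_1; pose be := r`_0 + al * u.
have sr : (size r <= 2)%N by have := ltn_modp p D; rewrite D0 sD ltnS.
have rE : r = al *: ('X - u%:P) + be%:P.
  apply/polyP => i; rewrite coefD coefZ coefB coefX !coefC.
  case: i => [|[|i]] /=; rewrite ?subr0 ?mulr1 ?addr0 ?sub0r /be ?mulr0 ?addr0//.
    by rewrite mulrN addrCA addNr addr0.
  by rewrite nth_default// (leq_trans sr).
have pE : p = (p %/ D) * D + (al *: ('X - u%:P) + be%:P) by rewrite -rE; exact: divp_eq.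
have [h1 h2] := expect_rho_poly hmu s0 v0 t0 pt pE.
have [h3 h4] := expect_rho_poly hnu s0 v0 t0 pt pE.
have zE : ceval p (u +i* v) = be +i* (al * v).
  have cM f g w : ceval (f * g : {poly R}) w = ceval f w * ceval g w by rewrite /ceval rmorphM hornerM.
  have cX : ceval ('X - u%:P) (u +i* v) = 0 +i* v.
    have -> : 'X - u%:P = 'X * 1%:P - u%:P :> {poly R} by rewrite mulr1.
    by rewrite cevalD cevalN cevalX !cevalC; apply: ceqP; rewrite !cE /=; ring.
  rewrite pE cevalD cM [ceval D _]cevalD [('X - _) ^+ 2]expr2 cM cX cevalC cevalD cevalZ cX cevalC.
  by apply: ceqP; rewrite !cE /=; ring.
rewrite zE /=.
have X1 : `|al * d1 + be * d0| <= A * t.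
  have -> : al * d1 + be * d0 = (moment_sum (p %/ D) + (al * expect mu (fun x => (x - u) * rho u v x) + be * expect mu (rho u v)))
     - (moment_sum (p %/ D) + (al * expect nu (fun x => (x - u) * rho u v x) + be * expect nu (rho u v))).
    by rewrite /d0 /d1; ring.
  by apply: le_trans (ler_normB _ _) _; rewrite /A; lra.
have X2 : `|be * d1 - al * v ^+ 2 * d0| <= B * t.
  have -> : be * d1 - al * v ^+ 2 * d0 = (moment_sum (('X - u%:P) * (p %/ D)) + (al * (1 - v ^+ 2 * expect mu (rho u v)) + be * expect mu (fun x => (x - u) * rho u v x)))
     - (moment_sum (('X - u%:P) * (p %/ D)) + (al * (1 - v ^+ 2 * expect nu (rho u v)) + be * expect nu (fun x => (x - u) * rho u v x))).
    by rewrite /d0 /d1; ring.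
  by apply: le_trans (ler_normB _ _) _; rewrite /B; lra.
clearbody A B.
have ha : `|al| * N <= (`|d1| * A + `|d0| * B) * t.
  rewrite -(ger0_norm (ltW N0)) -normrM.
  have -> : al * N = d1 * (al * d1 + be * d0) - d0 * (be * d1 - al * v ^+ 2 * d0) by rewrite /N; ring.
  apply: le_trans (ler_normB _ _) _.
  have -> : (`|d1| * A + `|d0| * B) * t = `|d1| * (A * t) + `|d0| * (B * t) by ring.
  by apply: lerD; rewrite normrM ler_wpM2l.
have hb : `|be| * N <= (v ^+ 2 * `|d0| * A + `|d1| * B) * t.
  rewrite -(ger0_norm (ltW N0)) -normrM.
  have -> : be * N = v ^+ 2 * d0 * (al * d1 + be * d0) + d1 * (be * d1 - al * v ^+ 2 * d0) by rewrite /N; ring.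
  apply: le_trans (ler_normD _ _) _.
  have -> : (v ^+ 2 * `|d0| * A + `|d1| * B) * t = `|v ^+ 2 * d0| * (A * t) + `|d1| * (B * t).
    by rewrite normrM (ger0_norm (sqr_ge0 v)); ring.
  by apply: lerD; rewrite normrM ler_wpM2l.
have pa : 0 <= (`|d1| * A + `|d0| * B) * t by apply: le_trans ha; rewrite mulr_ge0// ltW.
have pb : 0 <= (v ^+ 2 * `|d0| * A + `|d1| * B) * t by apply: le_trans hb; rewrite mulr_ge0// ltW.
rewrite normrM (ger0_norm (ltW v0)) [_ / N * t]mulrAC !ler_pdivlMr// [_ * v * N]mulrAC.
have hav : `|al| * N * v <= (`|d1| * A + `|d0| * B) * t * v by rewrite ler_wpM2r// ltW.
have pav : 0 <= (`|d1| * A + `|d0| * B) * t * v by rewrite mulr_ge0// ltW.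
move: ha hb pa pb hav pav.
move: (`|d1| * A + `|d0| * B) (v ^+ 2 * `|d0| * A + `|d1| * B) (`|be| * N) (`|al| * N) => X Y b a.
move=> *; split.
  by apply: le_trans (_ : b <= Y * t) _ => //; lra.
by apply: le_trans (_ : a * v <= X * t * v) _ => //; lra.
Qed.

Lemma ip_comb (x : nat -> R) N :
  let p := \sum_(n < N) x n *: opoly s n in
  poly_ip s p p = \sum_(n < N) x n ^+ 2 /\
  forall z, ceval p z = \sum_(n < N) (x n)%:C * Pz s z n.
Proof.
move=> p; split.
  rewrite {1}/p ip_suml; apply: eq_bigr => n _.
  rewrite ipZl ipC /p ip_suml (bigD1 n)//= ipZl (ip_opoly s_pd) eqxx mulr1 big1 ?addr0 ?expr2//.
  by move=> k kn; rewrite ipZl (ip_opoly s_pd) (_ : (nat_of_ord k == n) = false) ?mulr0//; exact/negbTE.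
by move=> z; rewrite /p /ceval rmorph_sum horner_sum; apply: eq_bigr => n _; exact: cevalZ.
Qed.

Lemma le_of_le_sqrt (S M : R) : 0 <= S -> 0 <= M -> (0 < S -> S <= M * Num.sqrt S) -> S <= M ^+ 2.
Proof.
move=> S0 M0 H; move: S0; rewrite le_eqVlt => /predU1P[<-|S0]; first exact: sqr_ge0.
have q0 : 0 < Num.sqrt S by rewrite sqrtr_gt0.
have E : Num.sqrt S ^+ 2 = S by rewrite sqr_sqrtr// ltW.
have : Num.sqrt S <= M by rewrite -(ler_pM2r q0) -expr2 E H.
by move=> h; rewrite -E ler_pXn2r ?nnegrE ?sqrtr_ge0.
Qed.

(** Duality: the real polynomial with coefficients x_n = Re P_n(z) in the orthonormal basis has
    squared norm S, the sum of the x_n^2, and its value at z has real part S. The evaluation bound S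
    <= M sqrt S then gives S <= M^2; imaginary parts are treated alike, whence 2 M^2. *)
Lemma indeterminate_bnd : indeterminate s -> exists (z : C) (A : R), Im z != 0 /\ bnd (Pz s z) A.
Proof.
move=> /indeterminate_rho[mu [nu [u [v [hmu hnu v0 neq]]]]].
have [M M0 HM] := eval_bound hmu hnu v0 neq.
exists (u +i* v), (2 * M ^+ 2); split; first by rewrite /= gt_eqF.
move=> N; set z := u +i* v.
pose x n := Re (Pz s z n); pose y n := Im (Pz s z n).
have H (w : nat -> R) : 0 < \sum_(n < N) w n ^+ 2 ->
    `|\sum_(n < N) w n * x n| <= M * Num.sqrt (\sum_(n < N) w n ^+ 2) /\
    `|\sum_(n < N) w n * y n| <= M * Num.sqrt (\sum_(n < N) w n ^+ 2).
  move=> w0; have [ipE /(_ z) cE'] := ip_comb w N.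
  have := HM _ (Num.sqrt (\sum_(n < N) w n ^+ 2)) _ _; rewrite sqrtr_gt0 => /(_ _ w0).
  move=> /(_ (\sum_(n < N) w n *: opoly s n)); rewrite sqr_sqrtr ?(ltW w0)// => /(_ ipE).
  rewrite -/z cE' cRe_sum cIm_sum => -[h1 h2]; split.
    by move: h1; congr (`|_| <= _); apply: eq_bigr => n _; rewrite !cE /=; ring.
  by move: h2; congr (`|_| <= _); apply: eq_bigr => n _; rewrite !cE /=; ring.
have Sx : \sum_(n < N) x n ^+ 2 <= M ^+ 2.
  apply: le_of_le_sqrt => //; first by apply: sumr_ge0 => n _; exact: sqr_ge0.
  by move=> /H[h _]; apply: le_trans h; apply: le_trans (ler_norm _).
have Sy : \sum_(n < N) y n ^+ 2 <= M ^+ 2.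
  apply: le_of_le_sqrt => //; first by apply: sumr_ge0 => n _; exact: sqr_ge0.
  by move=> /H[_ h]; apply: le_trans h; apply: le_trans (ler_norm _).
have -> : sq N (Pz s z) = \sum_(n < N) x n ^+ 2 + \sum_(n < N) y n ^+ 2.
  by rewrite -big_split; apply: eq_bigr => n _; exact: cmod_sq.
by rewrite mulr_natl mulr2n lerD.
Qed.

End IndeterminateBound.


Theorem theorem8p4 (R : realType) (s : nat -> R)
  (s0 : s 0%N = 1)
  (s_pd : positive_definite_seq s)
  (s_indet : indeterminate s)
  (f : R[i] -> R[i])
  (f_entry : f = nev_a s \/ f = nev_b s \/ f = nev_c s \/ f = nev_d s) :
  exists C : R, \forall r \near +oo,
    `|charF (jacobi_op s) r - nevanlinna_char f r| <= C * ln r.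
Proof.
have [z [A [z_im z_bnd]]] := indeterminate_bnd s0 s_pd s_indet.
have [c Hc] := characteristic_compare s0 s_pd z_im z_bnd f_entry.
exists c; apply: filterS (nbhs_pinfty_ge (num_real (expR 1))) => r re.
by rewrite (charFE s0 s_pd z_im z_bnd (lt_le_trans (expR_gt0 1) re)); exact: Hc.
Qed.
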